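(* Let $\mu=\mathcal N(0,\Sigma_\mu)$ and $\nu=\mathcal N(0,\Sigma_\nu)$ be Gaussian measures on $\mathbb R^n$ with $\Sigma_\mu,\Sigma_\nu\succ0$ and $[\Sigma_\mu,\Sigma_\nu]=\Sigma_\mu\Sigma_\nu-\Sigma_\nu\Sigma_\mu=0$. Consider the $L^2$-OCD dynamics $$\dot X_t=Y_t-\mathbb E_{p_t}[Y_t\mid X_t],\qquad \dot Y_t=X_t-\mathbb E_{p_t}[X_t\mid Y_t],$$ where $p_t$ is the joint law of $(X_t,Y_t)$, initialized with independent samples $(X_0,Y_0)\sim\mu\otimes\nu$, and let $J_t=\mathbb E[X_tY_t^\top]$ denote the cross-correlation. Let $$J_{\mathrm{OT}}=\Sigma_\mu^{1/2}\big(\Sigma_\mu^{1/2}\Sigma_\nu\Sigma_\mu^{1/2}\big)^{1/2}\Sigma_\mu^{-1/2}$$ be the Gaussian optimal transport cross-correlation. Then $J_t\to J_{\mathrm{OT}}$ exponentially fast: there exist constants $C>0$ and $\kappa>0$ such that $$\|J_t-J_{\mathrm{OT}}\|_2\le C\,e^{-2\kappa t}\qquad\text{for all }t\ge0,$$ where $\|\cdot\|_2$ denotes the spectral norm. Moreover, expressing $\Sigma_\mu=Q\,\mathrm{diag}(\sigma_{\mu,i})\,Q^\top$ and $\Sigma_\nu=Q\,\mathrm{diag}(\sigma_{\nu,i})\,Q^\top$ in a common orthonormal basis, this holds with $$\kappa=\min_{1\le i\le n}\Big(\sqrt{\tfrac{\sigma_{\nu,i}}{\sigma_{\mu,i}}}+\sqrt{\tfrac{\sigma_{\mu,i}}{\sigma_{\nu,i}}}\Big)\ge2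 .$$
   Context: Setting: in this Gaussian setting, the joint law $p_t$ of the $L^2$-OCD dynamics is taken to be (centered) Gaussian with marginals $\mu,\nu$, so that $\mathbb E_{p_t}[Y_t\mid X_t]=J_t^\top\Sigma_\mu^{-1}X_t$ and $\mathbb E_{p_t}[X_t\mid Y_t]=J_t\Sigma_\nu^{-1}Y_t$, and $J_t$ satisfies the matrix Riccati equation $$\partial_tJ_t=\Sigma_\mu+\Sigma_\nu-J_t^\top\Sigma_\mu^{-1}J_t-J_t\Sigma_\nu^{-1}J_t^\top,\qquad J_0=0 .$$ *)

(* Defs.v *)
From mathcomp Require Import all_boot all_order all_algebra.
From mathcomp Require Import all_classical all_reals all_analysis.
Import Order.TTheory GRing.Theory Num.Theory.
Import numFieldNormedType.Exports.

Set Implicit Arguments.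
Unset Strict Implicit.
Unset Printing Implicit Defensive.

Local Open Scope classical_set_scope.
Local Open Scope ring_scope.

Section LinearAlgebra.
Context {R : realType}.

Definition symmx m (A : 'M[R]_m) : Prop := A^T = A.

Definition posdefmx m (A : 'M[R]_m) : Prop :=
  symmx A /\ forall x : 'cV[R]_m, x != 0 -> 0 < (x^T *m A *m x) 0 0.

Definition possemidefmx m (A : 'M[R]_m) : Prop :=
  symmx A /\ forall x : 'cV[R]_m, 0 <= (x^T *m A *m x) 0 0.

(* The principal square root A^{1/2} of a positive semidefinite A: its unique
   positive semidefinite square root (0 if A has none). *)
Definition sqrtmx m (A : 'M[R]_m) : 'M[R]_m :=
  xget 0 [set S | possemidefmx S /\ S *m S = A].

Definition l2norm m (x : 'cV[R]_m) : R := Num.sqrt (\sum_(i < m) x i 0 ^+ 2).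

Definition spectral_norm m n (A : 'M[R]_(m, n)) : R :=
  sup [set l2norm (A *m x) | x in [set x : 'cV[R]_n | l2norm x <= 1]].

Definition J_OT m (Smu Snu : 'M[R]_m) : 'M[R]_m :=
  sqrtmx Smu *m sqrtmx (sqrtmx Smu *m Snu *m sqrtmx Smu)
    *m invmx (sqrtmx Smu).

Definition kappa_i m (smu snu : 'rV[R]_m) (i : 'I_m) : R :=
  Num.sqrt (snu 0 i / smu 0 i) + Num.sqrt (smu 0 i / snu 0 i).

(* The minimum of kappa_i over the (nonempty) index set 'I_m.+1; the initial
   value kappa_i 0 of the iterated minimum is itself one of the terms. *)
Definition kappa_min m (smu snu : 'rV[R]_m.+1) : R :=
  \big[Num.min/kappa_i smu snu ord0]_(i < m.+1) kappa_i smu snu i.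

End LinearAlgebra.

Section RandomVectors.
Context {R : realType} {d : measure_display} {T : measurableType d}.
Variable P : probability T R.

Definition coord m (Z : T -> 'cV[R]_m) (i : 'I_m) : T -> R := fun w => Z w i 0.

Definition sigma_of m (Z : T -> 'cV[R]_m) : set_system T :=
  <<s [set A | exists i (B : set (measurableTypeR R)),
               measurable B /\ A = coord Z i @^-1` B] >>.

Definition independent_vectors m (Z W : T -> 'cV[R]_m) : Prop :=
  forall A B, sigma_of Z A -> sigma_of W B ->
    P (A `&` B) = (P A * P B)%E.

(* M is a version of the conditional expectation E[V | G]. *)
Definition is_cond_exp (G : set_system T) (V M : T -> R) : Prop :=
  [/\ forall B : set (measurableTypeR R), measurable B -> G (M @^-1` B),
      P.-integrable setT (EFin \o M) &
      forall A, G A ->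
        (\int[P]_(w in A) (M w)%:E = \int[P]_(w in A) (V w)%:E)%E].

(* The law N(0, v) on the line, with variance v >= 0. The degenerate case is
   separate because the library's normal_prob is not a Dirac mass for s = 0. *)
Definition normal_law (v : R) : set (measurableTypeR R) -> \bar R :=
  if v == 0 then dirac (0 : measurableTypeR R)
  else normal_prob 0 (Num.sqrt v).

(* Z has law N(0, S), with S possibly singular: every linear form u Z has law
   N(0, u S u^T). *)
Definition centered_gaussian m (S : 'M[R]_m) (Z : T -> 'cV[R]_m) : Prop :=
  [/\ possemidefmx S,
      forall i, measurable_fun setT (coord Z i) &
      forall (u : 'rV[R]_m) (B : set (measurableTypeR R)), measurable B ->
        P ((fun w => (u *m Z w) 0 0) @^-1` B)
        = normal_law ((u *m S *m u^T) 0 0) B].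

Definition jointly_gaussian m (Z W : T -> 'cV[R]_m) : Prop :=
  exists S : 'M[R]_(m + m),
    centered_gaussian S (fun w => col_mx (Z w) (W w)).

Definition cross_corr m (Z W : T -> 'cV[R]_m) : 'M[R]_m :=
  \matrix_(i, j) fine ('E_P[(coord Z i \* coord W j)%R])%E.

Definition C1_path (f : R -> R) : Prop :=
  [/\ {within `[0, +oo[, continuous f},
      forall t, 0 < t -> derivable f t 1 &
      forall t, 0 < t -> {for t, continuous (derive1 f)}].

(* E[W t | Z t] is only defined up to a null set depending on t, so
   the equation dZ/dt = W - E[W | Z] is required almost surely at each time,
   along trajectories that are almost surely continuous on [0, +oo[ and
   continuously differentiable on ]0, +oo[. *)
Definition OCD_equation m (Z W : R -> T -> 'cV[R]_m) : Prop :=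
  (forall i, {ae P, forall w, C1_path (fun t => coord (Z t) i w)}) /\
  (forall t i, 0 < t ->
     exists M : T -> R,
       is_cond_exp (sigma_of (Z t)) (coord (W t) i) M /\
       {ae P, forall w,
         derive1 (fun s => coord (Z s) i w) t = coord (W t) i w - M w}).

Definition L2_OCD m (X Y : R -> T -> 'cV[R]_m) : Prop :=
  OCD_equation X Y /\ OCD_equation Y X.

End RandomVectors.

(* Main.v *)
From Pilot Require Import Defs.
From mathcomp Require Import all_boot all_order all_algebra.
From mathcomp Require Import all_classical all_reals all_analysis.
From mathcomp Require complex.
From mathcomp Require Import measurable_realfun normal_distribution ring lra.
Import Order.TTheory GRing.Theory Num.Theory.
Import numFieldNormedType.Exports.

Set Implicit Arguments.
Unset Strict Implicit.
Unset Printing Implicit Defensive.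

Local Open Scope classical_set_scope.
Local Open Scope ring_scope.

Import Pilot.Defs.

(** Write J t for the cross-correlation matrix of X t and Y t.

    The conditional expectations are linear.  At a fixed time let W be a
    coordinate of Y t minus its linear regression on X t.  It is uncorrelated
    with X t, so a W + u X and - a W + u X have the same variance, hence the
    same Gaussian law, for all a and u.  Testing this symmetry on sin and cos
    shows that W is orthogonal to every trigonometric polynomial of X t, and
    bounded pointwise limits carry this to all events of the sigma-algebra of
    X t (sym_Ex_indic).  So W has conditional expectation 0, and E[Y t | X t]
    is the regression (gauss_cond_exp).  At time 0 independence makes 0 a
    version of E[Y 0 | X 0] too, whence J 0 = 0 (indep_cross_corr0).

    J solves the Riccati equation.  Along almost every trajectory the product
    of a coordinate of X and one of Y is continuously differentiable, so its
    increment over a segment [s, t] of positive times is a limit of Riemann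
    sums of its derivative, and the expectation of the derivative at time r is
    an entry of riccati (J r).  The marginals do not depend on time, so these
    derivatives are bounded in L2 uniformly in time; bounded L2 norms let
    expectations pass to the limit (L2_bounded_cvg_Ex).  Hence J is Lipschitz
    up to time 0 (cross_corr_lip) and differentiable at positive times with
    derivative riccati (J t) (cross_corr_riccati).

    The Riccati equation is explicit in a common eigenbasis Q.  With
    eigenvalues a_i and b_i it decouples into
    k_i' = a_i + b_i - (1 / a_i + 1 / b_i) k_i ^ 2, solved from 0 by
    sqrt (a_i b_i) tanh (kappa_i t).  A Gronwall argument (riccati_unique)
    identifies J with this solution (riccati_sol).  The limit
    Q diag (sqrt (a_i b_i)) Q^T is J_OT, because positive definite square
    roots are unique (sqrtmx_eq), and 1 - tanh x <= 2 exp (- 2 x) gives the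
    rate.  Finally kappa_i has the form x + 1 / x, so it is at least 2.

    The first claim follows from the second one, since commuting real symmetric
    matrices have a common orthonormal eigenbasis (sym_codiag). *)

(** * Moments of centered normal laws *)

Section NormalLaw.
Context {R : realType}.
Local Notation mu := (@lebesgue_measure R).

(** The density defines normal_prob on sets only; the Radon-Nikodym
    derivative, which is almost everywhere equal to it, transports it to
    integrals. *)
Lemma ge0_integral_normal_prob (m s : R) (f : R -> \bar R) :
  measurable_fun setT f -> (forall x, 0 <= f x)%E ->
  (\int[normal_prob m s]_x f x = \int[mu]_x (f x * (normal_pdf m s x)%:E))%E.
Proof.
move=> mf f0.
have dom := @normal_prob_dominates R m s.
rewrite -(Radon_Nikodym_SigmaFinite.change_of_variables dom f0 measurableT mf).
have mpdf : measurable_fun setT (fun x => (normal_pdf m s x)%:E : \bar R).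
  by apply/measurable_EFinP; exact: measurable_normal_pdf.
apply: ae_eq_integral => //.
- apply: emeasurable_funM => //.
  exact: measurable_int (Radon_Nikodym_SigmaFinite.f_integrable dom).
- exact: emeasurable_funM.
apply: ae_eqe_mul2l => /=.
apply: integral_ae_eq => //=.
  exact: Radon_Nikodym_SigmaFinite.f_integrable.
move=> E _ mE.
by rewrite -(Radon_Nikodym_SigmaFinite.f_integral dom).
Qed.

Lemma sqr_expRN_le (y : R) : 0 <= y -> y ^+ 2 * expR (- y) <= 2.
Proof.
move=> y0; have := expR_ge1Dxn 1 y0; rewrite expRN => h.
rewrite ler_pdivrMr ?expR_gt0//.
have -> : 2 * expR y = expR y * 2 by rewrite mulrC.
rewrite -ler_pdivrMr//; apply: le_trans h.
by rewrite lerDr ler01.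
Qed.

(** Half of the exponent absorbs the fourth power, through y ^ 2 exp (- y) <=
    2, and the other half is a normal density with variance 2 s ^ 2. This
    reduces integrability of the fourth power to that of a density. *)
Lemma normal_pdf_expr4_le (s : R) : 0 < s -> exists K : R, forall x,
  0 <= K /\ x ^+ 4 * normal_pdf 0 s x <= K * normal_pdf 0 (Num.sqrt 2 * s) x.
Proof.
move=> s0.
have s20 : 0 < Num.sqrt 2 * s by rewrite mulr_gt0// sqrtr_gt0.
exists (32 * s ^+ 4 * normal_peak s / normal_peak (Num.sqrt 2 * s)) => x.
have p0 := normal_peak_gt0 (lt0r_neq0 s0).
have p20 := normal_peak_gt0 (lt0r_neq0 s20).
split; first by rewrite ltW// divr_gt0// mulr_gt0// mulr_gt0 ?exprn_gt0.
have pdfE (r : R) : 0 < r -> normal_pdf 0 r x = normal_peak r * normal_fun 0 r x.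
  by move=> r0; rewrite /normal_pdf gt_eqF.
rewrite !pdfE//.
have -> : 32 * s ^+ 4 * normal_peak s / normal_peak (Num.sqrt 2 * s) *
    (normal_peak (Num.sqrt 2 * s) * normal_fun 0 (Num.sqrt 2 * s) x) =
    normal_peak s * (32 * s ^+ 4 * normal_fun 0 (Num.sqrt 2 * s) x).
  by field; rewrite gt_eqF.
rewrite mulrCA ler_wpM2l ?(ltW p0)//.
rewrite /normal_fun subr0.
set y := x ^+ 2 / (4 * s ^+ 2).
have y0 : 0 <= y by rewrite /y mulr_ge0 ?sqr_ge0// invr_ge0 mulr_ge0 ?sqr_ge0.
have sn0 : s != 0 by rewrite gt_eqF.
have -> : - x ^+ 2 / (s ^+ 2 *+ 2) = - y - y by rewrite /y; field.
have -> : - x ^+ 2 / ((Num.sqrt 2 * s) ^+ 2 *+ 2) = - y.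
  by rewrite /y exprMn sqr_sqrtr//; field.
have -> : x ^+ 4 = 16 * s ^+ 4 * y ^+ 2 by rewrite /y; field.
rewrite expRD.
have := sqr_expRN_le y0.
set e := expR (- y) => h.
have e0 : 0 < e by exact: expR_gt0.
have -> : 16 * s ^+ 4 * y ^+ 2 * (e * e) = (16 * s ^+ 4 * e) * (y ^+ 2 * e) by ring.
have -> : 32 * s ^+ 4 * e = (16 * s ^+ 4 * e) * 2 by ring.
rewrite ler_wpM2l// mulr_ge0 ?(ltW e0)// mulr_ge0// exprn_even_ge0//.
Qed.

Lemma integrable_expr4_normal_pdf (s : R) : 0 < s ->
  mu.-integrable setT (fun x => (x ^+ 4 * normal_pdf 0 s x)%:E).
Proof.
move=> s0; have [K hK] := normal_pdf_expr4_le s0.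
apply: (@le_integrable _ _ R mu _ measurableT _ (fun x : R => (K%:E * (normal_pdf 0 (Num.sqrt 2 * s) x)%:E)%E)).
- apply/measurable_EFinP; apply: measurable_funM; last exact: measurable_normal_pdf.
  exact: measurable_funX.
- move=> x _; have [K0 hx] := hK x.
  rewrite -EFinM !abse_EFin lee_fin !ger0_norm//.
    by rewrite mulr_ge0// normal_pdf_ge0.
  by rewrite mulr_ge0 ?normal_pdf_ge0// exprn_even_ge0.
- by apply: integrableZl => //; exact: integrable_normal_pdf.
Qed.

Lemma integrable_expr2_normal_pdf (s : R) : 0 < s ->
  mu.-integrable setT (fun x => (x ^+ 2 * normal_pdf 0 s x)%:E).
Proof.
move=> s0.
have := integrableD measurableT (integrable_expr4_normal_pdf s0) (@integrable_normal_pdf R 0 s).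
apply: le_integrable => //.
  apply/measurable_EFinP; apply: measurable_funM; last exact: measurable_normal_pdf.
  exact: measurable_funX.
move=> x _ /=; rewrite lee_fin.
have p0 := normal_pdf_ge0 0 s x.
have x4 : 0 <= x ^+ 4 by rewrite exprn_even_ge0.
rewrite !ger0_norm; last 2 first.
- by rewrite addr_ge0// mulr_ge0.
- by rewrite mulr_ge0// sqr_ge0.
have -> : x ^+ 4 * normal_pdf 0 s x + normal_pdf 0 s x = (x ^+ 4 + 1) * normal_pdf 0 s x by ring.
rewrite ler_wpM2r//.
have -> : x ^+ 4 = (x ^+ 2) ^+ 2 by ring.
set z := x ^+ 2; have := sqr_ge0 (z - 1 / 2); have -> : (z - 1/2)^+2 = z^+2 - z + 1/4 by field.
lra.
Qed.

Let cpdf (s x : R) : R := normal_peak s * expR (- x ^+ 2 / (s ^+ 2 *+ 2)).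

Let cpdfE (s x : R) : 0 < s -> normal_pdf 0 s x = cpdf s x.
Proof. by move=> s0; rewrite /normal_pdf gt_eqF// /normal_fun subr0. Qed.

Let F (s x : R) : R := - s ^+ 2 * (x * cpdf s x).

Let is_derive_F (s x : R) : 0 < s ->
  is_derive x 1 (F s) (x ^+ 2 * cpdf s x - s ^+ 2 * cpdf s x).
Proof.
move=> s0; rewrite /F /cpdf; apply: is_derive_eq.
rewrite /GRing.scale /=; field.
by rewrite gt_eqF.
Qed.

Let measurable_sec (s : R) : measurable_fun setT
  (fun x : R => x ^+ 2 * normal_pdf 0 s x - s ^+ 2 * normal_pdf 0 s x).
Proof.
apply: measurable_funB; apply: measurable_funM => //; try exact: measurable_normal_pdf.
Qed.

Let integrable_sec (s : R) : 0 < s -> mu.-integrable setT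
  (fun x : R => (x ^+ 2 * normal_pdf 0 s x - s ^+ 2 * normal_pdf 0 s x)%:E).
Proof.
move=> s0.
have := integrableB measurableT (integrable_expr2_normal_pdf s0)
  (integrableZl measurableT (s ^+ 2) (@integrable_normal_pdf R 0 s)).
by apply: eq_integrable => // x _ /=; rewrite EFinB EFinM.
Qed.

Let derivable_sec (s x : R) :
  derivable (fun x : R => x ^+ 2 * cpdf s x - s ^+ 2 * cpdf s x) x 1.
Proof. by rewrite /cpdf; exact: ex_derive. Qed.

Let integral_sec_itv (s : R) (k : nat) : 0 < s ->
  (\int[mu]_(x in `[(- k.+1%:R)%R, k.+1%:R]) (x ^+ 2 * normal_pdf 0 s x - s ^+ 2 * normal_pdf 0 s x)%:E
   = (F s k.+1%:R)%:E - (F s (- k.+1%:R))%:E)%E.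
Proof.
move=> s0.
under eq_integral do rewrite cpdfE//.
have dF x := is_derive_F x s0.
have dvF x : derivable (F s) x 1 by have := dF x => -[].
have cF : continuous (F s).
  by move=> x; apply: differentiable_continuous; exact/derivable1_diffP.
apply: continuous_FTC2.
- by rewrite (@lt_trans _ _ 0)// ?oppr_lt0.
- apply: continuous_subspaceT => x.
  exact/differentiable_continuous/derivable1_diffP/derivable_sec.
- split => //.
  + by apply: cvg_at_right_filter; exact: cF.
  + by apply: cvg_at_left_filter; exact: cF.
- by move=> x _; rewrite derive1E derive_val.
Qed.

Let cvg_F (s : R) : 0 < s -> F s k.+1%:R @[k --> \oo] --> 0.
Proof.
move=> s0.
pose C := 2 * s ^+ 4 * normal_peak s.
have bound (k : nat) : `|F s k.+1%:R| <= C * k.+1%:R^-1.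
  have k0 : 0 < k.+1%:R :> R by [].
  have sn0 : s != 0 by rewrite gt_eqF.
  have p0 := normal_peak_gt0 sn0.
  set y := k.+1%:R ^+ 2 / (s ^+ 2 *+ 2).
  have y0 : 0 < y by rewrite divr_gt0 ?exprn_gt0// pmulrn_lgt0// exprn_gt0.
  rewrite /F /cpdf mulNr -/y.
  have e : expR (- k.+1%:R ^+ 2 / (s ^+ 2 *+ 2)) <= y^-1.
    rewrite mulNr expRN lef_pV2 ?posrE ?expR_gt0//.
    by rewrite (le_trans _ (expR_ge1Dx y))// lerDr.
  rewrite mulNr normrN ger0_norm; last first.
    by rewrite mulr_ge0 ?sqr_ge0// mulr_ge0// mulr_ge0 ?(ltW p0) ?expR_ge0.
  have -> : C * k.+1%:R^-1 = s ^+ 2 * (k.+1%:R * (normal_peak s * y^-1)).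
    by rewrite /C /y; move: (k.+1%:R) k0 => K K0; field; rewrite sn0 gt_eqF.
  by rewrite ler_wpM2l ?sqr_ge0// ler_wpM2l// ler_wpM2l ?(ltW p0)// -mulNr.
apply: norm_cvg0.
apply: (@squeeze_cvgr _ _ _ _ (fun=> 0) (fun k => C * k.+1%:R^-1)).
- by apply: nearW => k; rewrite normr_ge0 bound.
- exact: cvg_cst.
- rewrite -[X in _ --> X](mulr0 C); apply: cvgM; first exact: cvg_cst.
  exact: cvg_harmonic.
Qed.

(** The function (x ^ 2 - s ^ 2) times the density is the derivative of - s ^
    2 x times the density, which vanishes at infinity. So its integral over a
    symmetric segment tends to 0, and dominated convergence gives 0 on the
    whole line. *)
Lemma integral_sqr_normal_pdf (s : R) : 0 < s ->
  (\int[mu]_x (x ^+ 2 * normal_pdf 0 s x)%:E = (s ^+ 2)%:E)%E.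
Proof.
move=> s0.
set f := fun x : R => x ^+ 2 * normal_pdf 0 s x - s ^+ 2 * normal_pdf 0 s x.
have intf := integrable_sec s0.
suff f0 : (\int[mu]_x (f x)%:E = 0)%E.
  have : (\int[mu]_x (f x)%:E = \int[mu]_x (x ^+ 2 * normal_pdf 0 s x)%:E
      - (s ^+ 2)%:E)%E.
    rewrite /f; under eq_integral do rewrite EFinB EFinM [X in (_ - X)%E]EFinM.
    rewrite integralB//; last 2 first.
    - by have := integrable_expr2_normal_pdf s0.
    - by apply: integrableZl => //; exact: integrable_normal_pdf.
    rewrite integralZl//; last exact: integrable_normal_pdf.
    by rewrite integral_normal_pdf mule1.
  have fin := integrable_fin_num measurableT (integrable_expr2_normal_pdf s0).
  rewrite f0 -(fineK fin) -EFinB => -[/esym/eqP].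
  by rewrite subr_eq0 => /eqP ->.
pose fk (k : nat) (x : R) := ((f \_ `[(- k.+1%:R)%R, k.+1%:R]) x)%:E.
have m1 k : measurable_fun setT (fk k).
  apply/measurable_EFinP; apply/(measurable_restrictT _ (measurable_itv _)).
  by apply: measurable_funTS; exact: measurable_sec.
have m2 : measurable_fun setT (EFin \o f).
  by apply/measurable_EFinP; exact: measurable_sec.
have cvgf : {ae mu, forall x, setT x -> fk ^~ x @ \oo --> (EFin \o f) x}.
  apply: aeW => x _ /=; apply/fine_cvgP; split; first exact: nearW.
  apply: cvg_near_cst; near=> k; rewrite /fk /= patchE ifT//.
  rewrite inE /= in_itv /= -ler_norml.
  near: k; exists (Num.truncn `|x|) => // k /= xk.
  by rewrite (le_trans (ltW (truncnS_gt _)))// ler_nat ltnS.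
have dom : {ae mu, forall x k, setT x -> (`|fk k x| <= `|(f x)%:E|)%E}.
  apply: aeW => x k _ /=; rewrite lee_fin patchE; case: ifPn => //.
  by rewrite normr0.
have [_ _ h] := @dominated_convergence _ _ R mu setT measurableT fk (EFin \o f) _
  m1 m2 cvgf (integrable_abse intf) dom.
rewrite -(cvg_lim _ h)//=.
apply/cvg_lim => //.
under eq_fun => k.
  rewrite (_ : (\int[mu]_x _)%E = (\int[mu]_(x in `[(- k.+1%:R)%R, k.+1%:R]) (f x)%:E)%E); last first.
    rewrite [RHS]integral_mkcond; apply: eq_integral => x _.
    by rewrite /fk !patchE; case: ifPn.
  rewrite (integral_sec_itv k s0).
  have -> : F s (- k.+1%:R) = - F s k.+1%:R.
    by rewrite /F /cpdf sqrrN; ring.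
  rewrite -EFinB opprK.
  over.
apply: cvg_EFin; first exact: nearW.
rewrite -[X in _ --> X](addr0 (0:R)).
by apply: cvgD; exact: cvg_F.
Unshelve. all: by end_near. Qed.
End NormalLaw.

(** * Expectations depend on the law only *)

Section Laws.
Context {R : realType} {d : measure_display} {T : measurableType d}.
Variable P : probability T R.

Lemma eq_law_ge0_integral (m : {measure set (measurableTypeR R) -> \bar R}) (Z : T -> R)
    (f : R -> \bar R) :
  measurable_fun setT Z -> measurable_fun setT f -> (forall x, 0 <= f x)%E ->
  (forall B, measurable B -> P (Z @^-1` B) = m B) ->
  (\int[P]_w f (Z w) = \int[m]_x f x)%E.
Proof.
move=> mZ mf f0 law.
rewrite -(@ge0_integral_pushforward _ _ T (measurableTypeR R) R Z mZ P setT f measurableT mf); last by move=> x _.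
by apply: eq_measure_integral => //= A mA _; rewrite -law.
Qed.

Lemma eq_law_integral (Z Z' : T -> R) (f : R -> R) :
  measurable_fun setT Z -> measurable_fun setT Z' -> measurable_fun setT f ->
  (forall x, `|f x| <= 1) ->
  (forall B : set (measurableTypeR R), measurable B -> P (Z @^-1` B) = P (Z' @^-1` B)) ->
  (\int[P]_w (f (Z w))%:E = \int[P]_w (f (Z' w))%:E)%E.
Proof.
move=> mZ mZ' mf f1 law.
have int (W : T -> R) : measurable_fun setT W -> P.-integrable setT (EFin \o f \o W).
  move=> mW; apply: measurable_bounded_integrable => //.
  - by rewrite -ge0_fin_numE ?fin_num_measure.
  - exact: (measurableT_comp mf mW).
  - exists 1; split => // x x1 w _; exact: le_trans (f1 _) (ltW x1).
have mf' : measurable_fun setT (EFin \o f) by exact/measurable_EFinP.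
have := @integral_pushforward _ _ T (measurableTypeR R) R Z mZ P setT (EFin \o f) mf' (int _ mZ) measurableT.
have := @integral_pushforward _ _ T (measurableTypeR R) R Z' mZ' P setT (EFin \o f) mf' (int _ mZ') measurableT.
rewrite !preimage_setT /= => <- <-.
by apply: eq_measure_integral => //= A mA _; exact: law.
Qed.

(** The variance 0 is treated apart, because normal_law is then a Dirac mass
    without density. *)
Lemma normal_law_moments (v : R) (Z : T -> R) : 0 <= v ->
  measurable_fun setT Z ->
  (forall B : set (measurableTypeR R), measurable B -> P (Z @^-1` B) = normal_law v B) ->
  (\int[P]_w (Z w ^+ 2)%:E = v%:E)%E /\ (\int[P]_w (Z w ^+ 4)%:E < +oo)%E.
Proof.
move=> v0 mZ; rewrite /normal_law; case: eqVneq => [->|vn0] law.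
  have E (f : R -> R) : measurable_fun setT f -> (forall x, 0 <= f x) ->
     (\int[P]_w (f (Z w))%:E = (f 0)%:E)%E.
    move=> mf f0.
    have mf' : measurable_fun setT (EFin \o f) by exact/measurable_EFinP.
    have f0' x : (0 <= (EFin \o f) x)%E by rewrite lee_fin.
    rewrite (@eq_law_ge0_integral (dirac (0 : measurableTypeR R)) Z _ mZ mf' f0' law).
    by rewrite integral_dirac//= diracT mul1e.
  have E2 := E (fun x => x ^+ 2) (@exprn_measurable R setT 2) (fun x => sqr_ge0 x).
  have E4 := E (fun x => x ^+ 4) (@exprn_measurable R setT 4) (fun x => @exprn_even_ge0 R 4 x isT).
  by rewrite E2 E4 !expr0n; split => //; rewrite ltry.
have vgt0 : 0 < v by rewrite lt_def vn0.
have s0 : 0 < Num.sqrt v by rewrite sqrtr_gt0.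
have E (f : R -> R) : measurable_fun setT f -> (forall x, 0 <= f x) ->
   (\int[P]_w (f (Z w))%:E =
    \int[lebesgue_measure]_x (f x * normal_pdf 0 (Num.sqrt v) x)%:E)%E.
  move=> mf f0.
  have mf' : measurable_fun setT (EFin \o f) by exact/measurable_EFinP.
  have f0' x : (0 <= (EFin \o f) x)%E by rewrite lee_fin.
  rewrite (@eq_law_ge0_integral (normal_prob 0 (Num.sqrt v)) Z _ mZ mf' f0' law).
  by rewrite ge0_integral_normal_prob.
have E2 := E (fun x => x ^+ 2) (@exprn_measurable R setT 2) (fun x => sqr_ge0 x).
have E4 := E (fun x => x ^+ 4) (@exprn_measurable R setT 4) (fun x => @exprn_even_ge0 R 4 x isT).
rewrite E2 E4 integral_sqr_normal_pdf// sqr_sqrtr//; split => //.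
apply: integrable_lty => //.
exact: integrable_expr4_normal_pdf.
Qed.
End Laws.

(** * Expectation, square-integrable and fourth-power-integrable variables *)

Section Expectation.
Context {R : realType} {d : measure_display} {T : measurableType d}.
Variable P : probability T R.
Implicit Types f g h : T -> R.

Definition Ex f : R := \int[P]_w f w.
Definition Int f : Prop := P.-integrable setT (EFin \o f).

Lemma Int_measurable f : Int f -> measurable_fun setT f.
Proof. by move=> /measurable_int /measurable_EFinP. Qed.

Lemma le_Int f g : measurable_fun setT f -> (forall w, `|f w| <= g w) ->
  Int g -> Int f.
Proof.
move=> mf fg; apply: (le_integrable measurableT); first exact/measurable_EFinP.
by move=> w _ /=; rewrite lee_fin (le_trans (fg w)) ?ler_norm.
Qed.

Lemma Int_cst (c : R) : Int (fun=> c).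
Proof. exact: finite_measure_integrable_cst. Qed.

Lemma IntD f g : Int f -> Int g -> Int (fun w => f w + g w).
Proof. by move=> If Ig; have := integrableD measurableT If Ig. Qed.

Lemma IntZ (c : R) f : Int f -> Int (fun w => c * f w).
Proof. by move=> If; have := integrableZl measurableT c If. Qed.

Lemma IntN f : Int f -> Int (fun w => - f w).
Proof. by move=> If; have := integrableN If. Qed.

Lemma IntB f g : Int f -> Int g -> Int (fun w => f w - g w).
Proof. by move=> If Ig; apply: IntD If (IntN Ig). Qed.

Lemma Int_sum I (s : seq I) (F : I -> T -> R) :
  (forall i, Int (F i)) -> Int (fun w => \sum_(i <- s) F i w).
Proof.
move=> IF; elim: s => [|i s IH].
  by under eq_fun do rewrite big_nil; exact: Int_cst.
by under eq_fun do rewrite big_cons; exact: IntD.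
Qed.

Lemma ExD f g : Int f -> Int g -> Ex (fun w => f w + g w) = Ex f + Ex g.
Proof. exact: RintegralD. Qed.

Lemma ExB f g : Int f -> Int g -> Ex (fun w => f w - g w) = Ex f - Ex g.
Proof. exact: RintegralB. Qed.

Lemma ExZ (c : R) f : Int f -> Ex (fun w => c * f w) = c * Ex f.
Proof. exact: RintegralZl. Qed.

Lemma Ex_cst (c : R) : Ex (fun=> c) = c.
Proof. by rewrite /Ex Rintegral_cst//= probability_setT mulr1. Qed.

Lemma Ex_sum I (s : seq I) (F : I -> T -> R) : (forall i, Int (F i)) ->
  Ex (fun w => \sum_(i <- s) F i w) = \sum_(i <- s) Ex (F i).
Proof.
move=> IF; elim: s => [|i s IH].
  by under [in LHS]eq_fun do rewrite big_nil; rewrite big_nil Ex_cst.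
under [in LHS]eq_fun do rewrite big_cons.
by rewrite big_cons -IH ExD//; exact: Int_sum.
Qed.

Lemma le_Ex f g : Int f -> Int g -> (forall w, f w <= g w) -> Ex f <= Ex g.
Proof. by move=> If Ig fg; apply: le_Rintegral => // w _; exact: fg. Qed.

Lemma Ex_ge0 f : (forall w, 0 <= f w) -> 0 <= Ex f.
Proof. by move=> f0; apply: Rintegral_ge0 => w _; exact: f0. Qed.

Lemma le_normr_Ex f : Int f -> `|Ex f| <= Ex (fun w => `|f w|).
Proof. by move=> If; apply: le_normr_Rintegral. Qed.

Lemma Ex_EFin f : Int f -> (\int[P]_w (f w)%:E = (Ex f)%:E)%E.
Proof.
by move=> If; rewrite /Ex /Rintegral fineK//; exact: integrable_fin_num.
Qed.

(** Integrability of g is part of the conclusion, so that the lemma also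
    transfers it. *)
Lemma ae_eq_Ex f g : Int f -> measurable_fun setT g ->
  {ae P, forall w, f w = g w} -> Int g /\ Ex f = Ex g.
Proof.
move=> If mg fg.
have mf := Int_measurable If.
have E : (\int[P]_w (f w)%:E = \int[P]_w (g w)%:E)%E.
  apply: ae_eq_integral => //; [exact/measurable_EFinP|exact/measurable_EFinP|].
  by apply: filterS fg => w /= ->.
split; last by rewrite /Ex /Rintegral E.
apply/integrableP; split; first exact/measurable_EFinP.
move/integrableP : If => [_]; apply: le_lt_trans.
rewrite le_eqVlt; apply/orP; left; apply/eqP.
apply: ae_eq_integral => //.
- by apply: measurableT_comp => //; exact/measurable_EFinP.
- by apply: measurableT_comp => //; exact/measurable_EFinP.
- by apply: filterS fg => w /= ->.
Qed.

Lemma dominated_convergence_Ex (f_ : nat -> T -> R) f g :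
  (forall k, measurable_fun setT (f_ k)) -> measurable_fun setT f -> Int g ->
  {ae P, forall w, f_ ^~ w @ \oo --> f w} ->
  (forall k w, `|f_ k w| <= g w) ->
  Int f /\ Ex (f_ k) @[k --> \oo] --> Ex f.
Proof.
move=> mf_ mf Ig cf dom.
have [|||||If _ c] := @dominated_convergence _ _ R P setT measurableT
  (fun k w => (f_ k w)%:E) (EFin \o f) (EFin \o g).
- by move=> k; exact/measurable_EFinP.
- exact/measurable_EFinP.
- apply: filterS cf => w /= cw _; apply: cvg_EFin => //.
  exact: nearW.
- exact: Ig.
- by apply: aeW => w k _ /=; rewrite lee_fin.
split => //.
apply: fine_cvg; rewrite fineK//; exact: integrable_fin_num.
Qed.

Definition L2 f : Prop := measurable_fun setT f /\ Int (fun w => f w ^+ 2).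
Definition L4 f : Prop := measurable_fun setT f /\ Int (fun w => f w ^+ 4).

Lemma L4_L2 f : L4 f -> L2 f.
Proof.
move=> [mf If]; split => //.
apply: (@le_Int _ (fun w => f w ^+ 4 + 1)).
- exact: measurable_funX.
- move=> w; rewrite ger0_norm ?sqr_ge0//.
  have := sqr_ge0 (f w ^+ 2 - 1); nra.
- exact: IntD If (Int_cst _).
Qed.

Lemma L2_Int_mul f g : L2 f -> L2 g -> Int (fun w => f w * g w).
Proof.
move=> [mf If] [mg Ig].
apply: (@le_Int _ (fun w => f w ^+ 2 + g w ^+ 2)).
- exact: measurable_funM.
- move=> w; rewrite ler_norml; have := sqr_ge0 (f w + g w).
  have := sqr_ge0 (f w - g w); have := sqr_ge0 (f w); have := sqr_ge0 (g w).
  by move=> *; apply/andP; split; nra.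
- exact: IntD.
Qed.

Lemma L2_cst c : L2 (fun=> c).
Proof. by split; [exact: measurable_cst|exact: Int_cst]. Qed.

Lemma L4_cst c : L4 (fun=> c).
Proof. by split; [exact: measurable_cst|exact: Int_cst]. Qed.

Lemma L2_Int f : L2 f -> Int f.
Proof.
move=> L; have := L2_Int_mul L (L2_cst 1).
by under eq_fun do rewrite mulr1.
Qed.

Lemma L2D f g : L2 f -> L2 g -> L2 (fun w => f w + g w).
Proof.
move=> Lf Lg; have [mf If] := Lf; have [mg Ig] := Lg; split.
  exact: measurable_funD.
under eq_fun => w do rewrite sqrrD -mulr_natl.
exact: IntD (IntD If (IntZ _ (L2_Int_mul Lf Lg))) Ig.
Qed.

Lemma L2Z c f : L2 f -> L2 (fun w => c * f w).
Proof.
move=> [mf If]; split; first exact: measurable_funM.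
by under eq_fun do rewrite exprMn; exact: IntZ.
Qed.

Lemma L4D f g : L4 f -> L4 g -> L4 (fun w => f w + g w).
Proof.
move=> [mf If] [mg Ig]; split; first exact: measurable_funD.
apply: (@le_Int _ (fun w => 8 * (f w ^+ 4 + g w ^+ 4))).
- by apply: measurable_funX; exact: measurable_funD.
- move=> w; rewrite ger0_norm ?exprn_even_ge0//.
  move: (f w) (g w) => x y.
  have h : (x + y) ^+ 2 <= 2 * (x ^+ 2 + y ^+ 2).
    by have := sqr_ge0 (x - y); nra.
  have -> : (x + y) ^+ 4 = ((x + y) ^+ 2) ^+ 2 by ring.
  apply: (@le_trans _ _ ((2 * (x ^+ 2 + y ^+ 2)) ^+ 2)).
    by rewrite ler_sqr ?nnegrE ?sqr_ge0// mulr_ge0// addr_ge0 ?sqr_ge0.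
  by have := sqr_ge0 (x ^+ 2 - y ^+ 2); nra.
- exact: IntZ (IntD If Ig).
Qed.

Lemma L4Z c f : L4 f -> L4 (fun w => c * f w).
Proof.
move=> [mf If]; split; first exact: measurable_funM.
by under eq_fun do rewrite exprMn; exact: IntZ.
Qed.

(** Products of Gaussian coordinates are handled through this lemma: fourth
    moments of the factors bound the second moment of the product. *)
Lemma L4_L2_mul f g : L4 f -> L4 g -> L2 (fun w => f w * g w).
Proof.
move=> [mf If] [mg Ig]; split; first exact: measurable_funM.
apply: (@le_Int _ (fun w => f w ^+ 4 + g w ^+ 4)).
- by apply: measurable_funX; exact: measurable_funM.
- move=> w; rewrite ger0_norm ?sqr_ge0//.
  have := sqr_ge0 (f w ^+ 2 - g w ^+ 2).
  have := sqr_ge0 (f w ^+ 2 + g w ^+ 2); nra.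
- exact: IntD.
Qed.

End Expectation.

(** * Approximating the sign by trigonometric polynomials *)

Section Sign.
Context {R : realType}.

Lemma abs_sin_le (x : R) : `|sin x| <= `|x|.
Proof.
wlog x0 : x / 0 <= x => [h|].
  by have [/h//|/ltW x0] := leP 0 x; rewrite -normrN -sinN -(normrN x) h// oppr_ge0.
have := @MVT_segment R sin cos 0 x x0 (fun y _ => is_derive_sin y) _.
case=> [|c _]; first by apply: continuous_subspaceT => y; exact: continuous_sin.
rewrite sin0 !subr0 => ->; rewrite normrM -[leRHS]mul1r.
by rewrite ler_wpM2r// cos_max.
Qed.

Lemma abs_sub_sin_le (x : R) : `|x - sin x| <= x ^+ 2.
Proof.
wlog x0 : x / 0 <= x => [h|].
  have [/h//|/ltW x0] := leP 0 x.
  rewrite -normrN -sqrrN (le_trans _ (h (- x) _)) ?oppr_ge0//.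
  by rewrite sinN opprB opprK addrC.
have [|c] := @MVT_segment R sin cos 0 x x0 (fun y _ => is_derive_sin y) _.
  by apply: continuous_subspaceT => y; exact: continuous_sin.
rewrite in_itv /= sin0 !subr0 => /andP[c0 cx] ->.
have [|e] := @MVT_segment R cos (fun y => - sin y) 0 c c0 (fun y _ => is_derive_cos y) _.
  by apply: continuous_subspaceT => y; exact: continuous_cos.
rewrite in_itv /= cos0 !subr0 => /andP[e0 ec] ce.
have -> : x - cos c * x = x * (1 - cos c) by ring.
rewrite normrM ger0_norm// expr2 ler_wpM2l// distrC ce normrM normrN (ger0_norm c0).
by rewrite (le_trans _ cx)// -[leRHS]mul1r ler_wpM2r// sin_max.
Qed.

(** The Newton iteration for the matrix sign, on scalars. It is a polynomial
    map of [-1, 1] into itself whose iterates converge to the sign at every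
    point, 0 included, so an algebra of functions closed under bounded
    pointwise limits is closed under the sign. *)
Definition sgn_step (s : R) : R := s * (3 - s ^+ 2) / 2.

Lemma iter_sgn_stepN k s : iter k sgn_step (- s) = - iter k sgn_step s.
Proof. by elim: k => //= k ->; rewrite /sgn_step sqrrN !mulNr. Qed.

(** The factor 1 - x / 2 - x ^ 2 / 2 by which a step multiplies the defect 1
    - x is at most 1 - s / 2 once x >= s, and the iterates increase. *)
Lemma iter_sgn_step_pos k s : 0 < s <= 1 ->
  s <= iter k sgn_step s <= 1 /\ 1 - iter k sgn_step s <= (1 - s / 2) ^+ k.
Proof.
move=> /andP[s0 s1]; elim: k => [|k [/andP[h1 h2] h3]] /=.
  by rewrite lexx s1 expr0; split => //; rewrite gerBl ltW.
move: (iter k sgn_step s) h1 h2 h3 => x h1 h2 h3.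
have x0 : 0 < x by exact: lt_le_trans h1.
have E : 1 - sgn_step x = (1 - x) * (1 - x / 2 - x ^+ 2 / 2) by rewrite /sgn_step; field.
have E' : sgn_step x - x = x * (1 - x ^+ 2) / 2 by rewrite /sgn_step; field.
have x21 : x ^+ 2 <= 1 by rewrite expr_le1// ltW.
have xx : x ^+ 2 <= x by rewrite expr2 ger_pMr.
split.
  apply/andP; split.
    rewrite (le_trans h1)// -subr_ge0 E' divr_ge0// mulr_ge0 ?subr_ge0//; exact: ltW.
  by rewrite -subr_ge0 E mulr_ge0 ?subr_ge0//; nra.
rewrite E [leRHS]exprSr.
apply: (@le_trans _ _ ((1 - x) * (1 - s / 2))).
  by rewrite ler_wpM2l ?subr_ge0//; have := sqr_ge0 x; nra.
by rewrite ler_wpM2r//; lra.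
Qed.

Lemma iter_sgn_step_le1 k s : `|s| <= 1 -> `|iter k sgn_step s| <= 1.
Proof.
move=> s1; have [s0|s0|->] := ltgtP s 0.
- have [|/andP[h1 h2] _] := @iter_sgn_step_pos k (- s).
    by rewrite oppr_gt0 s0; rewrite ltr0_norm in s1.
  rewrite -normrN -iter_sgn_stepN ger0_norm// (le_trans _ h1)// oppr_ge0; exact: ltW.
- have [|/andP[h1 h2] _] := @iter_sgn_step_pos k s.
    by rewrite s0; rewrite gtr0_norm in s1.
  by rewrite ger0_norm// (le_trans _ h1)//; exact: ltW.
- suff -> : iter k sgn_step 0 = 0 by rewrite normr0.
  by elim: k => //= k ->; rewrite /sgn_step !mul0r.
Qed.

Lemma cvg_iter_sgn_step s : `|s| <= 1 -> iter k sgn_step s @[k --> \oo] --> Num.sg s.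
Proof.
have pos (r : R) : 0 < r <= 1 -> iter k sgn_step r @[k --> \oo] --> (1 : R).
  move=> r01; have [r0 r1] := andP r01.
  apply: (@squeeze_cvgr _ _ _ _ (fun k => 1 - (1 - r / 2) ^+ k) (fun=> 1)).
  - apply: nearW => k; have [/andP[_ ->] h] := iter_sgn_step_pos k r01.
    by rewrite andbT lerBlDr -lerBlDl.
  - rewrite -[X in _ --> X]subr0; apply: cvgB; first exact: cvg_cst.
    by apply: cvg_expr; rewrite ger0_norm; lra.
  - exact: cvg_cst.
move=> s1; have [s0|s0|->] := ltgtP s 0.
- rewrite ltr0_sg//; have -> : (fun k => iter k sgn_step s) = (fun k => - iter k sgn_step (- s)).
    by apply/funext => k; rewrite -iter_sgn_stepN opprK.
  apply: cvgN; apply: pos; rewrite oppr_gt0 s0.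
  by rewrite ltr0_norm in s1.
- by rewrite gtr0_sg//; apply: pos; rewrite s0; rewrite gtr0_norm in s1.
- rewrite sgr0; apply: cvg_near_cst; apply: nearW => k.
  by elim: k => //= k ->; rewrite /sgn_step !mul0r.
Qed.

(** For k large x / (k + 1) lies in ]- pi, pi[, where the sine has the sign
    of its argument. So the sequence is eventually constant, and periodic
    functions of x detect the half-line of positive x. *)
Lemma cvg_sg_sin (x : R) : Num.sg (sin (x / k.+1%:R)) @[k --> \oo] --> Num.sg x.
Proof.
have pos (r : R) : 0 < r -> \forall k \near \oo, sin (r / k.+1%:R) > 0.
  move=> r0; exists (Num.truncn r) => // k /= rk.
  apply: sin_gt0_pi; rewrite divr_gt0//=.
  apply: (@lt_le_trans _ _ 1); last by rewrite (le_trans _ (@pi_ge2 R))// ler1n.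
  rewrite ltr_pdivrMr// mul1r (lt_le_trans (truncnS_gt _))//.
  by rewrite ler_nat ltnS.
apply: cvg_near_cst.
have [x0|x0|->] := ltgtP x 0.
- have : 0 < - x by rewrite oppr_gt0.
  move=> /pos; apply: filterS => k.
  by rewrite mulNr sinN oppr_gt0 => h; rewrite !ltr0_sg.
- by move: x0 => /[dup] x0 /pos; apply: filterS => k h; rewrite !gtr0_sg.
- by apply: nearW => k; rewrite mul0r sin0.
Qed.

End Sign.

(** * From symmetric laws to conditional mean zero *)

Section CondIndep.
Context {R : realType} {d : measure_display} {T : measurableType d}.
Variable P : probability T R.
Variables (m : nat) (X : T -> 'cV[R]_m) (W : T -> R).
Hypothesis mX : forall i, measurable_fun setT (coord X i).
Hypothesis IW : Int P W.

Definition lform (u : 'rV[R]_m) (w : T) : R := (u *m X w) 0 0.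

Lemma lformE u w : lform u w = \sum_(j < m) u 0 j * coord X j w.
Proof. by rewrite /lform mxE. Qed.

Lemma lformD u v w : lform (u + v) w = lform u w + lform v w.
Proof. by rewrite /lform mulmxDl mxE. Qed.

Lemma lformB u v w : lform (u - v) w = lform u w - lform v w.
Proof. by rewrite /lform mulmxBl !mxE. Qed.

Lemma lform_scale_delta (c : R) j w : lform (c *: delta_mx 0 j) w = c * coord X j w.
Proof. by rewrite /lform -scalemxAl -rowE !mxE. Qed.

Lemma measurable_lform u : measurable_fun setT (lform u).
Proof.
have -> : lform u = fun w => \sum_(j < m) u 0 j * coord X j w.
  by apply/funext => w; exact: lformE.
by apply: measurable_sum => j; apply: measurable_funM.
Qed.

Definition bdd_meas (h : T -> R) :=
  measurable_fun setT h /\ exists K, forall w, `|h w| <= K.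

Lemma bdd_measM h g : bdd_meas h -> bdd_meas g -> bdd_meas (fun w => h w * g w).
Proof.
move=> [mh [K hK]] [mg [L gL]]; split; first exact: measurable_funM.
by exists (K * L) => w; rewrite normrM ler_pM.
Qed.

Lemma bdd_measD h g : bdd_meas h -> bdd_meas g -> bdd_meas (fun w => h w + g w).
Proof.
move=> [mh [K hK]] [mg [L gL]]; split; first exact: measurable_funD.
by exists (K + L) => w; rewrite (le_trans (ler_normD _ _))// lerD.
Qed.

Lemma bdd_meas_cst c : bdd_meas (fun=> c).
Proof. by split => //; exists `|c|. Qed.

Lemma bdd_meas_cos u : bdd_meas (fun w => cos (lform u w)).
Proof.
split; last by exists 1 => w; exact: cos_max.
apply: (measurableT_comp _ (measurable_lform u)).
by apply: continuous_measurable_fun; exact: continuous_cos.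
Qed.

Lemma bdd_meas_sin u : bdd_meas (fun w => sin (lform u w)).
Proof.
split; last by exists 1 => w; exact: sin_max.
apply: (measurableT_comp _ (measurable_lform u)).
by apply: continuous_measurable_fun; exact: continuous_sin.
Qed.

Lemma Int_bdd h : bdd_meas h -> Int P (fun w => W w * h w).
Proof.
move=> [mh [K hK]].
have mW := Int_measurable IW.
apply: (@le_Int _ _ _ _ _ (fun w => K * `|W w|)).
- exact: measurable_funM.
- by move=> w; rewrite normrM mulrC ler_wpM2r.
- by apply: IntZ; exact: integrable_norm.
Qed.

(** Dominated convergence with dominating function K |W|. *)
Lemma bdd_cvg_Ex (g_ : nat -> T -> R) (g : T -> R) (K : R) :
  (forall k, measurable_fun setT (g_ k)) -> measurable_fun setT g ->
  (forall k w, `|g_ k w| <= K) -> (forall w, g_ ^~ w @ \oo --> g w) ->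
  Ex P (fun w => W w * g_ k w) @[k --> \oo] --> Ex P (fun w => W w * g w).
Proof.
move=> mg_ mg gK cg; have mW := Int_measurable IW.
have [|||||] // := @dominated_convergence_Ex _ _ _ P (fun k w => W w * g_ k w) (fun w => W w * g w)
  (fun w => K * `|W w|).
- by move=> k; exact: measurable_funM.
- exact: measurable_funM.
- by apply: IntZ; exact: integrable_norm.
- by apply: aeW => w; apply: cvgM; [exact: cvg_cst|exact: cg].
- by move=> k w; rewrite normrM mulrC ler_wpM2r.
Qed.

(** Orthogonality of h, for the signed measure W dP, to all trigonometric
    functions of X. Both families are needed for the class to be stable under
    multiplication by either one, through the product formulas. *)
Definition trig_orth (h : T -> R) := bdd_meas h /\ forall u,
  Ex P (fun w => W w * (h w * cos (lform u w))) = 0 /\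
  Ex P (fun w => W w * (h w * sin (lform u w))) = 0.

(** Multipliers form an algebra by construction, whereas the functions
    orthogonal to W only form a linear space; this is what makes the
    indicators among them a sigma-algebra. *)
Definition multiplier (psi : T -> R) := bdd_meas psi /\
  forall h, trig_orth h -> trig_orth (fun w => h w * psi w).

Lemma Ex_lincomb a b f g k : bdd_meas f -> bdd_meas g ->
  (forall w, k w = a * f w + b * g w) ->
  Ex P (fun w => W w * f w) = 0 -> Ex P (fun w => W w * g w) = 0 ->
  Ex P (fun w => W w * k w) = 0.
Proof.
move=> bf bg E f0 g0.
have -> : (fun w => W w * k w) = (fun w => a * (W w * f w) + b * (W w * g w)).
  by apply/funext => w; rewrite E; ring.
have := Int_bdd bf; have := Int_bdd bg => Ig If.
by rewrite ExD ?ExZ ?f0 ?g0 ?mulr0 ?addr0//; exact: IntZ.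
Qed.

Lemma multiplierM f g : multiplier f -> multiplier g ->
  multiplier (fun w => f w * g w).
Proof.
move=> [bf Mf] [bg Mg]; split; first exact: bdd_measM.
move=> h /Mf /Mg; congr trig_orth.
by apply/funext => w; rewrite mulrA.
Qed.

Lemma multiplier_cst c : multiplier (fun=> c).
Proof.
split; first exact: bdd_meas_cst.
move=> h [bh h0]; split; first by apply: bdd_measM => //; exact: bdd_meas_cst.
have bc u := bdd_measM bh (bdd_meas_cos u).
have bs u := bdd_measM bh (bdd_meas_sin u).
move=> u; have [h1 h2] := h0 u; split.
- by apply: (Ex_lincomb (a := c) (b := 0) (bc u) (bc u)) => // w; ring.
- by apply: (Ex_lincomb (a := c) (b := 0) (bs u) (bs u)) => // w; ring.
Qed.

Lemma multiplierD f g : multiplier f -> multiplier g ->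
  multiplier (fun w => f w + g w).
Proof.
move=> [bf Mf] [bg Mg]; split; first exact: bdd_measD.
move=> h scaled_tanh; have [bhf hf] := Mf _ scaled_tanh; have [bhg hg] := Mg _ scaled_tanh.
split; first by apply: bdd_measM scaled_tanh.1 _; exact: bdd_measD.
move=> u; have [h1 h2] := hf u; have [h3 h4] := hg u; split.
- apply: (@Ex_lincomb 1 1 _ _ _ _ _ _ h1 h3) => [||w]; last by ring.
  + by apply: bdd_measM => //; exact: bdd_meas_cos.
  + by apply: bdd_measM => //; exact: bdd_meas_cos.
- apply: (@Ex_lincomb 1 1 _ _ _ _ _ _ h2 h4) => [||w]; last by ring.
  + by apply: bdd_measM => //; exact: bdd_meas_sin.
  + by apply: bdd_measM => //; exact: bdd_meas_sin.
Qed.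

Lemma multiplierZ c f : multiplier f -> multiplier (fun w => c * f w).
Proof. exact: multiplierM (multiplier_cst c). Qed.

Lemma multiplier_cvg (f_ : nat -> T -> R) (f : T -> R) (K : R) : (forall k, multiplier (f_ k)) ->
  (forall k w, `|f_ k w| <= K) -> (forall w, f_ ^~ w @ \oo --> f w) -> multiplier f.
Proof.
move=> Mf_ fK cf.
have mf_ k : measurable_fun setT (f_ k) by have [[]] := Mf_ k.
have mf : measurable_fun setT f.
  by apply: (measurable_fun_cvg mf_) => w _; exact: cf.
have bf : bdd_meas f.
  split => //; exists K => w.
  have c : `|f_ k w| @[k --> \oo] --> `|f w| by apply: cvg_norm; exact: cf.
  rewrite -(cvg_lim _ c)//; apply: limr_le; first by apply/cvg_ex; exists `|f w|.
  by apply: nearW => k; exact: fK.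
split => // h scaled_tanh; have [[mh [L hL]] h0] := scaled_tanh.
split; first exact: bdd_measM scaled_tanh.1 bf.
have key c : bdd_meas c -> (forall k, Ex P (fun w => W w * (h w * f_ k w * c w)) = 0) ->
    Ex P (fun w => W w * (h w * f w * c w)) = 0.
  move=> [mc [M cM]] E0.
  have : Ex P (fun w => W w * (h w * f_ k w * c w)) @[k --> \oo] -->
         Ex P (fun w => W w * (h w * f w * c w)).
    apply: (@bdd_cvg_Ex _ _ (L * K * M)).
    - by move=> k; apply: measurable_funM => //; exact: measurable_funM.
    - by apply: measurable_funM => //; exact: measurable_funM.
    - by move=> k w; rewrite !normrM !ler_pM ?mulr_ge0.
    - move=> w; apply: cvgM; last exact: cvg_cst.
      by apply: cvgM; [exact: cvg_cst|exact: cf].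
  under eq_fun do rewrite E0.
  by move/cvg_lim => <- //; rewrite lim_cst.
move=> u; split; apply: key.
- exact: bdd_meas_cos.
- by move=> k; have [_ /(_ _ scaled_tanh)[_ /(_ u)[]]] := Mf_ k.
- exact: bdd_meas_sin.
- by move=> k; have [_ /(_ _ scaled_tanh)[_ /(_ u)[]]] := Mf_ k.
Qed.

Lemma multiplier_cos v : multiplier (fun w => cos (lform v w)).
Proof.
split; first exact: bdd_meas_cos.
move=> h [bh h0]; split; first by apply: bdd_measM => //; exact: bdd_meas_cos.
have bc u := bdd_measM bh (bdd_meas_cos u).
have bs u := bdd_measM bh (bdd_meas_sin u).
move=> u; have [h1 h2] := h0 (u + v); have [h3 h4] := h0 (u - v); split.
- apply: (Ex_lincomb (a := 1/2) (b := 1/2) (bc _) (bc _) _ h1 h3) => w.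
  by rewrite lformD lformB cosD cosB; field.
- apply: (Ex_lincomb (a := 1/2) (b := 1/2) (bs _) (bs _) _ h2 h4) => w.
  by rewrite lformD lformB sinD sinB; field.
Qed.

Lemma multiplier_sin v : multiplier (fun w => sin (lform v w)).
Proof.
split; first exact: bdd_meas_sin.
move=> h [bh h0]; split; first by apply: bdd_measM => //; exact: bdd_meas_sin.
have bc u := bdd_measM bh (bdd_meas_cos u).
have bs u := bdd_measM bh (bdd_meas_sin u).
move=> u; have [h1 h2] := h0 (u + v); have [h3 h4] := h0 (u - v); split.
- apply: (Ex_lincomb (a := 1/2) (b := -1/2) (bs _) (bs _) _ h2 h4) => w.
  by rewrite lformD lformB sinD sinB; field.
- apply: (Ex_lincomb (a := -1/2) (b := 1/2) (bc _) (bc _) _ h1 h3) => w.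
  by rewrite lformD lformB cosD cosB; field.
Qed.

Lemma multiplier_sg f : multiplier f -> (forall w, `|f w| <= 1) ->
  multiplier (fun w => Num.sg (f w)).
Proof.
move=> Mf f1; apply: (@multiplier_cvg (fun k w => iter k sgn_step (f w)) _ 1).
- elim=> [|k IH] //=.
  have := multiplierM (multiplierZ (1/2) IH) (multiplierD (multiplier_cst 3) (multiplierZ (-1) (multiplierM IH IH))).
  congr multiplier; apply/funext => w; by rewrite /sgn_step; field.
- by move=> k w; exact: iter_sgn_step_le1.
- by move=> w; exact: cvg_iter_sgn_step.
Qed.

(** By cvg_sg_sin the sign of X_i - c is a bounded limit of signs of sin
    ((X_i - c) / (k + 1)), and the addition formula writes that sine with the
    frequency u = e_i / (k + 1). *)
Lemma multiplier_sg_coord i c : multiplier (fun w => Num.sg (coord X i w - c)).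
Proof.
apply: (@multiplier_cvg (fun k w => Num.sg (sin ((coord X i w - c) / k.+1%:R))) _ 1).
- move=> k; apply: multiplier_sg; last by move=> w; exact: sin_max.
  pose v : 'rV[R]_m := (k.+1%:R)^-1 *: delta_mx 0 i.
  have := multiplierD (multiplierZ (cos (c / k.+1%:R)) (multiplier_sin v))
    (multiplierZ (- sin (c / k.+1%:R)) (multiplier_cos v)).
  congr multiplier; apply/funext => w.
  by rewrite lform_scale_delta mulrBl sinB (mulrC k.+1%:R^-1); ring.
- by move=> k w; rewrite normr_sg; case: (_ != 0).
- by move=> w; exact: cvg_sg_sin.
Qed.

(** If s is the sign of X_i - c, the indicator of X_i > c is (s ^ 2 + s) / 2,
    and multipliers are closed under sums and products. *)
Lemma multiplier_indic_gt i c :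
  multiplier (\1_[set w | c < coord X i w]).
Proof.
have Ms := multiplier_sg_coord i c.
have := multiplierZ (1/2) (multiplierD (multiplierM Ms Ms) Ms).
congr multiplier; apply/funext => w; rewrite indicE /=.
have [h|h|h] := ltgtP (coord X i w) c.
- rewrite ltr0_sg ?subr_lt0// memNset /=; last by move=> /lt_trans/(_ h); rewrite ltxx.
  by field.
- by rewrite gtr0_sg ?subr_gt0// mem_set//=; field.
- by rewrite h subrr sgr0 memNset /= ?h ?ltxx//; field.
Qed.

Lemma multiplier_sigma_algebra : sigma_algebra setT [set A | multiplier (\1_A)].
Proof.
split.
- by rewrite /= indic0; exact: multiplier_cst.
- move=> A /= MA.
  have := multiplierD (multiplier_cst 1) (multiplierZ (-1) MA).
  congr multiplier; apply/funext => w.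
  by rewrite setTD !indicE in_setC; case: (_ \in _) => /=; ring.
- move=> F /= MF.
  have MU n : multiplier (\1_(\big[setU/set0]_(i < n) F i)).
    elim: n => [|n IH]; first by rewrite big_ord0 indic0; exact: multiplier_cst.
    rewrite big_ord_recr /=.
    have := multiplierD (multiplierD IH (MF n)) (multiplierZ (-1) (multiplierM IH (MF n))).
    congr multiplier; apply/funext => w; rewrite !indicE in_setU.
    by case: (w \in _); case: (w \in _); rewrite /=; ring.
  apply: (multiplier_cvg (K := 1) MU).
  + by move=> k w; rewrite indicE; case: (_ \in _); rewrite ?normr1 ?normr0.
  + move=> w; apply: cvg_near_cst.
    have [[k _ Fk]|nF] := pselect ((\bigcup_n F n) w).
    * exists k.+1 => // n /= kn; rewrite !indicE !mem_set//.
        by exists k.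
      by rewrite -bigcup_mkord; exists k.
    * apply: nearW => n; rewrite !indicE !memNset//.
      by rewrite -bigcup_mkord => -[j _ Fj]; apply: nF; exists j.
Qed.

(** The sigma-algebra of X is generated by its open half-spaces X_i > c. *)
Lemma multiplier_sigma_of A : sigma_of X A -> multiplier (\1_A).
Proof.
apply: (smallest_sub multiplier_sigma_algebra) => B [i [C [mC ->]]] /=.
rewrite RGenOInfty.measurableE in mC.
have := smallest_sub (_ : sigma_algebra setT [set C | multiplier (\1_(coord X i @^-1` C))]) _ mC.
apply.
- have [h0 hC hU] := multiplier_sigma_algebra; split.
  + by rewrite /= preimage_set0.
  + by move=> D /= /hC; rewrite !setTD preimage_setC.
  + by move=> F hF; rewrite /= preimage_bigcup; exact: hU.
- move=> _ [x ->] /=.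
  have := multiplier_indic_gt i x; congr multiplier; congr (\1__).
  by apply/seteqP; split => w /=; rewrite in_itv /= andbT.
Qed.

Hypothesis sym : forall (a : R) (u : 'rV[R]_m) (B : set (measurableTypeR R)),
  measurable B ->
  P ((fun w => a * W w + lform u w) @^-1` B) =
  P ((fun w => - a * W w + lform u w) @^-1` B).

Let mW : measurable_fun setT W := Int_measurable IW.

Let mS (a : R) u : measurable_fun setT (fun w => a * W w + lform u w).
Proof.
by apply: measurable_funD; [exact: measurable_funM|exact: measurable_lform].
Qed.

Let sym_Ex (f : R -> R) a u : measurable_fun setT f -> (forall x, `|f x| <= 1) ->
  Ex P (fun w => f (a * W w + lform u w)) = Ex P (fun w => f (- a * W w + lform u w)).
Proof.
move=> mf f1; rewrite /Ex /Rintegral; congr fine.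
by apply: (eq_law_integral (mS a u) (mS (- a) u) mf f1) => B; exact: sym.
Qed.

Let msin : measurable_fun setT (@sin R).
Proof. by apply: continuous_measurable_fun; exact: continuous_sin. Qed.

Let mcos : measurable_fun setT (@cos R).
Proof. by apply: continuous_measurable_fun; exact: continuous_cos. Qed.

Let Int1 (f : T -> R) : measurable_fun setT f -> (forall w, `|f w| <= 1) -> Int P f.
Proof. by move=> mf f1; apply: (le_Int mf f1); exact: Int_cst. Qed.

Let sin_cos0 a u : Ex P (fun w => sin (a * W w) * cos (lform u w)) = 0.
Proof.
have E := sym_Ex a u msin (@sin_max R).
have I b : Int P (fun w => sin (b * W w + lform u w)).
  by apply: Int1 => [|w]; [exact: (measurableT_comp msin)|exact: sin_max].
have -> : (fun w => sin (a * W w) * cos (lform u w)) =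
    (fun w => (1 / 2) * (sin (a * W w + lform u w) - sin (- a * W w + lform u w))).
  by apply/funext => w; rewrite mulNr !sinD sinN cosN; field.
by rewrite ExZ ?ExB// ?E ?subrr ?mulr0//; exact: IntB.
Qed.

Let sin_sin0 a u : Ex P (fun w => sin (a * W w) * sin (lform u w)) = 0.
Proof.
have E := sym_Ex a u mcos (@cos_max R).
have I b : Int P (fun w => cos (b * W w + lform u w)).
  by apply: Int1 => [|w]; [exact: (measurableT_comp mcos)|exact: cos_max].
have -> : (fun w => sin (a * W w) * sin (lform u w)) =
    (fun w => (- 1 / 2) * (cos (a * W w + lform u w) - cos (- a * W w + lform u w))).
  by apply/funext => w; rewrite [- a * _]mulNr !cosD sinN cosN; field.
by rewrite ExZ ?ExB// ?E ?subrr ?mulr0//; exact: IntB.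
Qed.

Let lin_limit g : bdd_meas g -> (forall w, `|g w| <= 1) ->
  (forall a, Ex P (fun w => sin (a * W w) * g w) = 0) ->
  Ex P (fun w => W w * g w) = 0.
Proof.
move=> [mg _] g1 E0.
have mk k : measurable_fun setT (fun w => k.+1%:R * sin (k.+1%:R^-1 * W w) * g w).
  apply: measurable_funM => //; apply: measurable_funM => //.
  by apply: (measurableT_comp msin); exact: measurable_funM.
have ml : measurable_fun setT (fun w => W w * g w) by exact: measurable_funM.
have IaW : Int P (fun w => `|W w|) by exact: integrable_norm.
have dom k w : `|k.+1%:R * sin (k.+1%:R^-1 * W w) * g w| <= `|W w|.
  rewrite normrM -[leRHS]mulr1 ler_pM// normrM.
  rewrite -[leRHS](@mulVKf _ (k.+1%:R))// ger0_norm// ler_wpM2l//.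
  by rewrite (le_trans (abs_sin_le _))// normrM gtr0_norm ?invr_gt0.
have cv : {ae P, forall w,
    k.+1%:R * sin (k.+1%:R^-1 * W w) * g w @[k --> \oo] --> W w * g w}.
  apply: aeW => w; apply: cvgM; last exact: cvg_cst.
  apply/subr_cvg0; apply: norm_cvg0.
  apply: (@squeeze_cvgr _ _ _ _ (fun=> 0) (fun k => W w ^+ 2 * k.+1%:R^-1)).
  - apply: nearW => k; rewrite normr_ge0 /=.
    have k0 : 0 < k.+1%:R :> R by [].
    have -> : k.+1%:R * sin (k.+1%:R^-1 * W w) - W w =
        k.+1%:R * - (k.+1%:R^-1 * W w - sin (k.+1%:R^-1 * W w)).
      by move: (k.+1%:R) k0 => K K0; field; rewrite gt_eqF.
    rewrite normrM normrN (ger0_norm (ltW k0)).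
    apply: (@le_trans _ _ (k.+1%:R * (k.+1%:R^-1 * W w) ^+ 2)).
      by rewrite ler_wpM2l ?(ltW k0)// abs_sub_sin_le.
    rewrite le_eqVlt; apply/orP; left; apply/eqP.
    by move: (k.+1%:R) k0 => K K0; field; rewrite gt_eqF.
  - exact: cvg_cst.
  - rewrite -[X in _ --> X](mulr0 (W w ^+ 2)); apply: cvgM; first exact: cvg_cst.
    exact: cvg_harmonic.
have [_ c] := dominated_convergence_Ex mk ml IaW cv dom.
rewrite -(cvg_lim _ c)//.
under eq_fun => k.
  have -> : (fun w => k.+1%:R * sin (k.+1%:R^-1 * W w) * g w) =
      (fun w => k.+1%:R * (sin (k.+1%:R^-1 * W w) * g w)).
    by apply/funext => w; rewrite mulrA.
  rewrite ExZ ?E0 ?mulr0; last first.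
    apply: Int1 => [|w].
      apply: measurable_funM => //.
      by apply: (measurableT_comp msin); exact: measurable_funM.
    by rewrite normrM mulr_ile1// sin_max.
  over.
by rewrite lim_cst.
Qed.

(** The symmetry of the laws gives E[sin (a W) cos (u X)] = 0 and E[sin (a W)
    sin (u X)] = 0, by the addition formulas; dividing by a and letting a
    tend to 0 replaces sin (a W) by W. *)
Lemma sym_trig_orth : trig_orth (fun=> 1).
Proof.
split; first exact: bdd_meas_cst.
move=> u; split; under eq_fun do rewrite mul1r; apply: lin_limit.
- exact: bdd_meas_cos.
- by move=> w; exact: cos_max.
- by move=> a; exact: sin_cos0.
- exact: bdd_meas_sin.
- by move=> w; exact: sin_max.
- by move=> a; exact: sin_sin0.
Qed.

Lemma sym_Ex_indic A : sigma_of X A -> Ex P (fun w => W w * \1_A w) = 0.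
Proof.
move=> /multiplier_sigma_of[_ /(_ _ sym_trig_orth)[_ /(_ 0)[+ _]]].
by under eq_fun do rewrite /lform mul0mx mxE cos0 mulr1 mul1r.
Qed.

End CondIndep.

(** * Gaussian vectors: covariance and regression *)

Section Gauss.
Context {R : realType} {d : measure_display} {T : measurableType d}.
Variable P : probability T R.

Lemma Int_mul_indic (f : T -> R) B : measurable B -> Int P f ->
  Int P (fun w => f w * \1_B w).
Proof.
move=> mB If; apply: (@le_Int _ _ _ _ _ (fun w => `|f w|)).
- by apply: measurable_funM; [exact: Int_measurable If|exact: measurable_indic mB].
- by move=> w; rewrite normrM indicE; case: (_ \in _);
    rewrite ?normr1 ?normr0 ?mulr1// mulr0.
- exact: integrable_norm.
Qed.

Lemma eq_law_Ex4 (Z Z' : T -> R) :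
  measurable_fun setT Z -> measurable_fun setT Z' ->
  (forall B : set (measurableTypeR R), measurable B -> P (Z @^-1` B) = P (Z' @^-1` B)) ->
  Ex P (fun w => Z w ^+ 4) = Ex P (fun w => Z' w ^+ 4).
Proof.
move=> mZ mZ' law; rewrite /Ex /Rintegral; congr fine.
have m4 : measurable_fun setT (fun x : R => (x ^+ 4)%:E) by apply/measurable_EFinP.
have p4 (x : R) : (0 <= (x ^+ 4)%:E)%E by rewrite lee_fin exprn_even_ge0.
have pE (U : T -> R) : measurable_fun setT U ->
  (\int[pushforward P (U : T -> measurableTypeR R)]_y (y ^+ 4)%:E = \int[P]_w (U w ^+ 4)%:E)%E.
  move=> mU.
  by rewrite (@ge0_integral_pushforward _ _ T (measurableTypeR R) R U mU P setT _ measurableT m4).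
rewrite -pE// -[RHS]pE//.
by apply: eq_measure_integral => A mA _; exact: law.
Qed.

(** The law of Z is symmetric, so Z and - Z have the same mean. *)
Lemma sym_law_Ex0 (Z : T -> R) : Int P Z ->
  (forall B : set (measurableTypeR R), measurable B ->
     P (Z @^-1` B) = P ((fun w => - Z w) @^-1` B)) ->
  Ex P Z = 0.
Proof.
move=> IZ law; have mZ := Int_measurable IZ.
have mid : measurable_fun setT (EFin : R -> \bar R) by apply/measurable_EFinP.
have pE (U : T -> R) : Int P U ->
  (\int[pushforward P (U : T -> measurableTypeR R)]_y y%:E = \int[P]_w (U w)%:E)%E.
  move=> IU.
  by rewrite (@integral_pushforward _ _ T (measurableTypeR R) R U (Int_measurable IU) P setT _ mid IU measurableT).
have mNZ := Int_measurable (IntN IZ).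
have E : Ex P Z = Ex P (fun w => - Z w).
  rewrite /Ex /Rintegral; congr fine; rewrite -pE// -[RHS]pE//; last exact: IntN.
  by apply: eq_measure_integral => A mA _; exact: law.
have : Ex P (fun w => - Z w) = - Ex P Z.
  have := ExZ (-1) IZ; rewrite mulN1r => <-; congr Ex.
  by apply/funext => w; rewrite mulN1r.
lra.
Qed.

Section Centered.
Variables (m : nat) (S : 'M[R]_m) (Z : T -> 'cV[R]_m).
Hypothesis gZ : centered_gaussian P S Z.

Lemma gauss_measurable i : measurable_fun setT (coord Z i).
Proof. by case: gZ. Qed.

(** A linear form of a Gaussian vector is normal, with variance given by the
    quadratic form of the covariance. *)
Lemma gauss_lform_moments u :
  L4 P (lform Z u) /\ Ex P (fun w => lform Z u w ^+ 2) = (u *m S *m u^T) 0 0.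
Proof.
have [[_ psd] mZ law] := gZ.
have mu := measurable_lform mZ u.
have v0 : 0 <= (u *m S *m u^T) 0 0 by have := psd u^T; rewrite trmxK.
have [h2 h4] := normal_law_moments v0 mu (law u).
split; last by rewrite /Ex /Rintegral h2.
split => //; apply/integrableP; split.
  by apply/measurable_EFinP; exact: measurable_funX.
rewrite (_ : (\int[P]_w _)%E = (\int[P]_w (lform Z u w ^+ 4)%:E)%E)//.
by apply: eq_integral => w _ /=; rewrite ger0_norm// exprn_even_ge0.
Qed.

Lemma coord_lform i : coord Z i = lform Z (delta_mx 0 i).
Proof. by apply/funext => w; rewrite /lform -rowE mxE. Qed.

Lemma gauss_L4 i : L4 P (coord Z i).
Proof. by rewrite coord_lform; have [] := gauss_lform_moments (delta_mx 0 i). Qed.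

(** Polarisation of the variance of linear forms. *)
Lemma gauss_cov_lform u v :
  Ex P (fun w => lform Z u w * lform Z v w) = (u *m S *m v^T) 0 0.
Proof.
have [[symS _] mZ _] := gZ.
have [Lu _] := gauss_lform_moments u; have [Lv _] := gauss_lform_moments v.
have [Lp Ep] := gauss_lform_moments (u + v).
have [Lm Em] := gauss_lform_moments (u - v).
have -> : (fun w => lform Z u w * lform Z v w) =
    (fun w => (1 / 4) * (lform Z (u + v) w ^+ 2 - lform Z (u - v) w ^+ 2)).
  by apply/funext => w; rewrite lformD lformB; field.
have [_ Ip] := L4_L2 Lp; have [_ Im] := L4_L2 Lm.
rewrite ExZ ?ExB ?Ep ?Em//; last exact: IntB.
rewrite [(u + v)^T]raddfD [(u - v)^T]raddfB /= !mulmxDl !mulmxDr !mulmxN !mulNmx.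
have aD (B C : 'M[R]_1) : (B + C) 0 0 = B 0 0 + C 0 0 by rewrite mxE.
have aN (B : 'M[R]_1) : (- B) 0 0 = - B 0 0 by rewrite mxE.
rewrite !(aD, aN).
have E : (v *m S *m u^T) 0 0 = (u *m S *m v^T) 0 0.
  have : (v *m S *m u^T)^T = u *m S *m v^T.
    by rewrite !trmx_mul trmxK symS mulmxA.
  by move=> <-; rewrite [RHS]mxE.
by rewrite E; field.
Qed.

Lemma gauss_cov i j : Ex P (fun w => coord Z i w * coord Z j w) = S i j.
Proof.
rewrite !coord_lform gauss_cov_lform -rowE.
by rewrite trmx_delta -colE !mxE.
Qed.

End Centered.

Lemma cross_corrE m (X Y : T -> 'cV[R]_m) i j :
  cross_corr P X Y i j = Ex P (fun w => coord X i w * coord Y j w).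
Proof. by rewrite /cross_corr mxE unlock. Qed.

Lemma sigma_of_measurable m (X : T -> 'cV[R]_m) A :
  (forall i, measurable_fun setT (coord X i)) -> sigma_of X A -> measurable A.
Proof.
move=> mX; apply: smallest_sub; first exact: sigma_algebra_measurable.
by move=> _ [i [B [mB ->]]]; rewrite -[X in measurable X]setTI; exact: mX.
Qed.

Section CondExp.
Variables (m : nat) (SX SY : 'M[R]_m) (X Y : T -> 'cV[R]_m).
Hypothesis gX : centered_gaussian P SX X.
Hypothesis gY : centered_gaussian P SY Y.
Hypothesis gXY : jointly_gaussian P X Y.
Hypothesis SXu : SX \in unitmx.

Let J := cross_corr P X Y.
Let A := J^T *m invmx SX.

Let LX u : L4 P (lform X u). Proof. by have [] := gauss_lform_moments gX u. Qed.
Let LY i : L4 P (coord Y i). Proof. exact: gauss_L4 gY i. Qed.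

Lemma Ex_lform_coord u i : Ex P (fun w => lform X u w * coord Y i w) = (u *m J) 0 i.
Proof.
have -> : (fun w => lform X u w * coord Y i w) =
    (fun w => \sum_(j < m) u 0 j * (coord X j w * coord Y i w)).
  by apply/funext => w; rewrite lformE mulr_suml; apply: eq_bigr => j _; rewrite mulrA.
have I j : Int P (fun w => coord X j w * coord Y i w).
  by apply: L2_Int; apply: L4_L2_mul => //; exact: gauss_L4 gX j.
rewrite Ex_sum; last by move=> j; exact: IntZ.
by rewrite mxE; apply: eq_bigr => j _; rewrite ExZ// cross_corrE.
Qed.

Let W i w := coord Y i w - lform X (row i A) w.

Let LW i : L4 P (W i).
Proof.
have := L4D (LY i) (L4Z (-1) (LX (row i A))).
by congr L4; apply/funext => w; rewrite mulN1r.
Qed.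

(** The coefficients A = J^T SX^-1 are those of the normal equations of the
    linear regression of Y on X. *)
Lemma Ex_resid_lform i u : Ex P (fun w => W i w * lform X u w) = 0.
Proof.
have -> : (fun w => W i w * lform X u w) =
    (fun w => lform X u w * coord Y i w - lform X (row i A) w * lform X u w).
  by apply/funext => w; rewrite /W; ring.
rewrite ExB; last 2 first.
- exact: L2_Int (L4_L2_mul _ _).
- exact: L2_Int (L4_L2_mul _ _).
rewrite Ex_lform_coord (gauss_cov_lform gX) /A -row_mul mulmxKV//.
suff -> : (row i J^T *m u^T) 0 0 = (u *m J) 0 i by rewrite subrr.
by rewrite !mxE; apply: eq_bigr => j _; rewrite !mxE mulrC.
Qed.

(** Both sides are laws of linear forms of the joint Gaussian vector; their
    variances agree because the mixed term, by Ex_resid_lform, vanishes. *)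
Lemma resid_sym i (a : R) (u : 'rV[R]_m) (B : set (measurableTypeR R)) :
  measurable B ->
  P ((fun w => a * W i w + lform X u w) @^-1` B) =
  P ((fun w => - a * W i w + lform X u w) @^-1` B).
Proof.
move=> mB; have [S gS] := gXY.
pose Z w := col_mx (X w) (Y w).
(* The form b W i + u X as a linear form of the joint vector. *)
pose v b : 'rV[R]_(m + m) := row_mx (u - b *: row i A) (b *: delta_mx 0 i).
have vE b w : lform Z (v b) w = b * W i w + lform X u w.
  have -> : lform Z (v b) w =
      lform X (u - b *: row i A) w + lform Y (b *: delta_mx 0 i) w.
    by rewrite /lform /v /Z mul_row_col mxE.
  rewrite lformB lform_scale_delta /W.
  have -> : lform X (b *: row i A) w = b * lform X (row i A) w.
    by rewrite /lform -scalemxAl mxE.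
  ring.
have lawE b : P ((fun w => b * W i w + lform X u w) @^-1` B) =
    normal_law (Ex P (fun w => (b * W i w + lform X u w) ^+ 2)) B.
  have [_ _ law] := gS.
  have h : P (lform Z (v b) @^-1` B) =
    normal_law ((v b *m S *m (v b)^T) 0 0) B := law (v b) B mB.
  have vEf : (fun w => b * W i w + lform X u w) = lform Z (v b).
    by apply/funext => w; rewrite vE.
  have [_ var] := gauss_lform_moments gS (v b).
  rewrite -var in h; rewrite vEf h; congr (normal_law (Ex P _) B).
  by apply/funext => w; rewrite vE.
rewrite !lawE; congr normal_law.
have IWW := (L4_L2 (LW i)).2.
have IWL : Int P (fun w => W i w * lform X u w) by exact: L2_Int (L4_L2_mul _ _).
have ILL := (L4_L2 (LX u)).2.
have E b : Ex P (fun w => (b * W i w + lform X u w) ^+ 2) =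
    b ^+ 2 * Ex P (fun w => W i w ^+ 2) + Ex P (fun w => lform X u w ^+ 2).
  have -> : (fun w => (b * W i w + lform X u w) ^+ 2) =
     (fun w => b ^+ 2 * W i w ^+ 2 + (2 * b) * (W i w * lform X u w) + lform X u w ^+ 2).
    by apply/funext => w; ring.
  rewrite ExD//; last by apply: IntD; exact: IntZ.
  rewrite ExD; [|exact: IntZ|exact: IntZ].
  by rewrite ExZ// ExZ// Ex_resid_lform mulr0 addr0.
by rewrite !E sqrrN.
Qed.

Lemma Ex_resid_indic i B : sigma_of X B -> Ex P (fun w => W i w * \1_B w) = 0.
Proof.
apply: sym_Ex_indic => [j||a u C mC]; first exact: gauss_measurable gX j.
- exact/L2_Int/L4_L2/LW.
- exact: resid_sym.
Qed.

Let G : set_system T := [set A | exists i (B : set (measurableTypeR R)),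
               measurable B /\ A = coord X i @^-1` B].

Let T' := g_sigma_algebraType G.

Let mT'_coord i : @measurable_fun _ _ T' _ setT (coord X i).
Proof.
move=> _ B mB; rewrite setTI; apply: sub_sigma_algebra.
by exists i, B.
Qed.

(** Let L be the linear regression. Both M and L are measurable for the
    sigma-algebra of X and have the same integrals on its events, in
    particular on the events M > L and M < L, so E|M - L| = 0. *)
Lemma gauss_cond_exp i M : is_cond_exp P (sigma_of X) (coord Y i) M ->
  {ae P, forall w, M w = (A *m X w) i 0}.
Proof.
move=> [mM iM intM].
pose L w := lform X (row i A) w.
have LE w : (A *m X w) i 0 = L w by rewrite /L /lform -row_mul [RHS]mxE.
have mX := gauss_measurable gX.
have mT'M : @measurable_fun _ _ T' _ setT M.
  by move=> _ B mB; rewrite setTI; exact: mM.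
have mT'L : @measurable_fun _ _ T' _ setT L.
  rewrite (_ : L = fun w => \sum_(j < m) row i A 0 j * coord X j w); last first.
    by apply/funext => w; rewrite /L lformE.
  by apply: measurable_sum => j; apply: measurable_funM.
have mT'D : @measurable_fun _ _ T' _ setT (fun w => M w - L w).
  exact: measurable_funB.
pose E1 := (fun w => M w - L w) @^-1` `]0, +oo[%classic.
pose E2 := (fun w => M w - L w) @^-1` `]-oo, 0[%classic.
have sE1 : sigma_of X E1.
  have := mT'D measurableT `]0, +oo[%classic (measurable_itv _).
  by rewrite setTI.
have sE2 : sigma_of X E2.
  have := mT'D measurableT `]-oo, 0[%classic (measurable_itv _).
  by rewrite setTI.
have IL : Int P L by exact/L2_Int/L4_L2/LX.
have IY : Int P (coord Y i) by exact/L2_Int/L4_L2/LY.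
have bi B mB f := @Int_mul_indic f B mB.
have key B : sigma_of X B -> Ex P (fun w => (M w - L w) * \1_B w) = 0.
  move=> sB; have mB := sigma_of_measurable mX sB.
  have toR f : (\int[P]_(w in B) (f w)%:E = \int[P]_w (f w * \1_B w)%:E)%E.
    by rewrite integral_mkcond; apply: eq_integral => w _; rewrite epatch_indic /= EFinM.
  have := intM B sB; rewrite !toR => h.
  have {}h : Ex P (fun w => M w * \1_B w) = Ex P (fun w => coord Y i w * \1_B w).
    by rewrite /Ex /Rintegral h.
  have := Ex_resid_indic i sB.
  have -> : (fun w => W i w * \1_B w) = (fun w => coord Y i w * \1_B w - L w * \1_B w).
    by apply/funext => w; rewrite /W /L; ring.
  have -> : (fun w => (M w - L w) * \1_B w) = (fun w => M w * \1_B w - L w * \1_B w).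
    by apply/funext => w; ring.
  by rewrite !ExB ?h//; exact: bi.
have mE1 := sigma_of_measurable mX sE1; have mE2 := sigma_of_measurable mX sE2.
have ID : Int P (fun w => M w - L w) by exact: IntB.
(* The sign of M - L is the difference of the indicators of E1 and E2. *)
have abs0 : Ex P (fun w => `|M w - L w|) = 0.
  have -> : (fun w => `|M w - L w|) =
      (fun w => (M w - L w) * \1_E1 w - (M w - L w) * \1_E2 w).
    apply/funext => w; rewrite !indicE /E1 /E2 /=.
    have [h|h|h] := ltgtP (M w - L w) 0.
    + rewrite memNset; last by rewrite /= in_itv /= andbT => /lt_trans/(_ h); rewrite ltxx.
      by rewrite mem_set ?in_itv//= ltr0_norm//; ring.
    + rewrite mem_set /= ?in_itv/= ?h// memNset /=; last first.
        by rewrite in_itv /= => /lt_trans/(_ h); rewrite ltxx.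
      by rewrite gtr0_norm//; ring.
    + by rewrite h normr0 !mul0r subr0.
  by rewrite ExB ?key ?subr0//; exact: bi.
have : (\int[P]_w `|(M w - L w)%:E| = 0)%E.
  transitivity (\int[P]_w (`|M w - L w|)%:E)%E; first exact: eq_integral.
  by rewrite Ex_EFin ?abs0//; exact: integrable_norm.
have mD : measurable_fun setT (fun w => (M w - L w)%:E).
  by apply/measurable_EFinP; exact: Int_measurable ID.
move/(ae_eq_integral_abs P measurableT mD).
apply: filterS => w /(_ I) /= [] /eqP.
by rewrite subr_eq0 LE => /eqP.
Qed.

Lemma gauss_coord_opp_law i (B : set (measurableTypeR R)) : measurable B ->
  P (coord Y i @^-1` B) = P ((fun w => - coord Y i w) @^-1` B).
Proof.
move=> mB; have [_ _ law] := gY.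
have h1 := law (delta_mx 0 i) B mB; have h2 := law (- delta_mx 0 i) B mB.
have E1 : coord Y i = (fun w => ((delta_mx 0 i : 'rV[R]_m) *m Y w) 0 0) by exact: coord_lform.
have E2 : (fun w => - coord Y i w) = (fun w => (- (delta_mx 0 i : 'rV[R]_m) *m Y w) 0 0).
  by rewrite E1; apply/funext => w; rewrite mulNmx [RHS]mxE.
rewrite E2 E1 h1 h2; congr (normal_law _ B).
by rewrite raddfN /= mulmxN !mulNmx opprK.
Qed.

(** Restricted to an event B of X, the coordinate of Y keeps by independence
    a symmetric law: the probability of B and Y_i in C is the product of
    those of B and of Y_i in C, and Y_i has a symmetric law. *)
Lemma indep_Ex_indic0 i B : independent_vectors P X Y -> sigma_of X B ->
  Ex P (fun w => coord Y i w * \1_B w) = 0.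
Proof.
move=> ind sB; have mX := gauss_measurable gX; have mY := gauss_measurable gY.
have mB := sigma_of_measurable mX sB.
have IY : Int P (coord Y i) by exact/L2_Int/L4_L2/LY.
have Iphi := Int_mul_indic mB IY.
apply: sym_law_Ex0 => // C mC.
have mphi : measurable ((fun w => coord Y i w * \1_B w) @^-1` C).
  by rewrite -[X in measurable X]setTI; exact: (Int_measurable Iphi).
have mphiN : measurable ((fun w => - (coord Y i w * \1_B w)) @^-1` C).
  by rewrite -[X in measurable X]setTI; exact: (Int_measurable (IntN Iphi)).
have sYC D : measurable D -> sigma_of Y (coord Y i @^-1` D).
  by move=> mD; apply: sub_sigma_algebra; exists i, D.
have mNC : measurable ((-%R : R -> R) @^-1` C).
  have mopp : measurable_fun setT (-%R : R -> R) by exact: oppr_measurable.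
  by rewrite -[X in measurable X]setTI; exact: mopp.
rewrite (measureDI P mphi mB) [RHS](measureDI P mphiN mB).
have -> : (fun w => coord Y i w * \1_B w) @^-1` C `\` B =
    (fun w => - (coord Y i w * \1_B w)) @^-1` C `\` B.
  by apply/seteqP; split => w /= [+ nB]; rewrite indicE memNset// mulr0 oppr0.
congr (_ + _)%E.
have -> : (fun w => coord Y i w * \1_B w) @^-1` C `&` B = B `&` coord Y i @^-1` C.
  by apply/seteqP; split => w /= [h1 h2]; move: h1 h2;
    [move=> + h2|move=> h2 +]; rewrite indicE mem_set// mulr1.
have -> : (fun w => - (coord Y i w * \1_B w)) @^-1` C `&` B =
    B `&` coord Y i @^-1` ((-%R : R -> R) @^-1` C).
  by apply/seteqP; split => w /= [h1 h2]; move: h1 h2;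
    [move=> + h2|move=> h2 +]; rewrite indicE mem_set// mulr1.
have e1 := ind _ _ sB (sYC _ mC).
have e2 := ind _ _ sB (sYC _ mNC).
by rewrite [LHS]e1 [RHS]e2 gauss_coord_opp_law.
Qed.

(** By indep_Ex_indic0 the constant 0 is a version of the conditional
    expectation of Y_i given X; by gauss_cond_exp the regression of Y_i on X
    then vanishes almost surely, and so does the covariance it encodes. *)
Lemma indep_cross_corr0 : independent_vectors P X Y -> J = 0.
Proof.
move=> ind.
have z i : {ae P, forall w, (0 : R) = (A *m X w) i 0}.
  apply: (@gauss_cond_exp i (fun=> 0)); split.
  - move=> B mB; rewrite preimage_cst; case: ifPn => _.
      exact: (@measurableT _ T').
    exact: (@measurable0 _ T').
  - exact: Int_cst.
  - move=> B sB; have mB := sigma_of_measurable (gauss_measurable gX) sB.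
    have IY : Int P (coord Y i) by exact/L2_Int/L4_L2/LY.
    rewrite integral0 integral_mkcond.
    rewrite (eq_integral (fun w => (coord Y i w * \1_B w)%:E)); last first.
      by move=> w _; rewrite epatch_indic /= EFinM.
    have Iphi := Int_mul_indic mB IY.
    by rewrite Ex_EFin// indep_Ex_indic0.
apply/matrixP => j i; rewrite [RHS]mxE /J cross_corrE coord_lform.
have -> : (fun w => lform X (delta_mx 0 j) w * coord Y i w) =
   (fun w => W i w * lform X (delta_mx 0 j) w + lform X (row i A) w * lform X (delta_mx 0 j) w).
  by apply/funext => w; rewrite /W; ring.
have IL2 u v : Int P (fun w => lform X u w * lform X v w) by exact: L2_Int (L4_L2_mul _ _).
rewrite ExD//; last exact: L2_Int (L4_L2_mul _ _).
rewrite Ex_resid_lform add0r.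
have [_ <-] : Int P (fun=> 0 : R) /\ Ex P (fun=> 0) = Ex P (fun w => lform X (row i A) w * lform X (delta_mx 0 j) w).
  have [|||I ->] := @ae_eq_Ex _ _ _ P (fun=> 0) (fun w => lform X (row i A) w * lform X (delta_mx 0 j) w).
  - exact: Int_cst.
  - exact: Int_measurable.
  - apply: filterS (z i) => w e.
    have -> : lform X (row i A) w = 0 by rewrite e /lform -row_mul mxE.
    by rewrite mul0r.
  - by split => //; exact: Int_cst.
by rewrite Ex_cst.
Qed.
End CondExp.
End Gauss.

(** * Riemann sums of a continuous derivative *)

Section Det.
Context {R : realType}.

Lemma sqr_sum_le n (a : 'I_n -> R) :
  (\sum_(k < n) a k) ^+ 2 <= n%:R * \sum_(k < n) a k ^+ 2.
Proof.
elim: n a => [|n IH] a; first by rewrite !big_ord0 expr0n mulr0.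
rewrite !big_ord_recr /=.
have := IH (fun k => a (widen_ord (leqnSn n) k)).
set S := \sum_(i < n) a _; set Q := \sum_(i < n) a _ ^+ 2.
move: (a ord_max) => x h.
have Q0 : 0 <= Q by apply: sumr_ge0 => k _; exact: sqr_ge0.
rewrite -natr1.
have [n0|n0] := posnP n.
  rewrite n0 mul0r in h.
  have S0 : S = 0 by apply/eqP; rewrite -sqrf_eq0 eq_le h sqr_ge0.
  by rewrite n0 S0; nra.
have n0' : 0 < n%:R :> R by rewrite ltr0n.
rewrite -subr_ge0 -(pmulr_rge0 _ n0').
have := sqr_ge0 (S - n%:R * x).
move: (n%:R : R) n0' h => N N0 h.
have : 0 <= N * (N * Q - S ^+ 2) by rewrite mulr_ge0 ?subr_ge0// ltW.
by nra.
Qed.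

(** Compactness is used in its near-covering form: a modulus that works near
    each point of the segment works uniformly. *)
Lemma segment_unif_continuous (f : R -> R) (a b : R) :
  (forall x, a <= x <= b -> {for x, continuous f}) ->
  forall e : R, 0 < e -> exists2 d : R, 0 < d &
    forall x y, a <= x <= b -> `|y - x| < d -> `|f y - f x| <= e.
Proof.
move=> cf e e0.
have /compact_near_coveringP cover := @segment_compact R a b.
pose Pr (d x : R) := forall y, `|y - x| < d -> `|f y - f x| <= e.
have near_Pr (x : R) : `[a, b]%classic x -> \forall x' \near x & d \near (0 : R)^'+, Pr d x'.
  rewrite /= in_itv /= => xab.
  have e20 : 0 < e / 2 by rewrite divr_gt0.
  have cfx : f @ x --> f x := cf x xab.
  move/cvgrPdist_lt : cfx => /(_ _ e20).
  move=> /nbhs_ballP[r /= r0 hr].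
  exists (ball x (r / 2), [set d | 0 < d < r / 2]) => /=.
    split; first by apply: nbhsx_ballx; rewrite divr_gt0.
    near=> d; rewrite /=; apply/andP; split => //.
    by near: d; apply: nbhs_right_lt; rewrite divr_gt0.
  move=> [x' d] /= [xx' /andP[d0 dr]] y yx'.
  have h1 : `|f x - f x'| < e / 2.
    by apply: hr; rewrite /ball /= in xx' *; apply: lt_trans xx' _; lra.
  have h2 : `|f x - f y| < e / 2.
    apply: hr; rewrite /ball /= in xx' *.
    have -> : x - y = (x - x') - (y - x') by ring.
    by rewrite (le_lt_trans (ler_normB _ _))//; lra.
  have -> : f y - f x' = (f x - f x') - (f x - f y) by ring.
  by rewrite (le_trans (ler_normB _ _))//; lra.
have [r /= r0 hr] := cover R (0^'+) Pr _ near_Pr.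
exists (r / 2); first by rewrite divr_gt0.
move=> x y xab yx.
apply: (hr (r / 2) _ _ x) => //=.
- by rewrite sub0r normrN gtr0_norm ?divr_gt0//; lra.
- by rewrite divr_gt0.
Unshelve. all: by end_near. Qed.

Definition grid_point (s t : R) (N k : nat) : R := s + k%:R * ((t - s) / N.+1%:R).

Lemma grid_point_itv s t N k : s <= t -> (k <= N.+1)%N -> s <= grid_point s t N k <= t.
Proof.
move=> st kN; rewrite /grid_point.
have N0 : 0 < N.+1%:R :> R by [].
have kN' : k%:R <= N.+1%:R :> R by rewrite ler_nat.
have k0 : 0 <= k%:R :> R by [].
rewrite lerDl mulr_ge0 ?divr_ge0 ?subr_ge0 ?(ltW N0)//=.
rewrite -lerBrDl mulrCA ler_piMr ?subr_ge0//.
by rewrite ler_pdivrMr// mul1r.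
Qed.

Lemma grid_pointS s t N k : grid_point s t N k.+1 - grid_point s t N k = (t - s) / N.+1%:R.
Proof. by rewrite /grid_point -natr1; ring. Qed.

(** On each step the mean value theorem replaces the increment of g by the
    value of dg at an interior point, which uniform continuity compares with
    its value at the left node. *)
Lemma riemann_sum_cvg (g dg : R -> R) (s t : R) : s < t ->
  (forall x, s <= x <= t -> is_derive x 1 g (dg x)) ->
  (forall x, s <= x <= t -> {for x, continuous dg}) ->
  \sum_(k < N.+1) (t - s) / N.+1%:R * dg (grid_point s t N k) @[N --> \oo] --> g t - g s.
Proof.
move=> st dgP cdg; apply/cvgrPdist_le => e e0.
have ts0 : 0 < t - s by rewrite subr_gt0.
have e'0 : 0 < e / (t - s) by rewrite divr_gt0.
have [d d0 hd] := segment_unif_continuous cdg e'0.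
near=> N.
have N0 : 0 < N.+1%:R :> R by [].
set del := (t - s) / N.+1%:R.
have del0 : 0 < del by rewrite divr_gt0.
have deld : del < d.
  rewrite /del ltr_pdivrMr// mulrC -ltr_pdivrMr//.
  rewrite (lt_le_trans (truncnS_gt _))// ler_nat ltnS.
  by near: N; exact: nbhs_infty_ge.
(* The increment is the telescoping sum of the increments on the steps. *)
have tel : g t - g s = \sum_(k < N.+1) (g (grid_point s t N k.+1) - g (grid_point s t N k)).
  rewrite -(big_mkord xpredT (fun k => g (grid_point s t N k.+1) - g (grid_point s t N k))).
  rewrite telescope_sumr//; congr (g _ - g _); rewrite /grid_point ?mul0r ?addr0//.
  by rewrite mulrC divfK ?gt_eqF//; ring.
rewrite tel -sumrB (le_trans (ler_norm_sum _ _ _))//.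
have step (k : 'I_N.+1) : `|g (grid_point s t N k.+1) - g (grid_point s t N k)
    - del * dg (grid_point s t N k)| <= del * (e / (t - s)).
  have k1 := @grid_point_itv s t N k (ltW st) (ltnW (ltn_ord k)).
  have k2 := @grid_point_itv s t N k.+1 (ltW st) (ltn_ord k).
  have E := grid_pointS s t N k; rewrite -/del in E.
  move: (grid_point s t N k) (grid_point s t N k.+1) k1 k2 E => a b /andP[sa at_] /andP[sb bt] E.
  have ab : a < b by rewrite -subr_gt0 E.
  have [||c] := @MVT R g dg a b ab.
  - by move=> x /[!in_itv]/= /andP[ax xb]; apply: dgP; apply/andP; split; lra.
  - apply: derivable_within_continuous => x /[!in_itv]/= /andP[ax xb].
    by have [] : is_derive x 1 g (dg x) by apply: dgP; apply/andP; split; lra.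
  rewrite in_itv /= => /andP[ac cb] ->.
  rewrite E mulrC -mulrBr normrM (gtr0_norm del0) ler_wpM2l ?(ltW del0)//.
  apply: hd; first by rewrite sa.
  by rewrite gtr0_norm ?subr_gt0//; apply: le_lt_trans deld; lra.
apply: (@le_trans _ _ (\sum_(k < N.+1) del * (e / (t - s)))).
  by apply: ler_sum => k _; exact: step.
rewrite sumr_const card_ord -mulr_natl /del.
rewrite le_eqVlt; apply/orP; left; apply/eqP.
by move: (N.+1%:R : R) N0 => K K0; field; rewrite !gt_eqF.
Unshelve. all: by end_near. Qed.
End Det.

(** * Convergence of expectations under an L2 bound *)

Section Vitali.
Context {R : realType} {d : measure_display} {T : measurableType d}.
Variable P : probability T R.

(** Uniform integrability by truncation: |x| <= min (|x|, M) + x ^ 2 / M. The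
    truncated part tends to 0 by dominated convergence, and the rest is at
    most a constant over M. *)
Lemma L2_bounded_cvg_Ex (V_ : nat -> T -> R) V (C : R) :
  (forall k, L2 P (V_ k)) -> L2 P V ->
  {ae P, forall w, V_ ^~ w @ \oo --> V w} ->
  (forall k, Ex P (fun w => V_ k w ^+ 2) <= C) ->
  Ex P (V_ k) @[k --> \oo] --> Ex P V.
Proof.
move=> LV_ LV cV VC.
pose D k w := V_ k w - V w.
have LD k : L2 P (D k).
  have := L2D (LV_ k) (L2Z (-1) LV).
  by congr L2; apply/funext => w; rewrite mulN1r.
pose C' := 2 * C + 2 * Ex P (fun w => V w ^+ 2) + 1.
have DC k : Ex P (fun w => D k w ^+ 2) <= C'.
  apply: (@le_trans _ _ (Ex P (fun w => 2 * V_ k w ^+ 2 + 2 * V w ^+ 2))).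
    apply: le_Ex.
    - exact: (LD k).2.
    - by apply: IntD; apply: IntZ; [exact: (LV_ k).2|exact: LV.2].
    - by move=> w; rewrite /D; have := sqr_ge0 (V_ k w + V w); nra.
  rewrite ExD ?ExZ; [|exact: LV.2|exact: (LV_ k).2|exact: IntZ (LV_ k).2|exact: IntZ LV.2].
  by rewrite /C'; have := VC k; lra.
have C'0 : 0 < C'.
  have h1 : 0 <= Ex P (fun w => V_ 0%N w ^+ 2) by apply: Ex_ge0 => w; exact: sqr_ge0.
  have h2 : 0 <= Ex P (fun w => V w ^+ 2) by apply: Ex_ge0 => w; exact: sqr_ge0.
  by have := VC 0%N; rewrite /C'; lra.
apply/cvgrPdist_le => e e0.
(* With this truncation level the quadratic part contributes at most e / 2. *)
pose M := 2 * C' / e.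
have M0 : 0 < M by rewrite divr_gt0// mulr_gt0.
pose mn k w := Num.min `|D k w| M.
have mmn k : measurable_fun setT (mn k).
  by apply: measurable_minr => //; apply: measurableT_comp => //; exact: (LD k).1.
have mnM k w : `|mn k w| <= M.
  rewrite ger0_norm ?ge_min ?lexx ?orbT// le_min normr_ge0 /=; exact: ltW.
have cmn : {ae P, forall w, mn ^~ w @ \oo --> (0 : R)}.
  apply: filterS cV => w cw.
  have cD : `|D k w| @[k --> \oo] --> (0 : R).
    rewrite -[X in _ --> X](@normr0 _ R); apply: cvg_norm.
    by apply/subr_cvg0.
  apply: (@squeeze_cvgr _ _ _ _ (fun=> 0) (fun k => `|D k w|)) => //.
  - apply: nearW => k; rewrite /mn ge_min lexx /= andbT le_min normr_ge0 /=; exact: ltW.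
  - exact: cvg_cst.
have [_ cEx] := dominated_convergence_Ex mmn (measurable_cst _) (Int_cst P M) cmn mnM.
rewrite Ex_cst in cEx.
have e20 : 0 < e / 2 by rewrite divr_gt0.
move/cvgrPdist_le : cEx => /(_ _ e20); apply: filterS => k.
rewrite sub0r normrN => hk.
have -> : Ex P V - Ex P (V_ k) = - Ex P (D k).
  by rewrite /D ExB ?opprB//; exact: L2_Int.
rewrite normrN (le_trans (le_normr_Ex (L2_Int (LD k))))//.
have Imn : Int P (mn k) by apply: (le_Int (mmn k) (mnM k)); exact: Int_cst.
apply: (@le_trans _ _ (Ex P (fun w => mn k w + M^-1 * D k w ^+ 2))).
  apply: le_Ex.
  - exact: integrable_norm (L2_Int (LD k)).
  - by apply: IntD => //; apply: IntZ; exact: (LD k).2.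
  - move=> w; rewrite /mn; have [h|h] := leP `|D k w| M.
      by rewrite lerDl mulr_ge0 ?sqr_ge0// invr_ge0 ltW.
    rewrite (@le_trans _ _ (M^-1 * D k w ^+ 2))//; last by rewrite lerDr ltW.
    rewrite -real_normK ?num_real// expr2 mulrA ler_peMl//.
    by rewrite mulrC ler_pdivlMr// mul1r ltW.
rewrite ExD ?ExZ//; [|exact: (LD k).2|exact: IntZ (LD k).2].
have h1 := le_trans (ler_norm _) hk.
have h2 : M^-1 * Ex P (fun w => D k w ^+ 2) <= e / 2.
  rewrite mulrC ler_pdivrMr// (le_trans (DC k))// /M.
  rewrite le_eqVlt; apply/orP; left; apply/eqP.
  by field; rewrite gt_eqF.
by lra.
Qed.
End Vitali.

(** * The Riccati equation for the cross-correlation *)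

Section Swap.
Context {R : realType} {d : measure_display} {T : measurableType d}.
Variable P : probability T R.

Lemma cross_corr_tr m (X Y : T -> 'cV[R]_m) : cross_corr P Y X = (cross_corr P X Y)^T.
Proof.
apply/matrixP => i j; rewrite [RHS]mxE !cross_corrE; congr Ex.
by apply/funext => w; rewrite mulrC.
Qed.

(** Exchanging the two blocks is the action of the block permutation matrix
    Pi, under which the covariance becomes Pi S Pi^T. *)
Lemma jointly_gaussian_sym m (X Y : T -> 'cV[R]_m) :
  jointly_gaussian P X Y -> jointly_gaussian P Y X.
Proof.
move=> [S [[symS psd] mZ law]].
pose Pi : 'M[R]_(m + m) := block_mx 0 1%:M 1%:M 0.
have PiE w : Pi *m col_mx (X w) (Y w) = col_mx (Y w) (X w).
  by rewrite /Pi mul_block_col !mul0mx !mul1mx add0r addr0.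
move: Pi PiE => Pi PiE.
exists (Pi *m S *m Pi^T); split.
- split.
    by rewrite /symmx !trmx_mul trmxK symS mulmxA.
  by move=> x; have := psd (Pi^T *m x); rewrite trmx_mul trmxK !mulmxA.
- move=> i; pose Z w := col_mx (X w) (Y w); case: (split_ordP i) => k ->.
    rewrite (_ : coord _ _ = coord Z (rshift m k)); first exact: mZ.
    by apply/funext => w; rewrite /coord col_mxEd col_mxEu.
  rewrite (_ : coord _ _ = coord Z (lshift m k)); first exact: mZ.
  by apply/funext => w; rewrite /coord col_mxEd col_mxEu.
- move=> u B mB.
  have -> : (fun w => (u *m col_mx (Y w) (X w)) 0 0) =
      (fun w => (u *m Pi *m col_mx (X w) (Y w)) 0 0).
    by apply/funext => w; rewrite -mulmxA PiE.
  rewrite (law (u *m Pi) B mB); congr (normal_law (_ 0 0) B).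
  by rewrite trmx_mul !mulmxA.
Qed.

Lemma L2_sum I (s : seq I) (F : I -> T -> R) :
  (forall i, L2 P (F i)) -> L2 P (fun w => \sum_(i <- s) F i w).
Proof.
move=> LF; elim: s => [|i s IH].
  by under eq_fun do rewrite big_nil; exact: L2_cst.
by under eq_fun do rewrite big_cons; exact: L2D.
Qed.
End Swap.

Section RiccatiDef.
Context {R : realType}.
Definition riccati m (SX SY K : 'M[R]_m) : 'M[R]_m :=
  SX + SY - K^T *m invmx SX *m K - K *m invmx SY *m K^T.
End RiccatiDef.

Section OCD.
Context {R : realType} {d : measure_display} {T : measurableType d}.
Variable P : probability T R.
Variables (m : nat) (SX SY : 'M[R]_m) (X Y : R -> T -> 'cV[R]_m).
Hypothesis uX : SX \in unitmx.
Hypothesis uY : SY \in unitmx.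
Hypothesis ocd : L2_OCD P X Y.
Hypothesis lawX : forall t : R, 0 <= t -> centered_gaussian P SX (X t).
Hypothesis lawY : forall t : R, 0 <= t -> centered_gaussian P SY (Y t).
Hypothesis lawXY : forall t : R, 0 <= t -> jointly_gaussian P (X t) (Y t).

Let J t := cross_corr P (X t) (Y t).
Let A t := (J t)^T *m invmx SX.
Let B t := J t *m invmx SY.
Let dX t i w := coord (Y t) i w - lform (X t) (row i (A t)) w.
Let dY t j w := coord (X t) j w - lform (Y t) (row j (B t)) w.
Let G t i j w := dX t i w * coord (Y t) j w + coord (X t) i w * dY t j w.

Let LX t i : 0 <= t -> L4 P (coord (X t) i).
Proof. by move=> t0; exact: gauss_L4 (lawX t0) i. Qed.

Let LY t i : 0 <= t -> L4 P (coord (Y t) i).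
Proof. by move=> t0; exact: gauss_L4 (lawY t0) i. Qed.

Let ae_dX t i : 0 < t ->
  {ae P, forall w, derive1 (fun s => coord (X s) i w) t = dX t i w}.
Proof.
move=> t0; have t0' := ltW t0; have [[_ /(_ t i t0)[M [cM aM]]] _] := ocd.
have h := gauss_cond_exp (lawX t0') (lawY t0') (lawXY t0') uX cM.
apply: filterS2 h aM => w -> ->; rewrite /dX /lform -row_mul; congr (_ - _).
by rewrite [RHS]mxE.
Qed.

Let ae_dY t i : 0 < t ->
  {ae P, forall w, derive1 (fun s => coord (Y s) i w) t = dY t i w}.
Proof.
move=> t0; have t0' := ltW t0; have [_ [_ /(_ t i t0)[M [cM aM]]]] := ocd.
have h := gauss_cond_exp (lawY t0') (lawX t0') (jointly_gaussian_sym (lawXY t0')) uY cM.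
apply: filterS2 h aM => w -> ->; rewrite /dY /lform -row_mul; congr (_ - _).
by rewrite [RHS]mxE cross_corr_tr trmxK.
Qed.

Let Llin (Z : R -> T -> 'cV[R]_m) S t u : centered_gaussian P S (Z t) ->
  L4 P (lform (Z t) u).
Proof. by move=> /(@gauss_lform_moments _ _ _ _ _ _ _)/(_ u)[]. Qed.

Let LdX t i : 0 <= t -> L4 P (dX t i).
Proof.
move=> t0; have := L4D (LY i t0) (L4Z (-1) (Llin (row i (A t)) (lawX t0))).
by congr L4; apply/funext => w; rewrite mulN1r.
Qed.

Let LdY t i : 0 <= t -> L4 P (dY t i).
Proof.
move=> t0; have := L4D (LX i t0) (L4Z (-1) (Llin (row i (B t)) (lawY t0))).
by congr L4; apply/funext => w; rewrite mulN1r.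
Qed.

Let LG t i j : 0 <= t -> L2 P (G t i j).
Proof.
by move=> t0; apply: L2D; apply: L4_L2_mul; [exact: LdX|exact: LY|exact: LX|exact: LdY].
Qed.

Let symSY : SY^T = SY.
Proof. by have [[]] := lawY (lexx (0 : R)). Qed.

Let Ex_G t i j : 0 <= t -> Ex P (G t i j) = riccati SX SY (J t) i j.
Proof.
move=> t0; have gX := lawX t0; have gY := lawY t0.
have I1 : Int P (fun w => coord (Y t) i w * coord (Y t) j w).
  by apply/L2_Int/L4_L2_mul; exact: LY.
have I2 : Int P (fun w => lform (X t) (row i (A t)) w * coord (Y t) j w).
  by apply/L2_Int/L4_L2_mul; [exact: Llin gX|exact: LY].
have I3 : Int P (fun w => coord (X t) i w * coord (X t) j w).
  by apply/L2_Int/L4_L2_mul; exact: LX.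
have I4 : Int P (fun w => lform (Y t) (row j (B t)) w * coord (X t) i w).
  by apply/L2_Int/L4_L2_mul; [exact: Llin gY|exact: LX].
have -> : G t i j = (fun w =>
    (coord (Y t) i w * coord (Y t) j w - lform (X t) (row i (A t)) w * coord (Y t) j w) +
    (coord (X t) i w * coord (X t) j w - lform (Y t) (row j (B t)) w * coord (X t) i w)).
  by apply/funext => w; rewrite /G /dX /dY; ring.
rewrite ExD ?ExB//; [|exact: IntB|exact: IntB].
rewrite (gauss_cov gY) (gauss_cov gX) (Ex_lform_coord gX gY) (Ex_lform_coord gY gX).
rewrite (cross_corr_tr P (X t) (Y t)) -/(J t) -!row_mul.
have aD (U V : 'M[R]_m) : (U + V) i j = U i j + V i j by rewrite mxE.
have aN (U : 'M[R]_m) : (- U) i j = - U i j by rewrite mxE.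
rewrite /riccati !(aD, aN).
have -> : row i (A t *m J t) 0 j = ((J t)^T *m invmx SX *m J t) i j by rewrite mxE.
have -> : row j (B t *m (J t)^T) 0 i = (J t *m invmx SY *m (J t)^T) i j.
  have h : (B t *m (J t)^T)^T = J t *m invmx SY *m (J t)^T.
    by rewrite /B !trmx_mul trmxK trmx_inv symSY mulmxA.
  by rewrite [LHS]mxE -[in RHS]h [RHS]mxE.
ring.
Qed.

(** By |x y| <= x ^ 2 + y ^ 2, since the variances of the coordinates do not
    depend on time. *)
Lemma cross_corr_bounded : exists b : R, 0 <= b /\ forall t : R, 0 <= t -> forall i j, `|J t i j| <= b.
Proof.
exists (\sum_i `|SX i i| + \sum_j `|SY j j|).
split; first by rewrite addr_ge0// sumr_ge0.
move=> t t0 i j.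
have hX : `|SX i i| <= \sum_i `|SX i i|.
  by rewrite (bigD1 i)//= lerDl sumr_ge0.
have hY : `|SY j j| <= \sum_j `|SY j j|.
  by rewrite (bigD1 j)//= lerDl sumr_ge0.
rewrite cross_corrE.
have I : Int P (fun w => coord (X t) i w * coord (Y t) j w).
  by apply/L2_Int/L4_L2_mul; [exact: LX|exact: LY].
have IX : Int P (fun w => coord (X t) i w * coord (X t) i w).
  by apply/L2_Int/L4_L2_mul; exact: LX.
have IY : Int P (fun w => coord (Y t) j w * coord (Y t) j w).
  by apply/L2_Int/L4_L2_mul; exact: LY.
apply: (le_trans (le_normr_Ex I)).
apply: (@le_trans _ _ (Ex P (fun w => coord (X t) i w * coord (X t) i w +
    coord (Y t) j w * coord (Y t) j w))).
  apply: le_Ex; [exact: integrable_norm|exact: IntD|move=> w].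
  rewrite normrM; set x := coord _ _ _; set y := coord _ _ _.
  have -> : x * x = `|x| * `|x| by rewrite -normrM ger0_norm// -expr2 sqr_ge0.
  have -> : y * y = `|y| * `|y| by rewrite -normrM ger0_norm// -expr2 sqr_ge0.
  by have := sqr_ge0 (`|x| - `|y|); have := normr_ge0 x; have := normr_ge0 y; nra.
rewrite ExD// (gauss_cov (lawX t0)) (gauss_cov (lawY t0)).
by apply: lerD; apply: le_trans (ler_norm _) _.
Qed.

Let AB_bounded : exists c, 0 <= c /\ forall t, 0 <= t -> forall i j,
  `|A t i j| <= c /\ `|B t i j| <= c.
Proof.
have [b [b0 hb]] := cross_corr_bounded.
pose nX := \sum_k \sum_l `|invmx SX k l|; pose nY := \sum_k \sum_l `|invmx SY k l|.
have col_le (M : 'M[R]_m) j : \sum_k `|M k j| <= \sum_k \sum_l `|M k l|.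
  by apply: ler_sum => k _; rewrite (bigD1 j)//= lerDl sumr_ge0.
have n0 (M : 'M[R]_m) : 0 <= \sum_k \sum_l `|M k l|.
  by apply: sumr_ge0 => k _; exact: sumr_ge0.
exists (b * nX + b * nY); split; first by rewrite addr_ge0// mulr_ge0// n0.
move=> t t0 i j; split.
- rewrite /A mxE (le_trans (ler_norm_sum _ _ _))//.
  apply: (@le_trans _ _ (b * nX)); last by rewrite lerDl mulr_ge0// n0.
  apply: (@le_trans _ _ (b * \sum_k `|invmx SX k j|)); last by rewrite ler_wpM2l.
  by rewrite mulr_sumr; apply: ler_sum => k _; rewrite normrM mxE ler_wpM2r// hb.
- rewrite /B mxE (le_trans (ler_norm_sum _ _ _))//.
  apply: (@le_trans _ _ (b * nY)); last by rewrite lerDr mulr_ge0// n0.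
  apply: (@le_trans _ _ (b * \sum_k `|invmx SY k j|)); last by rewrite ler_wpM2l.
  by rewrite mulr_sumr; apply: ler_sum => k _; rewrite normrM ler_wpM2r// hb.
Qed.

Let N1 t w := \sum_(k < m) (`|coord (X t) k w| + `|coord (Y t) k w|).
Let N4 t w := \sum_(k < m) (coord (X t) k w ^+ 4 + coord (Y t) k w ^+ 4).

Let N1_ge0 t w : 0 <= N1 t w.
Proof. by apply: sumr_ge0 => k _; exact: addr_ge0. Qed.

Let X_le_N1 t w i : `|coord (X t) i w| <= N1 t w.
Proof.
by rewrite /N1 (bigD1 i)//= -addrA lerDl addr_ge0// sumr_ge0.
Qed.

Let Y_le_N1 t w i : `|coord (Y t) i w| <= N1 t w.
Proof.
by rewrite /N1 (bigD1 i)//= addrAC lerDr addr_ge0// sumr_ge0.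
Qed.

Let N1_N4 t w : N1 t w ^+ 4 <= 8 * m%:R ^+ 3 * N4 t w.
Proof.
pose a k := `|coord (X t) k w| + `|coord (Y t) k w|.
have h1 : N1 t w ^+ 2 <= m%:R * \sum_k a k ^+ 2 := sqr_sum_le a.
have h2 := sqr_sum_le (fun k => a k ^+ 2).
have q0 : 0 <= \sum_k a k ^+ 2 by apply: sumr_ge0 => k _; exact: sqr_ge0.
have -> : N1 t w ^+ 4 = (N1 t w ^+ 2) ^+ 2 by ring.
apply: (@le_trans _ _ ((m%:R * \sum_k a k ^+ 2) ^+ 2)).
  by rewrite ler_sqr ?nnegrE ?sqr_ge0// mulr_ge0.
rewrite exprMn.
apply: (@le_trans _ _ (m%:R ^+ 2 * (m%:R * \sum_k (a k ^+ 2) ^+ 2))).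
  by rewrite ler_wpM2l// sqr_ge0.
have -> : m%:R ^+ 2 * (m%:R * \sum_k (a k ^+ 2) ^+ 2) =
  m%:R ^+ 3 * \sum_k (a k ^+ 2) ^+ 2 by ring.
have -> : 8 * m%:R ^+ 3 * N4 t w = m%:R ^+ 3 * (8 * N4 t w) by ring.
rewrite ler_wpM2l ?exprn_ge0//.
rewrite /N4 mulr_sumr; apply: ler_sum => k _.
rewrite /a; set x := coord _ _ _; set y := coord _ _ _.
have -> : x ^+ 4 = (`|x| ^+ 2) ^+ 2 by rewrite real_normK ?num_real//; ring.
have -> : y ^+ 4 = (`|y| ^+ 2) ^+ 2 by rewrite real_normK ?num_real//; ring.
move: (`|x|) (`|y|) => u v.
have h : (u + v) ^+ 2 <= 2 * (u ^+ 2 + v ^+ 2) by have := sqr_ge0 (u - v); nra.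
apply: (@le_trans _ _ ((2 * (u ^+ 2 + v ^+ 2)) ^+ 2)).
  by rewrite ler_sqr ?nnegrE ?sqr_ge0// mulr_ge0// addr_ge0 ?sqr_ge0.
by have := sqr_ge0 (u ^+ 2 - v ^+ 2); nra.
Qed.

Let IN4 t : 0 <= t -> Int P (N4 t).
Proof.
by move=> t0; apply: Int_sum => k; apply: IntD; [exact: (LX k t0).2|exact: (LY k t0).2].
Qed.

Let Ex_N4 t : 0 <= t -> Ex P (N4 t) = Ex P (N4 0).
Proof.
move=> t0; have z0 := lexx (0 : R).
have E s : 0 <= s -> Ex P (N4 s) =
    \sum_(k < m) (Ex P (fun w => coord (X s) k w ^+ 4) + Ex P (fun w => coord (Y s) k w ^+ 4)).
  move=> s0; rewrite /N4 Ex_sum; last first.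
    by move=> k; apply: IntD; [exact: (LX k s0).2|exact: (LY k s0).2].
  by apply: eq_bigr => k _; rewrite ExD//; [exact: (LX k s0).2|exact: (LY k s0).2].
rewrite !E//; apply: eq_bigr => k _.
have law4 (Z : R -> T -> 'cV[R]_m) S : (forall t, 0 <= t -> centered_gaussian P S (Z t)) ->
    Ex P (fun w => coord (Z t) k w ^+ 4) = Ex P (fun w => coord (Z 0) k w ^+ 4).
  move=> lawZ; apply: eq_law_Ex4.
  - exact: gauss_measurable (lawZ t t0) k.
  - exact: gauss_measurable (lawZ 0 z0) k.
  - move=> C mC; rewrite !coord_lform.
    have [_ _ l1] := lawZ t t0; have [_ _ l2] := lawZ 0 z0.
    have e1 := l1 (delta_mx 0 k) C mC; have e2 := l2 (delta_mx 0 k) C mC.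
    by rewrite [LHS]e1 [RHS]e2.
by rewrite (law4 X SX lawX) (law4 Y SY lawY).
Qed.

Let G2_bounded : exists2 C, 0 <= C & forall t, 0 <= t -> forall i j,
  Ex P (fun w => G t i j w ^+ 2) <= C.
Proof.
have [c [c0 hc]] := AB_bounded.
(* |G| <= 2 (1 + c) N1 ^ 2 and N1 ^ 4 <= 8 m ^ 3 N4, where N4 has a constant mean. *)
pose C1 := 4 * (1 + c) ^+ 2 * (8 * m%:R ^+ 3).
have C10 : 0 <= C1.
  by rewrite /C1 mulr_ge0// mulr_ge0 ?sqr_ge0 ?exprn_ge0.
exists (C1 * Ex P (N4 0)).
  rewrite mulr_ge0//; apply: Ex_ge0 => w; apply: sumr_ge0 => k _.
  by rewrite addr_ge0// exprn_even_ge0.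
move=> t t0 i j.
have lin (Z : T -> 'cV[R]_m) (u : 'rV[R]_m) w : (forall k, `|u 0 k| <= c) ->
    (\sum_k `|coord Z k w| <= N1 t w) -> `|lform Z u w| <= c * N1 t w.
  move=> uc ZN; rewrite lformE (le_trans (ler_norm_sum _ _ _))//.
  apply: (@le_trans _ _ (c * \sum_k `|coord Z k w|)); last by rewrite ler_wpM2l.
  by rewrite mulr_sumr; apply: ler_sum => k _; rewrite normrM ler_wpM2r.
have hdX w : `|dX t i w| <= (1 + c) * N1 t w.
  rewrite mulrDl mul1r (le_trans (ler_normB _ _))// lerD//.
  apply: lin => [k|]; first by rewrite mxE; have [] := hc t t0 i k.
  by apply: ler_sum => k _; rewrite lerDl.
have hdY w : `|dY t j w| <= (1 + c) * N1 t w.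
  rewrite mulrDl mul1r (le_trans (ler_normB _ _))// lerD//.
  apply: lin => [k|]; first by rewrite mxE; have [] := hc t t0 j k.
  by apply: ler_sum => k _; rewrite lerDr.
have hG w : G t i j w ^+ 2 <= C1 * N4 t w.
  have h : `|G t i j w| <= 2 * (1 + c) * N1 t w ^+ 2.
    rewrite /G (le_trans (ler_normD _ _))// !normrM.
    have -> : 2 * (1 + c) * N1 t w ^+ 2 =
      (1 + c) * N1 t w * N1 t w + N1 t w * ((1 + c) * N1 t w) by ring.
    by apply: lerD; apply: ler_pM.
  rewrite -real_normK ?num_real//.
  apply: (@le_trans _ _ ((2 * (1 + c) * N1 t w ^+ 2) ^+ 2)).
    by rewrite ler_sqr ?nnegrE// (le_trans _ h).
  have -> : (2 * (1 + c) * N1 t w ^+ 2) ^+ 2 = 4 * (1 + c) ^+ 2 * N1 t w ^+ 4 by ring.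
  rewrite /C1 -[leRHS]mulrA ler_wpM2l ?N1_N4//.
  by rewrite mulr_ge0// sqr_ge0.
apply: (@le_trans _ _ (Ex P (fun w => C1 * N4 t w))).
  by apply: le_Ex => //; [exact: (LG i j t0).2|apply: IntZ; exact: IN4].
by rewrite ExZ ?Ex_N4//; exact: IN4.
Qed.

Let rs s t N i j w :=
  \sum_(k < N.+1) (t - s) / N.+1%:R * G (grid_point s t N k) i j w.

Let grid_point_gt0 (s t : R) N (k : 'I_N.+1) : 0 < s -> s < t -> 0 < grid_point s t N k.
Proof.
move=> s0 st.
by have /andP[+ _] := @grid_point_itv _ s t N k (ltW st) (ltnW (ltn_ord k)); exact: lt_le_trans.
Qed.

Let Lrs s t N i j : 0 < s -> s < t -> L2 P (rs s t N i j).
Proof.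
move=> s0 st; apply: L2_sum => k; apply: L2Z; apply: LG.
exact/ltW/grid_point_gt0.
Qed.

Let Ex_rs s t N i j : 0 < s -> s < t -> Ex P (rs s t N i j) =
  \sum_(k < N.+1) (t - s) / N.+1%:R * riccati SX SY (J (grid_point s t N k)) i j.
Proof.
move=> s0 st; have r0 k := ltW (@grid_point_gt0 s t N k s0 st).
rewrite Ex_sum; last by move=> k; apply: IntZ; exact/L2_Int/LG/r0.
apply: eq_bigr => k _; rewrite ExZ; last exact/L2_Int/LG/r0.
by rewrite Ex_G// r0.
Qed.

Let rs2_bounded s t i j C : 0 < s -> s < t ->
  (forall r, 0 <= r -> Ex P (fun w => G r i j w ^+ 2) <= C) ->
  forall N, Ex P (fun w => rs s t N i j w ^+ 2) <= (t - s) ^+ 2 * C.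
Proof.
move=> s0 st hC N; have r0 k := ltW (@grid_point_gt0 s t N k s0 st).
pose del := (t - s) / N.+1%:R.
(* The square of a sum of N + 1 terms is at most N + 1 times the sum of squares. *)
have IG (k : 'I_N.+1) : Int P (fun w => G (grid_point s t N k) i j w ^+ 2).
  by case: (LG i j (r0 k)).
have ISG : Int P (fun w => \sum_(k < N.+1) G (grid_point s t N k) i j w ^+ 2).
  exact: Int_sum.
apply: (@le_trans _ _ (Ex P (fun w => N.+1%:R * del ^+ 2 *
    \sum_(k < N.+1) G (grid_point s t N k) i j w ^+ 2))).
  apply: le_Ex; [exact: (Lrs N i j s0 st).2|exact: IntZ|move=> w].
  rewrite (le_trans (sqr_sum_le _))//.
  rewrite -mulrA ler_wpM2l// mulr_sumr.
  by apply: ler_sum => k _; rewrite exprMn.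
rewrite ExZ// Ex_sum//.
have N0 : 0 < N.+1%:R :> R by [].
have -> : (t - s) ^+ 2 * C = N.+1%:R * del ^+ 2 * (N.+1%:R * C).
  by rewrite /del; move: (N.+1%:R : R) N0 => K K0; field; rewrite gt_eqF.
apply: ler_wpM2l; first by apply: mulr_ge0; [exact: ltW|exact: sqr_ge0].
apply: (@le_trans _ _ (\sum_(k < N.+1) C)).
  by apply: ler_sum => k _; exact: hC (r0 k).
by rewrite sumr_const card_ord mulr_natl.
Qed.

Let ae_rs_cvg s t i j : 0 < s -> s < t -> {ae P, forall w,
  rs s t N i j w @[N --> \oo] -->
  coord (X t) i w * coord (Y t) j w - coord (X s) i w * coord (Y s) j w}.
Proof.
move=> s0 st; have [[cX _] [cY _]] := ocd.
have aeX : {ae P, forall w, forall N, forall k : nat, (k < N.+1)%N ->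
    derive1 (fun s => coord (X s) i w) (grid_point s t N k) = dX (grid_point s t N k) i w}.
  apply: ae_foralln => N; apply: ae_foralln => k.
  have [kN|kN] := ltnP k N.+1; last by apply: aeW => w.
  by apply: filterS (ae_dX i (@grid_point_gt0 s t N (Ordinal kN) s0 st)).
have aeY : {ae P, forall w, forall N, forall k : nat, (k < N.+1)%N ->
    derive1 (fun s => coord (Y s) j w) (grid_point s t N k) = dY (grid_point s t N k) j w}.
  apply: ae_foralln => N; apply: ae_foralln => k.
  have [kN|kN] := ltnP k N.+1; last by apply: aeW => w.
  by apply: filterS (ae_dY j (@grid_point_gt0 s t N (Ordinal kN) s0 st)).
apply: (filterS _ (filterI (filterI (cX i) (cY j)) (filterI aeX aeY))) => w [[[_ dx cdx] [_ dy cdy]] [ex ey]].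
pose x r := coord (X r) i w; pose y r := coord (Y r) j w.
pose dg r := x r * derive1 y r + y r * derive1 x r.
have -> : (fun N => rs s t N i j w) =
    (fun N => \sum_(k < N.+1) (t - s) / N.+1%:R * dg (grid_point s t N k)).
  apply/funext => N; apply: eq_bigr => k _; congr (_ * _).
  have kN := ltn_ord k.
  by rewrite /dg /x /y (ex N k kN) (ey N k kN) /G; ring.
have pos r : s <= r <= t -> 0 < r by move=> /andP[+ _]; exact: lt_le_trans.
apply: (riemann_sum_cvg (g := fun r => x r * y r)) => //.
- move=> r /pos r0.
  have hx : is_derive r 1 x (derive1 x r).
    by rewrite derive1E; apply/derivableP; exact: dx.
  have hy : is_derive r 1 y (derive1 y r).
    by rewrite derive1E; apply/derivableP; exact: dy.
  exact: is_deriveM.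
- move=> r /pos r0.
  have ctx : {for r, continuous x}.
    exact/differentiable_continuous/derivable1_diffP/dx.
  have cty : {for r, continuous y}.
    exact/differentiable_continuous/derivable1_diffP/dy.
  apply: cvgD; apply: cvgM => //; [exact: cdy|exact: cdx].
Qed.

Let J_incr_cvg s t i j : 0 < s -> s < t ->
  \sum_(k < N.+1) (t - s) / N.+1%:R * riccati SX SY (J (grid_point s t N k)) i j
    @[N --> \oo] --> J t i j - J s i j.
Proof.
move=> s0 st; have t0 := lt_trans s0 st.
have [C C0 hC] := G2_bounded.
have L r : 0 <= r -> L2 P (fun w => coord (X r) i w * coord (Y r) j w).
  by move=> r0; apply: L4_L2_mul; [exact: LX|exact: LY].
have LD : L2 P (fun w =>
    coord (X t) i w * coord (Y t) j w - coord (X s) i w * coord (Y s) j w).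
  have := L2D (L _ (ltW t0)) (L2Z (-1) (L _ (ltW s0))).
  by congr L2; apply/funext => w; rewrite mulN1r.
have E : (fun N => Ex P (rs s t N i j)) = (fun N =>
    \sum_(k < N.+1) (t - s) / N.+1%:R * riccati SX SY (J (grid_point s t N k)) i j).
  by apply/funext => N; rewrite Ex_rs.
rewrite -E !cross_corrE -ExB; [|exact/L2_Int/L/ltW|exact/L2_Int/L/ltW].
exact: (@L2_bounded_cvg_Ex _ _ _ P (fun N => rs s t N i j) _
  ((t - s) ^+ 2 * C) (fun N => Lrs N i j s0 st) LD (ae_rs_cvg i j s0 st)
  (rs2_bounded s0 st (fun r r0 => hC r r0 i j))).
Qed.

Let avg_le (s t : R) N (f : nat -> R) (K : R) : s < t -> (forall k, (k < N.+1)%N -> f k <= K) ->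
  \sum_(k < N.+1) (t - s) / N.+1%:R * f k <= (t - s) * K.
Proof.
move=> st fK; have N0 : 0 < N.+1%:R :> R by [].
apply: (@le_trans _ _ (\sum_(k < N.+1) (t - s) / N.+1%:R * K)).
  apply: ler_sum => k _; rewrite ler_wpM2l ?fK//.
  by rewrite divr_ge0 ?subr_ge0 ?ltW.
rewrite sumr_const card_ord.
have -> : (t - s) * K = N.+1%:R * ((t - s) / N.+1%:R * K).
  by move: (N.+1%:R : R) N0 => M M0; field; rewrite gt_eqF.
by rewrite mulr_natl.
Qed.

Let J_incr_le s t i j K : 0 < s -> s < t ->
  (forall r, s <= r <= t -> riccati SX SY (J r) i j <= K) ->
  J t i j - J s i j <= (t - s) * K.
Proof.
move=> s0 st hK; have c := @J_incr_cvg s t i j s0 st.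
rewrite -(cvg_lim _ c)//; apply: limr_le; first by apply/cvg_ex; eexists; exact: c.
apply: nearW => N; apply: (avg_le (f := fun k => riccati SX SY (J (grid_point s t N k)) i j)) => // k kN.
by apply: hK; exact: grid_point_itv (ltW st) (ltnW kN).
Qed.

Let J_incr_ge s t i j K : 0 < s -> s < t ->
  (forall r, s <= r <= t -> K <= riccati SX SY (J r) i j) ->
  (t - s) * K <= J t i j - J s i j.
Proof.
move=> s0 st hK; have c := @J_incr_cvg s t i j s0 st.
rewrite -(cvg_lim _ c)//; apply: limr_ge; first by apply/cvg_ex; eexists; exact: c.
apply: nearW => N.
have := @avg_le s t N (fun k => - riccati SX SY (J (grid_point s t N k)) i j) (- K) st.
have -> : \sum_(k < N.+1) (t - s) / N.+1%:R * - riccati SX SY (J (grid_point s t N k)) i j =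
    - \sum_(k < N.+1) (t - s) / N.+1%:R * riccati SX SY (J (grid_point s t N k)) i j.
  by rewrite -sumrN; apply: eq_bigr => k _; rewrite mulrN.
rewrite mulrN lerN2; apply.
by move=> k kN; rewrite lerN2; apply: hK; exact: grid_point_itv (ltW st) (ltnW kN).
Qed.

Let riccati_bounded : exists2 K, 0 <= K & forall t, 0 <= t -> forall i j,
  `|riccati SX SY (J t) i j| <= K.
Proof.
have [C C0 hC] := G2_bounded; exists (1 + C); first by rewrite addr_ge0.
move=> t t0 i j; rewrite -Ex_G//.
apply: (le_trans (le_normr_Ex (L2_Int (LG i j t0)))).
apply: (@le_trans _ _ (Ex P (fun w => 1 + G t i j w ^+ 2))).
  apply: le_Ex.
  - exact: integrable_norm (L2_Int (LG i j t0)).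
  - by apply: IntD; [exact: Int_cst|exact: (LG i j t0).2].
  - move=> w; have := sqr_ge0 (`|G t i j w| - 1).
    rewrite -[X in _ <= _ + X]real_normK ?num_real//; have := normr_ge0 (G t i j w).
    by nra.
by rewrite ExD ?Ex_cst ?lerD2l ?hC//; [exact: Int_cst|exact: (LG i j t0).2].
Qed.

Let J_lip_pos : exists2 K, 0 <= K & forall s t : R, 0 < s -> s < t -> forall i j,
  `|J t i j - J s i j| <= K * (t - s).
Proof.
have [K K0 hK] := riccati_bounded; exists K => // s t s0 st i j.
have pos r : s <= r <= t -> 0 <= r by move=> /andP[+ _]; exact/le_trans/ltW.
rewrite ler_norml; apply/andP; split.
  have := @J_incr_ge s t i j (- K) s0 st; rewrite mulrN mulrC; apply.
  by move=> r /pos r0; have := hK r r0 i j; rewrite ler_norml => /andP[].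
have := @J_incr_le s t i j K s0 st; rewrite mulrC; apply.
by move=> r /pos r0; have := hK r r0 i j; rewrite ler_norml => /andP[].
Qed.

Let J0_cvg i j : J k.+1%:R^-1 i j @[k --> \oo] --> J 0 i j.
Proof.
have z0 := lexx (0 : R).
have p k : 0 <= k.+1%:R^-1 :> R by [].
have L r : 0 <= r -> L2 P (fun w => coord (X r) i w * coord (Y r) j w).
  by move=> r0; apply: L4_L2_mul; [exact: LX|exact: LY].
have E : (fun k => J k.+1%:R^-1 i j) =
    (fun k => Ex P (fun w => coord (X k.+1%:R^-1) i w * coord (Y k.+1%:R^-1) j w)).
  by apply/funext => k; rewrite cross_corrE.
rewrite E cross_corrE.
apply: (@L2_bounded_cvg_Ex _ _ _ P _ _ (8 * m%:R ^+ 3 * Ex P (N4 0))).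
- by move=> k; exact: L (p k).
- exact: L z0.
- have [[cX _] [cY _]] := ocd.
  apply: filterS2 (cX i) (cY j) => w [wx _ _] [wy _ _].
  have seq0 (f : R -> R) : {within `[0, +oo[, continuous f} ->
      f k.+1%:R^-1 @[k --> \oo] --> f 0.
    move=> /continuous_within_itvcyP[_ /cvg_at_rightP]; apply; split => //.
    exact: cvg_harmonic.
  by apply: cvgM; [exact: (seq0 _ wx)|exact: (seq0 _ wy)].
- move=> k; rewrite -(Ex_N4 (p k)) -ExZ; last exact: IN4.
  apply: le_Ex; [exact: (L _ (p k)).2|by apply: IntZ; exact: IN4|move=> w].
  rewrite (le_trans _ (N1_N4 _ _))// exprMn.
  have -> : N1 k.+1%:R^-1 w ^+ 4 = N1 k.+1%:R^-1 w ^+ 2 * N1 k.+1%:R^-1 w ^+ 2 by ring.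
  apply: ler_pM; rewrite ?sqr_ge0// -real_normK ?num_real//;
    by rewrite ler_sqr ?nnegrE ?N1_ge0// ?X_le_N1 ?Y_le_N1.
Qed.

(** For positive times the increments are limits of averages of the bounded
    function riccati (J r). Time 0 is reached by continuity of the
    trajectories along the sequence 1 / (k + 1), because their derivatives
    are only controlled at positive times. *)
Lemma cross_corr_lip : exists2 K, 0 <= K & forall s t : R, 0 <= s -> s <= t -> forall i j,
  `|J t i j - J s i j| <= K * (t - s).
Proof.
have [K K0 hK] := J_lip_pos; exists K => // s t s0 st i j.
move: st; rewrite le_eqVlt => /predU1P[->|st]; first by rewrite !subrr normr0 mulr0.
move: s0; rewrite le_eqVlt => /predU1P[s0|s0]; last exact: hK.
rewrite -s0 in st *; rewrite subr0.
have c : `|J t i j - J k.+1%:R^-1 i j| @[k --> \oo] --> `|J t i j - J 0 i j|.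
  by apply: cvg_norm; apply: cvgB; [exact: cvg_cst|exact: J0_cvg].
rewrite -(cvg_lim _ c)//; apply: limr_le; first by apply/cvg_ex; eexists; exact: c.
near=> k.
have kt : k.+1%:R^-1 < t.
  rewrite invf_plt ?posrE//.
  rewrite (lt_le_trans (truncnS_gt _))// ler_nat ltnS.
  by near: k; exact: nbhs_infty_ge.
rewrite (le_trans (hK _ _ _ kt i j))// ler_wpM2l//.
by rewrite lerBlDr lerDl.
Unshelve. all: by end_near. Qed.

Let mcont (M : R -> 'M[R]_m) t := forall i j, (fun r => M r i j) @ t --> M t i j.

Let mcontM (M N : R -> 'M[R]_m) t : mcont M t -> mcont N t ->
  mcont (fun r => M r *m N r) t.
Proof.
move=> cM cN i j; rewrite /= [X in _ --> X]mxE.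
rewrite (_ : (fun r => _) = (fun r => \sum_k M r i k * N r k j)); last first.
  by apply/funext => r; rewrite mxE.
elim: (index_enum _) => [|k l IH].
  rewrite big_nil; rewrite (_ : (fun r => _) = (fun=> 0)); first exact: cvg_cst.
  by apply/funext => r; rewrite big_nil.
rewrite big_cons (_ : (fun r => _) = (fun r => M r i k * N r k j +
    \sum_(k <- l) M r i k * N r k j)); last by apply/funext => r; rewrite big_cons.
by apply: cvgD => //; apply: cvgM; [exact: cM|exact: cN].
Qed.

Let mcont_cst M t : mcont (fun=> M) t.
Proof. by move=> i j; exact: cvg_cst. Qed.

Let mcont_tr M t : mcont M t -> mcont (fun r => (M r)^T) t.
Proof.
move=> cM i j; rewrite mxE; rewrite (_ : (fun r => _) = (fun r => M r j i)); first exact: cM.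
by apply/funext => r; rewrite mxE.
Qed.

Let mcontJ t : 0 < t -> mcont J t.
Proof.
move=> t0 i j; have [K K0 hK] := cross_corr_lip.
apply/cvgrPdist_le => e e0.
have K1 : 0 < K + 1 by rewrite ltr_wpDl.
near=> r.
have r0 : 0 <= r.
  apply: ltW; near: r; exact: lt_nbhsr.
have rt : `|t - r| < e / (K + 1).
  near: r; apply: cvgr_dist_lt; [exact: cvg_id|exact: divr_gt0].
apply: (@le_trans _ _ (K * `|t - r|)).
  have [h|/ltW h] := leP r t.
    by rewrite (ger0_norm (_ : 0 <= t - r)) ?subr_ge0//; exact: hK.
  rewrite [in leRHS]distrC (ger0_norm (_ : 0 <= r - t)) ?subr_ge0// distrC.
  exact: hK (ltW t0) h i j.
apply: (@le_trans _ _ ((K + 1) * `|t - r|)); first by rewrite ler_wpM2r// lerDl.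
by rewrite mulrC -ler_pdivlMr// ltW.
Unshelve. all: by end_near. Qed.

Let riccati_cont (t : R) i j : 0 < t ->
  (fun r => riccati SX SY (J r) i j) @ t --> riccati SX SY (J t) i j.
Proof.
move=> t0; have cJ := mcontJ t0.
have c1 := mcontM (mcontM (mcont_tr cJ) (@mcont_cst (invmx SX) t)) cJ.
have c2 := mcontM (mcontM cJ (@mcont_cst (invmx SY) t)) (mcont_tr cJ).
have aD (U V : 'M[R]_m) : (U + V) i j = U i j + V i j by rewrite mxE.
have aN (U : 'M[R]_m) : (- U) i j = - U i j by rewrite mxE.
rewrite /riccati !(aD, aN).
rewrite (_ : (fun r => _) = (fun r => SX i j + SY i j -
  ((J r)^T *m invmx SX *m J r) i j - (J r *m invmx SY *m (J r)^T) i j)).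
  by apply: cvgB; [apply: cvgB; [exact: cvg_cst|exact: c1]|exact: c2].
by apply/funext => r; rewrite !(aD, aN).
Qed.

(** Increments of J over a segment lie between the bounds of riccati (J r) on
    it, times its length; continuity of riccati along J, a consequence of
    cross_corr_lip, turns this into differentiability. *)
Lemma cross_corr_riccati (t : R) i j : 0 < t ->
  is_derive t 1 (fun r => J r i j) (riccati SX SY (J t) i j).
Proof.
move=> t0; set phi := riccati SX SY (J t) i j.
have c : h^-1 *: (((fun r => J r i j) \o shift t) (h *: 1) - J t i j) @[h --> 0^'] --> phi.
  apply/cvgrPdist_le => e e0.
  have /cvgrPdist_le/(_ _ e0)/nbhs_ballP[r /= r0 hr] := @riccati_cont t i j t0.
  near=> h.
  have hn0 : h != 0 by near: h; exact: nbhs_dnbhs_neq.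
  have hlt : `|h| < Num.min r t.
    near: h; apply: dnbhs0_lt; rewrite lt_min r0 t0//.
  move: hlt; rewrite lt_min => /andP[hr' ht'].
  rewrite /= [h *: 1]mulr1.
  have bnd s : `|s - t| <= `|h| -> phi - e <= riccati SX SY (J s) i j <= phi + e.
    move=> sh; have := hr s _; rewrite /ball /= -/phi distrC.
    move=> /(_ (le_lt_trans sh hr')); rewrite ler_norml => /andP[h1 h2].
    by apply/andP; split; lra.
  have [h0|h0|h0] := ltgtP h 0.
  - have th0 : 0 < h + t by move: ht'; rewrite ltr0_norm//; lra.
    have tht : h + t < t by lra.
    have hin s : h + t <= s <= t -> `|s - t| <= `|h|.
      by move=> /andP[h1 h2]; rewrite (ltr0_norm h0) ler_norml; apply/andP; split; lra.
    have u := @J_incr_le (h + t) t i j (phi + e) th0 tht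
      (fun s hs => (andP (bnd s (hin s hs))).2).
    have l := @J_incr_ge (h + t) t i j (phi - e) th0 tht
      (fun s hs => (andP (bnd s (hin s hs))).1).
    have E : h^-1 *: (J (h + t) i j - J t i j) = (J t i j - J (h + t) i j) / (- h).
      by rewrite /GRing.scale /=; field; rewrite hn0.
    rewrite E ler_norml; apply/andP; split.
      by rewrite lerBrDl -lerBrDr opprK ler_pdivrMr ?oppr_gt0//; lra.
    by rewrite lerBlDr -lerBlDl ler_pdivlMr ?oppr_gt0//; lra.
  - have tth : t < h + t by lra.
    have hin s : t <= s <= h + t -> `|s - t| <= `|h|.
      by move=> /andP[h1 h2]; rewrite (gtr0_norm h0) ler_norml; apply/andP; split; lra.
    have u := @J_incr_le t (h + t) i j (phi + e) t0 tth
      (fun s hs => (andP (bnd s (hin s hs))).2).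
    have l := @J_incr_ge t (h + t) i j (phi - e) t0 tth
      (fun s hs => (andP (bnd s (hin s hs))).1).
    have E : h^-1 *: (J (h + t) i j - J t i j) = (J (h + t) i j - J t i j) / h.
      by rewrite /GRing.scale /= mulrC.
    rewrite E ler_norml; apply/andP; split.
      by rewrite lerBrDl -lerBrDr opprK ler_pdivrMr//; lra.
    by rewrite lerBlDr -lerBlDl ler_pdivlMr//; lra.
  - by rewrite h0 eqxx in hn0.
split; first by apply/cvg_ex; exists phi.
exact: cvg_lim c.
Unshelve. all: by end_near. Qed.

End OCD.

(** * The entrywise norm and the spectral norm *)

Section EntryNorm.
Context {R : realType}.

(** The sum of absolute values is submultiplicative, is invariant under
    transposition and dominates the spectral norm, so every estimate below
    can be made entrywise. *)
Definition entry_norm m n (M : 'M[R]_(m, n)) : R := \sum_i \sum_j `|M i j|.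
Local Notation n1 := entry_norm.

Lemma entry_norm_ge0 m n (M : 'M[R]_(m, n)) : 0 <= n1 M.
Proof. by apply: sumr_ge0 => i _; apply: sumr_ge0. Qed.

Lemma entry_le_norm m n (M : 'M[R]_(m, n)) i j : `|M i j| <= n1 M.
Proof.
rewrite /entry_norm (bigD1 i)//= (bigD1 j)//= -addrA lerDl addr_ge0//.
  exact: sumr_ge0.
by apply: sumr_ge0 => k _; exact: sumr_ge0.
Qed.

Lemma entry_normD m n (M N : 'M[R]_(m, n)) : n1 (M + N) <= n1 M + n1 N.
Proof.
rewrite /entry_norm -big_split /=; apply: ler_sum => i _.
by rewrite -big_split /=; apply: ler_sum => j _; rewrite mxE ler_normD.
Qed.

Lemma entry_normN m n (M : 'M[R]_(m, n)) : n1 (- M) = n1 M.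
Proof.
by rewrite /entry_norm; do 2 (apply: eq_bigr => ? _); rewrite mxE normrN.
Qed.

Lemma entry_norm_tr m n (M : 'M[R]_(m, n)) : n1 M^T = n1 M.
Proof.
rewrite /entry_norm exchange_big /=.
by do 2 (apply: eq_bigr => ? _); rewrite mxE.
Qed.

Lemma entry_normM m n p (M : 'M[R]_(m, n)) (N : 'M[R]_(n, p)) :
  n1 (M *m N) <= n1 M * n1 N.
Proof.
rewrite /entry_norm mulr_suml; apply: ler_sum => i _.
apply: (@le_trans _ _ (\sum_j \sum_k `|M i k| * `|N k j|)).
  apply: ler_sum => j _; rewrite mxE (le_trans (ler_norm_sum _ _ _))//.
  by apply: ler_sum => k _; rewrite normrM.
rewrite exchange_big /= mulr_suml; apply: ler_sum => k _.
rewrite -mulr_sumr ler_wpM2l//.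
by rewrite (bigD1 k)//= lerDl; apply: sumr_ge0 => l _; exact: sumr_ge0.
Qed.

Lemma entry_norm_diag m (v : 'rV[R]_m) : n1 (diag_mx v) = \sum_i `|v 0 i|.
Proof.
rewrite /entry_norm; apply: eq_bigr => i _.
rewrite (bigD1 i)//= mxE eqxx mulr1n big1 ?addr0// => j ji.
by rewrite mxE eq_sym (negbTE ji) mulr0n normr0.
Qed.

Lemma sqr_entry_norm_le m n (M : 'M[R]_(m, n)) :
  n1 M ^+ 2 <= (m * n)%:R * \sum_i \sum_j M i j ^+ 2.
Proof.
rewrite /entry_norm (le_trans (sqr_sum_le _))// natrM -mulrA ler_wpM2l//.
rewrite mulr_sumr; apply: ler_sum => i _.
rewrite (le_trans (sqr_sum_le _))// ler_wpM2l//.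
by apply: ler_sum => j _; rewrite real_normK ?num_real.
Qed.

Lemma l2norm_entry m (x : 'cV[R]_m) i : `|x i 0| <= l2norm x.
Proof.
rewrite /l2norm -sqrtr_sqr ler_wsqrtr// (bigD1 i)//= lerDl.
by apply: sumr_ge0 => k _; exact: sqr_ge0.
Qed.

Lemma sum_sqr_le (I : Type) (r : seq I) (x : I -> R) :
  \sum_(i <- r) x i ^+ 2 <= (\sum_(i <- r) `|x i|) ^+ 2.
Proof.
elim: r => [|i r IH]; first by rewrite !big_nil expr0n.
have s0 : 0 <= \sum_(i <- r) `|x i| by exact: sumr_ge0.
rewrite !big_cons sqrrD real_normK ?num_real//.
by have := normr_ge0 (x i); nra.
Qed.

Lemma l2norm_le_sum m (x : 'cV[R]_m) : l2norm x <= \sum_i `|x i 0|.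
Proof.
have s0 : 0 <= \sum_i `|x i 0| by exact: sumr_ge0.
by rewrite /l2norm -(ger0_norm s0) -sqrtr_sqr ler_wsqrtr// sum_sqr_le.
Qed.

Lemma spectral_norm_le m n (M : 'M[R]_(m, n)) : spectral_norm M <= n1 M.
Proof.
apply: ge_sup.
  exists (l2norm (M *m 0)); exists 0 => //=.
  rewrite /l2norm big1 ?sqrtr0// => i _.
  by rewrite mxE expr0n.
move=> _ [x /= x1 <-]; rewrite (le_trans (l2norm_le_sum _))// /entry_norm.
apply: ler_sum => i _; rewrite mxE (le_trans (ler_norm_sum _ _ _))//.
apply: ler_sum => j _; rewrite normrM ler_piMr//.
exact: le_trans (l2norm_entry x j) x1.
Qed.
End EntryNorm.

(** * Uniqueness for the Riccati equation *)

Section Riccati.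
Context {R : realType}.
Local Notation n1 := entry_norm.

Lemma riccati_entry_norm_le m (SX SY K L : 'M[R]_m) b : n1 K <= b -> n1 L <= b ->
  n1 (riccati SX SY K - riccati SX SY L) <=
    2 * b * (n1 (invmx SX) + n1 (invmx SY)) * n1 (K - L).
Proof.
move=> Kb Lb; have b0 := le_trans (entry_norm_ge0 K) Kb.
have nX := entry_norm_ge0 (invmx SX); have nY := entry_norm_ge0 (invmx SY).
have nD := entry_norm_ge0 (K - L).
pose E1 := (K - L)^T *m invmx SX *m K + L^T *m invmx SX *m (K - L).
pose E2 := (K - L) *m invmx SY *m K^T + L *m invmx SY *m (K - L)^T.
have -> : riccati SX SY K - riccati SX SY L = - E1 - E2.
  have -> : E1 = K^T *m invmx SX *m K - L^T *m invmx SX *m L.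
    by rewrite /E1 raddfB /= !mulmxBl mulmxBr addrA subrK.
  have -> : E2 = K *m invmx SY *m K^T - L *m invmx SY *m L^T.
    by rewrite /E2 raddfB /= !mulmxBl mulmxBr addrA subrK.
  rewrite /riccati.
  move: (K^T *m _ *m K) (L^T *m _ *m L) (K *m _ *m K^T) (L *m _ *m L^T).
  by move=> U U' V V'; apply/matrixP => i j; rewrite !mxE; ring.
have m3 (U V W : 'M[R]_m) u v w : n1 U <= u -> n1 V <= v -> n1 W <= w ->
    n1 (U *m V *m W) <= u * v * w.
  move=> hU hV hW; rewrite (le_trans (entry_normM _ _))// ler_pM ?entry_norm_ge0//.
  by rewrite (le_trans (entry_normM _ _))// ler_pM ?entry_norm_ge0.
have h1 : n1 (- E1) <= 2 * b * n1 (invmx SX) * n1 (K - L).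
  rewrite entry_normN (le_trans (entry_normD _ _))//.
  have e1 : n1 ((K - L)^T *m invmx SX *m K) <= n1 (K - L) * n1 (invmx SX) * b.
    by apply: m3; rewrite // entry_norm_tr.
  have e2 : n1 (L^T *m invmx SX *m (K - L)) <= b * n1 (invmx SX) * n1 (K - L).
    by apply: m3; rewrite // entry_norm_tr.
  by rewrite (le_trans (lerD e1 e2))// le_eqVlt; apply/orP; left; apply/eqP; ring.
have h2 : n1 (- E2) <= 2 * b * n1 (invmx SY) * n1 (K - L).
  rewrite entry_normN (le_trans (entry_normD _ _))//.
  have e1 : n1 ((K - L) *m invmx SY *m K^T) <= n1 (K - L) * n1 (invmx SY) * b.
    by apply: m3; rewrite // entry_norm_tr.
  have e2 : n1 (L *m invmx SY *m (K - L)^T) <= b * n1 (invmx SY) * n1 (K - L).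
    by apply: m3; rewrite // entry_norm_tr.
  by rewrite (le_trans (lerD e1 e2))// le_eqVlt; apply/orP; left; apply/eqP; ring.
rewrite (le_trans (entry_normD _ _))// (le_trans (lerD h1 h2))//.
by rewrite le_eqVlt; apply/orP; left; apply/eqP; ring.
Qed.

Lemma is_derive_sum_seq I (r : seq I) (F : I -> R -> R) (dF : I -> R) (t : R) :
  (forall i, is_derive t 1 (F i) (dF i)) ->
  is_derive t 1 (fun s => \sum_(i <- r) F i s) (\sum_(i <- r) dF i).
Proof.
move=> h; elim: r => [|i r IH].
  rewrite big_nil (_ : (fun s => _) = cst 0); first exact: is_derive_cst.
  by apply/funext => s; rewrite big_nil.
rewrite big_cons (_ : (fun s => _) = F i + (fun s => \sum_(i <- r) F i s)).
  exact: is_deriveD.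
by apply/funext => s; rewrite big_cons.
Qed.

(** Gronwall: the squared distance u of the two solutions satisfies u' <= C
    u, so u exp (- C t) is nonincreasing at positive times. The equation is
    not assumed at time 0; instead the Lipschitz bounds at 0 show that u
    tends to 0 there. *)
Lemma riccati_unique m (SX SY : 'M[R]_m) (K L : R -> 'M[R]_m) (b l : R) :
  0 <= l ->
  (forall t : R, 0 <= t -> n1 (K t) <= b) -> (forall t : R, 0 <= t -> n1 (L t) <= b) ->
  (forall (t : R) i j, 0 < t -> is_derive t 1 (fun r => K r i j) (riccati SX SY (K t) i j)) ->
  (forall (t : R) i j, 0 < t -> is_derive t 1 (fun r => L r i j) (riccati SX SY (L t) i j)) ->
  (forall (t : R) i j, 0 <= t -> `|K t i j| <= l * t) ->
  (forall (t : R) i j, 0 <= t -> `|L t i j| <= l * t) ->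
  forall t : R, 0 <= t -> K t = L t.
Proof.
move=> l0 Kb Lb dK dL K0 L0 t t0.
pose D s := K s - L s.
pose u s := \sum_i \sum_j (K s i j - L s i j) ^+ 2.
have uE (s : R) : u s = \sum_i \sum_j D s i j ^+ 2.
  by do 2 (apply: eq_bigr => ? _); rewrite /D !mxE.
have u_ge0 (s : R) : 0 <= u s by do 2 (apply: sumr_ge0 => ? _); exact: sqr_ge0.
have b0 := le_trans (entry_norm_ge0 _) (Kb t t0).
pose E s := riccati SX SY (K s) - riccati SX SY (L s).
pose du s := \sum_i \sum_j 2 * D s i j * E s i j.
have u_der (s : R) : 0 < s -> is_derive s 1 u (du s).
  move=> s0; apply: is_derive_sum_seq => i; apply: is_derive_sum_seq => j.
  have hK := dK s i j s0; have hL := dL s i j s0.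
  apply: is_derive_eq.
  rewrite /D /E; have aB (U V : 'M[R]_m) : (U - V) i j = U i j - V i j by rewrite !mxE.
  by rewrite !aB /GRing.scale /=; ring.
pose c := 2 * b * (n1 (invmx SX) + n1 (invmx SY)).
pose C := 2 * c * (m * m)%:R.
have c0 : 0 <= c by rewrite /c !mulr_ge0// addr_ge0// entry_norm_ge0.
have du_le (s : R) : 0 < s -> du s <= C * u s.
  move=> s0; have s0' := ltW s0.
  apply: (@le_trans _ _ (2 * (n1 (D s) * n1 (E s)))).
    rewrite /du /n1 mulr_suml mulr_sumr; apply: ler_sum => i _.
    rewrite mulr_suml mulr_sumr; apply: ler_sum => j _.
    rewrite -mulrA ler_wpM2l// (le_trans (ler_norm _))// normrM ler_wpM2l//.
    exact: entry_le_norm.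
  have hE : n1 (E s) <= c * n1 (D s) := riccati_entry_norm_le SX SY (Kb s s0') (Lb s s0').
  apply: (@le_trans _ _ (2 * (n1 (D s) * (c * n1 (D s))))).
    by rewrite ler_wpM2l// ler_wpM2l// entry_norm_ge0.
  have -> : 2 * (n1 (D s) * (c * n1 (D s))) = 2 * c * n1 (D s) ^+ 2 by ring.
  have -> : C * u s = 2 * c * ((m * m)%:R * u s) by rewrite /C mulrA.
  apply: ler_wpM2l; first by rewrite mulr_ge0.
  by rewrite uE; exact: sqr_entry_norm_le.
pose g s := u s * expR (- C * s).
have g_der (s : R) : 0 < s -> is_derive s 1 g ((du s - C * u s) * expR (- C * s)).
  move=> s0; have := u_der s s0 => hu.
  rewrite /g; apply: is_derive_eq.
  by rewrite /GRing.scale /=; ring.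
have g_dec (s : R) : 0 < s -> s < t -> g t <= g s.
  move=> s0 st.
  have [||x] := @MVT R g (fun s => (du s - C * u s) * expR (- C * s)) s t st.
  - by move=> x /[!in_itv]/= /andP[sx _]; apply: g_der; exact: lt_trans sx.
  - apply: derivable_within_continuous => x /[!in_itv]/= /andP[sx _].
    by have [] := g_der x (lt_le_trans s0 sx).
  rewrite in_itv /= => /andP[sx _] E0.
  rewrite -subr_le0 E0 pmulr_lle0 ?subr_gt0//.
  by rewrite pmulr_lle0 ?expR_gt0// subr_le0 du_le// (lt_trans s0).
have u_small (s : R) : 0 < s -> g s <= (m * m)%:R * (2 * l * s) ^+ 2.
  move=> s0; apply: (@le_trans _ _ (u s)).
    rewrite ler_piMr// -[leRHS]expR0 ler_expR mulNr oppr_le0 mulr_ge0 ?(ltW s0)//.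
    by rewrite /C mulr_ge0// mulr_ge0.
  apply: (@le_trans _ _ (\sum_(i < m) \sum_(j < m) (2 * l * s) ^+ 2)).
    apply: ler_sum => i _; apply: ler_sum => j _.
    rewrite -real_normK ?num_real// ler_sqr ?nnegrE ?mulr_ge0 ?(ltW s0)//.
    rewrite (le_trans (ler_normB _ _))//.
    by have := K0 s i j (ltW s0); have := L0 s i j (ltW s0); lra.
  under eq_bigr do rewrite sumr_const card_ord.
  by rewrite sumr_const card_ord -mulrnA [leRHS]mulr_natl.
move: (t0); rewrite le_eqVlt => /predU1P[<-|tpos].
  apply/matrixP => i j; have := K0 0 i j (lexx 0); have := L0 0 i j (lexx 0).
  by rewrite mulr0 !normr_le0 => /eqP -> /eqP ->.
suff gt0 : g t <= 0.
  have ut0 : u t = 0.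
    apply/eqP; rewrite eq_le u_ge0 andbT.
    by rewrite -(pmulr_lle0 _ (expR_gt0 (- C * t))).
  have Dt : D t = 0.
    apply/eqP; rewrite -subr_eq0 subr0; apply/eqP/matrixP => i j.
    have := entry_le_norm (D t) i j.
    have : n1 (D t) ^+ 2 <= 0.
      by rewrite (le_trans (sqr_entry_norm_le _))// -uE ut0 mulr0.
    rewrite -[X in X <= 0](ger0_norm (sqr_ge0 _)) normr_le0 sqrf_eq0 => /eqP ->.
    by rewrite normr_le0 => /eqP ->; rewrite mxE.
  by apply/eqP; rewrite -subr_eq0; apply/eqP.
rewrite leNgt; apply/negP => gpos.
(* If g t were positive, a time s so small that Z s < g t would contradict
   g t <= g s <= Z s; the minimum below also keeps s in ]0, t[ and below 1. *)
pose Z := (m * m)%:R * (2 * l) ^+ 2 + 1.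
have Z0 : 0 < Z by rewrite ltr_wpDl// mulr_ge0// sqr_ge0.
pose s := Num.min (t / 2) (Num.min 1 (g t / (2 * Z))).
have s0 : 0 < s.
  by rewrite /s !lt_min divr_gt0//= ltr01 divr_gt0// mulr_gt0.
have st : s < t by rewrite /s gt_min; apply/orP; left; lra.
have s1 : s <= 1 by rewrite /s !ge_min lexx !orbT.
have sg : s <= g t / (2 * Z) by rewrite /s !ge_min lexx !orbT.
have h1 := le_trans (g_dec s s0 st) (u_small s s0).
have h2 : (m * m)%:R * (2 * l * s) ^+ 2 <= Z * s.
  have -> : (m * m)%:R * (2 * l * s) ^+ 2 = ((m * m)%:R * (2 * l) ^+ 2) * (s * s) by ring.
  apply: ler_pM.
  - by rewrite mulr_ge0// sqr_ge0.
  - by rewrite mulr_ge0 ?(ltW s0).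
  - by rewrite /Z lerDl.
  - by rewrite ler_piMr ?(ltW s0).
have h3 : Z * s <= g t / 2.
  rewrite (le_trans (ler_wpM2l (ltW Z0) sg))// le_eqVlt; apply/orP; left; apply/eqP.
  by field; rewrite gt_eqF.
lra.
Qed.
End Riccati.

(** * Square roots and orthogonally diagonal matrices *)

Section Sqrt.
Context {R : realType}.

Lemma posdef_semi m (S : 'M[R]_m) : posdefmx S -> possemidefmx S.
Proof.
move=> [sS pS]; split => // x; have [->|x0] := eqVneq x 0; last exact/ltW/pS.
by rewrite mulmx0 mxE.
Qed.

(** Writes the trace as a sum of values of the quadratic form of M, so that
    its sign can be read off. *)
Lemma mxtrace_sandwich m (D M : 'M[R]_m) : D^T = D ->
  \tr (D *m M *m D) = \sum_j ((col j D)^T *m M *m col j D) 0 0.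
Proof.
move=> sD; rewrite /mxtrace; apply: eq_bigr => j _.
rewrite tr_col sD -row_mul colE mulmxA -colE -row_mul.
by rewrite !mxE.
Qed.

(** If D is the difference of two positive semidefinite roots S' and S, then
    S' D + D S = 0. Multiplying by D and taking traces gives tr (D S' D) + tr
    (D S D) = 0, a sum of two nonnegative terms; as S is positive definite, D
    = 0. *)
Lemma sqrtmx_eq m (S A : 'M[R]_m) : posdefmx S -> S *m S = A -> sqrtmx A = S.
Proof.
move=> pS SA.
have : [set S' | possemidefmx S' /\ S' *m S' = A] (sqrtmx A).
  by apply: xgetPex; exists S; split => //; exact: posdef_semi.
move: (sqrtmx A) => S' /= [[sS' pS'] S'A].
have [sS pos] := pS.
pose D := S' - S.
have sD : D^T = D by rewrite /D raddfB /= sS' sS.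
have E : S' *m D + D *m S = 0.
  by rewrite /D mulmxBr mulmxBl S'A SA addrA subrK subrr.
have tr0 : \tr (D *m S' *m D) + \tr (D *m S *m D) = 0.
  rewrite -[X in _ + X]mxtrace_mulC mulmxA -mulmxA -mxtraceD -mulmxA -mulmxDr E.
  by rewrite mulmx0 mxtrace0.
rewrite !mxtrace_sandwich// in tr0.
have g1 j : 0 <= ((col j D)^T *m S' *m col j D) 0 0 by exact: pS'.
have g2 j : 0 <= ((col j D)^T *m S *m col j D) 0 0 by have [_] := posdef_semi pS.
have z : \sum_j ((col j D)^T *m S *m col j D) 0 0 = 0.
  have h1 : 0 <= \sum_j ((col j D)^T *m S' *m col j D) 0 0 by exact: sumr_ge0.
  have h2 : 0 <= \sum_j ((col j D)^T *m S *m col j D) 0 0 by exact: sumr_ge0.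
  by lra.
apply/eqP; rewrite -subr_eq0 -/D; apply/eqP/matrixP => i j; rewrite [RHS]mxE.
have cj : col j D = 0.
  apply/eqP; apply/negPn/negP => /pos.
  have -> : ((col j D)^T *m S *m col j D) 0 0 = 0 := psumr_eq0P (fun j _ => g2 j) z isT.
  by rewrite ltxx.
have <- : col j D i 0 = 0 by rewrite cj mxE.
by rewrite [RHS]mxE.
Qed.
End Sqrt.

Section Diag.
Context {R : realType}.
Variables (m : nat) (Q : 'M[R]_m).
Hypothesis QQ : Q^T *m Q = 1%:M.

Definition conj_diag (Q : 'M[R]_m) (v : 'rV[R]_m) : 'M[R]_m := Q *m diag_mx v *m Q^T.
Local Notation dg := (conj_diag Q).

Lemma conj_diagM v w : dg v *m dg w = dg (\row_i (v 0 i * w 0 i)).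
Proof.
rewrite /conj_diag !mulmxA -[_ *m Q^T *m Q]mulmxA QQ mulmx1.
by rewrite -[Q *m _ *m diag_mx w]mulmxA mulmx_diag.
Qed.

Lemma conj_diag_tr v : (dg v)^T = dg v.
Proof. by rewrite /conj_diag !trmx_mul trmxK tr_diag_mx mulmxA. Qed.

Lemma conj_diagD v w : dg v + dg w = dg (v + w).
Proof. by rewrite /conj_diag raddfD /= mulmxDr mulmxDl. Qed.

Lemma conj_diagN v : - dg v = dg (- v).
Proof. by rewrite /conj_diag raddfN /= mulmxN mulNmx. Qed.

Lemma conj_diag1 : dg (const_mx 1) = 1%:M.
Proof. by rewrite /conj_diag diag_const_mx mulmx1; exact: mulmx1C. Qed.

Lemma conj_diag_inv (v : 'rV[R]_m) : (forall i, v 0 i != 0) ->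
  dg v \in unitmx /\ invmx (dg v) = dg (\row_i (v 0 i)^-1).
Proof.
move=> v0.
have E : dg v *m dg (\row_i (v 0 i)^-1) = 1%:M.
  rewrite conj_diagM -conj_diag1; congr conj_diag; apply/rowP => i.
  by rewrite !mxE mulfV.
have [u _] := mulmx1_unit E; split => //.
by rewrite -[LHS]mulmx1 -E mulmxA mulVmx// mul1mx.
Qed.

Lemma conj_diag_quad v (x : 'cV[R]_m) :
  (x^T *m dg v *m x) 0 0 = \sum_i v 0 i * (Q^T *m x) i 0 ^+ 2.
Proof.
rewrite /conj_diag !mulmxA -[_ *m Q^T *m x]mulmxA.
have -> : x^T *m Q = (Q^T *m x)^T by rewrite trmx_mul trmxK.
move: (Q^T *m x) => y; rewrite mxE; apply: eq_bigr => i _.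
by rewrite mul_mx_diag !mxE; ring.
Qed.

Lemma conj_diag_posdef v : posdefmx (dg v) <-> forall i, 0 < v 0 i.
Proof.
split=> [[_ pos] i|v0].
  have := pos (Q *m delta_mx i 0); rewrite conj_diag_quad mulmxA QQ mul1mx.
  rewrite (bigD1 i)//= big1 ?addr0; last first.
    by move=> k ki; rewrite mxE (negbTE ki) expr0n mulr0.
  rewrite mxE !eqxx expr1n mulr1; apply.
  apply/eqP => /(congr1 (mulmx Q^T)); rewrite mulmxA QQ mul1mx mulmx0.
  move=> /matrixP/(_ i 0); rewrite !mxE !eqxx => /eqP.
  by rewrite oner_eq0.
split; first exact: conj_diag_tr.
move=> x x0; rewrite conj_diag_quad.
have y0 : Q^T *m x != 0.
  apply: contra_neq x0 => /(congr1 (mulmx Q)).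
  by rewrite mulmxA (mulmx1C QQ) mul1mx mulmx0.
rewrite lt_def sumr_ge0 ?andbT; last by move=> i _; rewrite mulr_ge0 ?sqr_ge0 ?ltW.
apply: contra_neq y0 => s0.
apply/matrixP => i j; rewrite [RHS]mxE ord1.
have : v 0 i * (Q^T *m x) i 0 ^+ 2 = 0 :=
  psumr_eq0P (fun i _ => mulr_ge0 (ltW (v0 i)) (sqr_ge0 ((Q^T *m x) i 0))) s0 isT.
by move/eqP; rewrite mulf_eq0 (gt_eqF (v0 i)) /= sqrf_eq0 => /eqP.
Qed.

Lemma sqrtmx_conj_diag (v : 'rV[R]_m) : (forall i, 0 < v 0 i) ->
  sqrtmx (dg v) = dg (\row_i Num.sqrt (v 0 i)).
Proof.
move=> v0; apply: sqrtmx_eq.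
  by apply/conj_diag_posdef => i; rewrite mxE sqrtr_gt0.
rewrite conj_diagM; congr conj_diag; apply/rowP => i.
by rewrite !mxE -expr2 sqr_sqrtr// ltW.
Qed.

(** On eigenvalues, a^(1/2) (a^(1/2) b a^(1/2))^(1/2) a^(-1/2) is (a
    b)^(1/2). *)
Lemma J_OT_conj_diag (a b : 'rV[R]_m) : (forall i, 0 < a 0 i) -> (forall i, 0 < b 0 i) ->
  J_OT (dg a) (dg b) = dg (\row_i (Num.sqrt (a 0 i) * Num.sqrt (b 0 i))).
Proof.
move=> a0 b0; rewrite /J_OT (sqrtmx_conj_diag a0) !conj_diagM.
rewrite sqrtmx_conj_diag; last first.
  by move=> i; rewrite !mxE !mulr_gt0 ?sqrtr_gt0.
rewrite conj_diagM.
have [|_ ->] := @conj_diag_inv (\row_i Num.sqrt (a 0 i)).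
  by move=> i; rewrite mxE gt_eqF// sqrtr_gt0.
rewrite conj_diagM; congr conj_diag; apply/rowP => i; rewrite !mxE.
have sa : 0 < Num.sqrt (a 0 i) by rewrite sqrtr_gt0.
have -> : Num.sqrt (a 0 i) * b 0 i * Num.sqrt (a 0 i) = (Num.sqrt (a 0 i) * Num.sqrt (b 0 i)) ^+ 2.
  by rewrite exprMn (sqr_sqrtr (ltW (b0 i))); ring.
rewrite sqrtr_sqr ger0_norm ?mulr_ge0//.
by field; rewrite gt_eqF.
Qed.

Lemma conj_diag_riccati (a b k : 'rV[R]_m) : (forall i, 0 < a 0 i) -> (forall i, 0 < b 0 i) ->
  riccati (dg a) (dg b) (dg k) =
  dg (\row_i (a 0 i + b 0 i - k 0 i ^+ 2 / a 0 i - k 0 i ^+ 2 / b 0 i)).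
Proof.
move=> a0 b0; rewrite /riccati conj_diag_tr.
have [|_ ->] := @conj_diag_inv a; first by move=> i; rewrite gt_eqF.
have [|_ ->] := @conj_diag_inv b; first by move=> i; rewrite gt_eqF.
rewrite !conj_diagM !conj_diagN !conj_diagD; congr conj_diag; apply/rowP => i.
by rewrite !mxE; ring.
Qed.

End Diag.

(** * The hyperbolic tangent profile *)

Section Tanh.
Context {R : realType}.
(** This is tanh (k t), written with decaying exponentials so that its
    distance to 1 can be read off. *)
Definition scaled_tanh (k t : R) : R := (1 - expR (- 2 * k * t)) / (1 + expR (- 2 * k * t)).

Lemma is_derive_scaled_tanh (k t : R) : is_derive t 1 (scaled_tanh k) (k * (1 - scaled_tanh k t ^+ 2)).
Proof.
have n0 (s : R) : 1 + expR (- 2 * k * s) != 0 by rewrite gt_eqF// addr_gt0// expR_gt0.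
rewrite /scaled_tanh; apply: is_derive_eq.
rewrite /GRing.scale /=; have := n0 t; move: (expR _) => e e0.
by field.
Qed.

Lemma scaled_tanh_bounds (k t : R) : 0 <= k -> 0 <= t ->
  0 <= scaled_tanh k t /\ scaled_tanh k t <= 2 * k * t /\ 1 - scaled_tanh k t <= 2 * expR (- 2 * k * t) /\ scaled_tanh k t <= 1.
Proof.
move=> k0 t0; rewrite /scaled_tanh.
have kt : 0 <= 2 * k * t by rewrite !mulr_ge0.
have := expR_gt0 (- 2 * k * t); have := expR_ge1Dx (- 2 * k * t).
have : expR (- 2 * k * t) <= 1 by rewrite -[leRHS]expR0 ler_expR; lra.
have -> : - 2 * k * t = - (2 * k * t) by ring.
move: (2 * k * t) kt => x x0; move: (expR _) => e e1 ex e0.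
have d0 : 0 < 1 + e by lra.
split; first by rewrite divr_ge0//; lra.
split; first by rewrite ler_pdivrMr//; nra.
split; last by rewrite ler_pdivrMr//; lra.
by rewrite lerBlDr -lerBlDl ler_pdivlMr//; nra.
Qed.
End Tanh.

(** * Simultaneous diagonalisation of commuting symmetric matrices *)

Section RealEigen.
Import complex.
Context {R : realType}.
Local Notation C := (complex R).
Local Notation toC := (map_mx (real_complex R)).

(** Here x + i y is a complex eigenvector of A with eigenvalue p + i q.
    Symmetry gives (x A) y^T = (y A) x^T, which reads q (|x| ^ 2 + |y| ^ 2) =
    0. *)
Lemma sym_eigen_im0 n (A : 'M[R]_n) (x y : 'rV[R]_n) (p q : R) : A^T = A ->
  x *m A = p *: x - q *: y -> y *m A = q *: x + p *: y ->
  (x != 0) || (y != 0) -> q = 0.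
Proof.
move=> sA hx hy xy0.
have E : (x *m A *m y^T) 0 0 = (y *m A *m x^T) 0 0.
  have -> : y *m A *m x^T = (x *m A *m y^T)^T by rewrite !trmx_mul trmxK sA mulmxA.
  by rewrite [RHS]mxE.
have dotC : (x *m y^T) 0 0 = (y *m x^T) 0 0.
  have -> : y *m x^T = (x *m y^T)^T by rewrite trmx_mul trmxK.
  by rewrite [RHS]mxE.
have dot_gt0 (z : 'rV[R]_n) : 0 <= (z *m z^T) 0 0 ?= iff (z == 0).
  split.
    by rewrite mxE sumr_ge0// => j _; rewrite mxE -expr2 sqr_ge0.
  apply/eqP/eqP => [|->]; last by rewrite mul0mx mxE.
  rewrite mxE => /esym h; apply/rowP => j; rewrite mxE.
  have : z 0 j * z^T j 0 = 0.
    by apply: (psumr_eq0P _ h isT) => i _; rewrite mxE -expr2 sqr_ge0.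
  by rewrite mxE => /eqP; rewrite -expr2 sqrf_eq0 => /eqP.
have aD (U V : 'M[R]_1) : (U + V) 0 0 = U 0 0 + V 0 0 by rewrite mxE.
have aN (U : 'M[R]_1) : (- U) 0 0 = - U 0 0 by rewrite mxE.
have aZ c (U : 'M[R]_1) : (c *: U) 0 0 = c * U 0 0 by rewrite mxE.
move: E; rewrite hx hy !mulmxDl mulNmx -!scalemxAl !(aD, aN, aZ) dotC => E.
have [gx ex] := dot_gt0 x; have [gy ey] := dot_gt0 y.
have : q * ((x *m x^T) 0 0 + (y *m y^T) 0 0) = 0 by lra.
move/eqP; rewrite mulf_eq0 => /orP[/eqP //|].
rewrite paddr_eq0// ![_ == 0]eq_sym ex ey => /andP[/eqP x0 /eqP y0].
by move: xy0; rewrite x0 y0 eqxx.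
Qed.

(** Over the complex numbers commuting matrices have a common eigenvector;
    symmetry makes its two eigenvalues real, so its real and imaginary parts
    are eigenvectors too, and one of them is nonzero. *)
Lemma common_real_eigenvector n (A B : 'M[R]_n) : (0 < n)%N ->
  A^T = A -> B^T = B -> A *m B = B *m A ->
  exists (v : 'rV[R]_n) (l k : R), [/\ v != 0, v *m A = l *: v & v *m B = k *: v].
Proof.
move=> n0 sA sB AB.
have ABC : toC A *m toC B = toC B *m toC A by rewrite -!map_mxM AB.
have [v v0 /andP[vA vB]] := common_eigenvector2 n0 ABC.
pose x : 'rV[R]_n := map_mx (@Re R) v; pose y : 'rV[R]_n := map_mx (@Im R) v.
have xy0 : (x != 0) || (y != 0).
  apply: contraNT v0; rewrite negb_or !negbK => /andP[/eqP x0 /eqP y0].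
  apply/eqP/rowP => j; rewrite [RHS]mxE.
  have := congr1 (fun M : 'rV[R]_n => M 0 j) x0; have := congr1 (fun M : 'rV[R]_n => M 0 j) y0.
  by rewrite !mxE; case: (v 0 j) => a b /= -> ->.
have split_eq (M : 'M[R]_n) : stablemx v (toC M) -> exists p q : R,
    x *m M = p *: x - q *: y /\ y *m M = q *: x + p *: y.
  move=> /sub_rVP[l]; case: l => p q E; exists p, q.
  have Ej j : \sum_k v 0 k * (M k j)%:C%C = (p +i* q)%C * v 0 j.
    have := congr1 (fun N : 'rV[C]_n => N 0 j) E; rewrite !mxE => <-.
    by apply: eq_bigr => k _; rewrite mxE.
  have ReM (z : C) (r : R) : Re (z * r%:C%C) = Re z * r.
    by case: z => a b /=; ring.
  have ImM (z : C) (r : R) : Im (z * r%:C%C) = Im z * r.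
    by case: z => a b /=; ring.
  split; apply/rowP => j; rewrite !mxE.
  - have := congr1 (@Re R) (Ej j); rewrite raddf_sum /=.
    under eq_bigr do rewrite ReM.
    rewrite (eq_bigr (fun k => x 0 k * M k j)); last by move=> k _; rewrite mxE.
    by move=> ->; case: (v 0 j) => a b /=.
  - have := congr1 (@Im R) (Ej j); rewrite raddf_sum /=.
    under eq_bigr do rewrite ImM.
    rewrite (eq_bigr (fun k => y 0 k * M k j)); last by move=> k _; rewrite mxE.
    by move=> ->; case: (v 0 j) => a b /=; ring.
have [p [q [hx hy]]] := split_eq A vA.
have [p' [q' [hx' hy']]] := split_eq B vB.
have q0 := sym_eigen_im0 sA hx hy xy0; have q'0 := sym_eigen_im0 sB hx' hy' xy0.
rewrite q0 q'0 !scale0r !subr0 !add0r in hx hy hx' hy'.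
have [x0|x0] := eqVneq x 0; last by exists x, p, p'.
by exists y, p, p'; split => //; move: xy0; rewrite x0 eqxx.
Qed.
End RealEigen.

Section CoDiag.
Context {R : realType}.

(** The reflection in the hyperplane orthogonal to v - e, for e the first basis
    vector. It is the identity matrix if v = e. *)
Lemma householder n (v : 'rV[R]_n.+1) : v *m v^T = 1%:M ->
  exists H : 'M[R]_n.+1, [/\ H^T = H, H *m H = 1%:M & delta_mx 0 0 *m H = v].
Proof.
move=> vv; pose e : 'rV[R]_n.+1 := delta_mx 0 0.
have ee : e *m e^T = 1%:M.
  by rewrite /e trmx_delta mul_delta_mx; apply/matrixP => i j; rewrite !ord1 !mxE.
have [->|ve] := eqVneq v e.
  by exists 1%:M; rewrite trmx1 !mulmx1.
pose w := v - e; pose c := (e *m v^T) 0 0.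
have evc : e *m v^T = c%:M by rewrite [LHS]mx11_scalar.
have vec : v *m e^T = c%:M.
  by rewrite -[LHS]trmxK trmx_mul trmxK evc tr_scalar_mx.
have ww : w *m w^T = (2 - 2 * c)%:M.
  rewrite /w raddfB /= mulmxBl !mulmxBr vv ee evc vec.
  by apply/matrixP => i j; rewrite !ord1 !mxE /=; ring.
have ew : e *m w^T = (c - 1)%:M.
  by rewrite /w raddfB /= mulmxBr ee evc; apply/matrixP => i j; rewrite !ord1 !mxE.
have c1 : 2 - 2 * c != 0.
  apply: contra_neq ve => h; apply/eqP; rewrite -subr_eq0 -/w; apply/eqP/rowP => j.
  have : (w *m w^T) 0 0 = 0 by rewrite ww h mxE mul0rn.
  rewrite mxE => hs; rewrite [RHS]mxE.
  have : w 0 j * w^T j 0 = 0.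
    by apply: (psumr_eq0P _ hs isT) => i _; rewrite [w^T _ _]mxE -expr2 sqr_ge0.
  by rewrite [w^T _ _]mxE => /eqP; rewrite -expr2 sqrf_eq0 => /eqP.
pose g := 2 / (2 - 2 * c).
pose W := w^T *m w.
have WW : W *m W = (2 - 2 * c) *: W.
  by rewrite /W mulmxA -[w^T *m w *m w^T]mulmxA ww mul_mx_scalar -scalemxAl.
have gg : g * (g * (2 - 2 * c)) = g + g by rewrite /g; field.
exists (1%:M - g *: W); split.
- by rewrite raddfB /= trmx1 linearZ /= trmx_mul trmxK.
- rewrite mulmxBr mulmx1 mulmxBl mul1mx -scalemxAl -scalemxAr WW !scalerA -mulrA gg.
  by rewrite scalerDl opprB addrK subrK.
- rewrite mulmxBr mulmx1 -scalemxAr mulmxA ew mul_scalar_mx scalerA.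
  have -> : g * (c - 1) = - 1 by rewrite /g; field.
  by rewrite scaleN1r opprK /w addrC subrK.
Qed.

(** A reflection sends a common unit eigenvector to the first basis vector,
    so both matrices become block diagonal, with a scalar block and a smaller
    pair of commuting symmetric blocks. *)
Lemma sym_codiag n (A B : 'M[R]_n) : A^T = A -> B^T = B -> A *m B = B *m A ->
  exists (Q : 'M[R]_n) (a b : 'rV[R]_n),
    [/\ Q^T *m Q = 1%:M, A = conj_diag Q a & B = conj_diag Q b].
Proof.
elim: n A B => [|n IH] A B sA sB AB.
  by exists 0, 0, 0; split; apply/matrixP => -[].
have [x [l [k [x0 xA xB]]]] := common_real_eigenvector (ltn0Sn n) sA sB AB.
have xx0 : 0 < (x *m x^T) 0 0.
  rewrite mxE lt_def sumr_ge0 ?andbT; last by move=> j _; rewrite mxE -expr2 sqr_ge0.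
  apply: contra_neq x0 => h; apply/rowP => j; rewrite mxE.
  have : x 0 j * x^T j 0 = 0.
    by apply: (psumr_eq0P _ h isT) => i _; rewrite mxE -expr2 sqr_ge0.
  by rewrite mxE => /eqP; rewrite -expr2 sqrf_eq0 => /eqP.
pose d := (x *m x^T) 0 0; rewrite -/d in xx0.
have xxE : x *m x^T = d%:M by rewrite [LHS]mx11_scalar.
pose v := (Num.sqrt d)^-1 *: x.
have vv : v *m v^T = 1%:M.
  rewrite /v linearZ /= -scalemxAl -scalemxAr scalerA xxE scale_scalar_mx.
  by rewrite -invfM -expr2 sqr_sqrtr ?(ltW xx0)// mulVf// gt_eqF.
have vA : v *m A = l *: v by rewrite /v -scalemxAl xA !scalerA mulrC.
have vB : v *m B = k *: v by rewrite /v -scalemxAl xB !scalerA mulrC.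
have [H [sH HH eH]] := householder vv.
have vH : v *m H = delta_mx 0 0 by rewrite -eH -mulmxA HH mulmx1.
have block (M : 'M[R]_n.+1) (r : R) : M^T = M -> v *m M = r *: v ->
    exists N : 'M[R]_n, N^T = N /\
      H *m M *m H = block_mx (r%:M : 'M[R]_1) 0 0 N :> 'M[R]_(1 + n).
  move=> sM vM.
  have [M1 [M1E sM1 eM1]] : exists M1 : 'M[R]_(1 + n), [/\ M1 = H *m M *m H,
      M1^T = M1 & (delta_mx 0 0 : 'rV[R]_(1 + n)) *m M1 = r *: delta_mx 0 0].
    exists (H *m M *m H); split => //; first by rewrite !trmx_mul sH sM mulmxA.
    by rewrite !mulmxA eH vM -scalemxAl vH.
  have row0 j : M1 0 j = r * (j == 0)%:R.
    have := congr1 (fun N : 'rV[R]_(1 + n) => N 0 j) eM1.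
    by rewrite -rowE [LHS]mxE [RHS]mxE [delta_mx _ _ _ _]mxE eqxx.
  have ulE : ulsubmx M1 = r%:M.
    apply/matrixP => i j; rewrite !ord1 !mxE.
    have -> : lshift n (0 : 'I_1) = 0 by apply/val_inj.
    by rewrite row0 eqxx mulr1.
  have urE : ursubmx M1 = 0.
    apply/matrixP => i j; rewrite !ord1 !mxE.
    have -> : lshift n (0 : 'I_1) = 0 by apply/val_inj.
    by rewrite row0 mulr0.
  have dlE : dlsubmx M1 = 0.
    by rewrite -[M1]sM1 -trmx_ursub urE trmx0.
  exists (drsubmx M1); split; first by rewrite trmx_drsub sM1.
  by rewrite -M1E -[LHS]submxK ulE urE dlE.
have [A2 [sA2 EA]] := block A l sA vA.
have [B2 [sB2 EB]] := block B k sB vB.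
have AB2 : A2 *m B2 = B2 *m A2.
  have E (M N : 'M[R]_n.+1) : (H *m M *m H) *m (H *m N *m H) = H *m (M *m N) *m H.
    by rewrite !mulmxA -[_ *m H *m H]mulmxA HH mulmx1.
  have comm : block_mx (l%:M : 'M[R]_1) 0 0 A2 *m block_mx (k%:M : 'M[R]_1) 0 0 B2 =
      block_mx (k%:M : 'M[R]_1) 0 0 B2 *m block_mx (l%:M : 'M[R]_1) 0 0 A2.
    by rewrite -EA -EB [LHS]E [RHS]E AB.
  move: comm; rewrite !mulmx_block => /eq_block_mx[_ _ _].
  by rewrite !mul0mx !add0r.
have [Q2 [a2 [b2 [QQ2 A2E B2E]]]] := IH A2 B2 sA2 sB2 AB2.
pose Qb : 'M[R]_(1 + n) := block_mx 1%:M 0 0 Q2.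
have QQb : Qb^T *m Qb = 1%:M.
  rewrite /Qb tr_block_mx trmx1 !trmx0 mulmx_block !mulmx0 !mul0mx mulmx1 QQ2.
  by rewrite !addr0 !add0r -scalar_mx_block.
have back (M : 'M[R]_n.+1) r M2 (m2 : 'rV[R]_n) :
    H *m M *m H = block_mx (r%:M : 'M[R]_1) 0 0 M2 :> 'M[R]_(1 + n) ->
    M2 = conj_diag Q2 m2 -> M = conj_diag (H *m Qb) (row_mx (r%:M : 'rV[R]_1) m2).
  move=> EM M2E.
  have Dr : diag_mx (row_mx (r%:M : 'rV[R]_1) m2) = block_mx (r%:M : 'M[R]_1) 0 0 (diag_mx m2).
    rewrite diag_mx_row; congr block_mx.
    by apply/matrixP => i j; rewrite !ord1 !mxE.
  have blk : block_mx (r%:M : 'M[R]_1) 0 0 M2 =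
      Qb *m diag_mx (row_mx (r%:M : 'rV[R]_1) m2) *m Qb^T.
    rewrite Dr /Qb tr_block_mx trmx1 !trmx0 !mulmx_block !mulmx0 !mul0mx !mulmx1 !mul1mx.
    by rewrite !addr0 !add0r ?mul0mx ?mulmx0 M2E.
  have -> : M = H *m (H *m M *m H) *m H.
    by rewrite !mulmxA HH mul1mx -mulmxA HH mulmx1.
  by rewrite EM blk /conj_diag trmx_mul sH !mulmxA.
exists (H *m Qb), (row_mx (l%:M : 'rV[R]_1) a2), (row_mx (k%:M : 'rV[R]_1) b2); split.
- by rewrite trmx_mul sH -mulmxA [H *m (H *m _)]mulmxA HH mul1mx.
- exact: back EA A2E.
- exact: back EB B2E.
Qed.
End CoDiag.

(** * The explicit solution and its rate of convergence *)

Section Kappa.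
Context {R : realType}.
Variables (m : nat) (a b : 'rV[R]_m.+1).
Hypothesis a0 : forall i, 0 < a 0 i.
Hypothesis b0 : forall i, 0 < b 0 i.
Local Notation al i := (Num.sqrt (a 0 i)).
Local Notation be i := (Num.sqrt (b 0 i)).

Lemma kappa_iE i : kappa_i a b i = be i / al i + al i / be i.
Proof.
by rewrite /kappa_i !sqrtrM ?(ltW (a0 i)) ?(ltW (b0 i))// !sqrtrV ?(ltW (a0 i)) ?(ltW (b0 i)).
Qed.

(** With x = sqrt a and y = sqrt b this is x ^ 2 + y ^ 2 >= 2 x y. *)
Lemma kappa_i_ge2 i : 2 <= kappa_i a b i.
Proof.
rewrite kappa_iE; have x0 : 0 < al i by rewrite sqrtr_gt0.
have y0 : 0 < be i by rewrite sqrtr_gt0.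
move: (al i) (be i) x0 y0 => x y x0 y0.
have -> : y / x + x / y = (x ^+ 2 + y ^+ 2) / (x * y) by field; rewrite !gt_eqF.
rewrite ler_pdivlMr ?mulr_gt0//.
by have := sqr_ge0 (x - y); nra.
Qed.

Lemma kappa_min_le i : kappa_min a b <= kappa_i a b i.
Proof. exact: bigmin_le. Qed.

Lemma kappa_min_ge2 : 2 <= kappa_min a b.
Proof. by apply: le_bigmin => [|i _]; exact: kappa_i_ge2. Qed.
End Kappa.

Section Explicit.
Context {R : realType}.
Variables (m : nat) (Q : 'M[R]_m.+1) (a b : 'rV[R]_m.+1).
Hypothesis QQ : Q^T *m Q = 1%:M.
Hypothesis a0 : forall i, 0 < a 0 i.
Hypothesis b0 : forall i, 0 < b 0 i.
Local Notation al i := (Num.sqrt (a 0 i)).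
Local Notation be i := (Num.sqrt (b 0 i)).
Local Notation n1 := entry_norm.

(** The solution vanishing at time 0 when the covariances are diagonal in the
    basis Q with eigenvalues a and b. *)
Definition riccati_sol (t : R) : 'M[R]_m.+1 :=
  conj_diag Q (\row_i (al i * be i * scaled_tanh (kappa_i a b i) t)).

Let abk i : al i * be i * kappa_i a b i = a 0 i + b 0 i.
Proof.
have x0 : 0 < al i by rewrite sqrtr_gt0.
have y0 : 0 < be i by rewrite sqrtr_gt0.
have ax : a 0 i = al i ^+ 2 by rewrite sqr_sqrtr// ltW.
have bx : b 0 i = be i ^+ 2 by rewrite sqr_sqrtr// ltW.
rewrite kappa_iE//; move: (al i) (be i) x0 y0 ax bx => x y x0 y0 -> ->.
by field; rewrite !gt_eqF.
Qed.

Let k0 i : 0 <= kappa_i a b i.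
Proof. by rewrite (le_trans _ (kappa_i_ge2 a0 b0 i)). Qed.

Let ab0 i : 0 <= al i * be i.
Proof. by rewrite mulr_ge0. Qed.

Lemma conj_diag_entry v i j : conj_diag Q v i j = \sum_k Q i k * v 0 k * Q j k.
Proof.
rewrite /conj_diag mxE; apply: eq_bigr => k _.
by rewrite mul_mx_diag !mxE.
Qed.

(** With k = sqrt (a b) T and T = tanh (kappa t), both k' and the right-hand
    side a + b - k ^ 2 / a - k ^ 2 / b equal (a + b) (1 - T ^ 2), because
    sqrt (a b) kappa = a + b. *)
Lemma riccati_sol_ode (t : R) i j : is_derive t 1 (fun s => riccati_sol s i j)
  (riccati (conj_diag Q a) (conj_diag Q b) (riccati_sol t) i j).
Proof.
rewrite conj_diag_riccati// conj_diag_entry.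
rewrite (_ : (fun s => _) = (fun s =>
    \sum_k Q i k * (al k * be k * scaled_tanh (kappa_i a b k) s) * Q j k)); last first.
  apply/funext => s; rewrite conj_diag_entry.
  by apply: eq_bigr => k _; rewrite mxE.
apply: is_derive_sum_seq => k.
have h := is_derive_scaled_tanh (kappa_i a b k) t.
apply: is_derive_eq.
rewrite !mxE /GRing.scale /=.
have x0 : 0 < al k by rewrite sqrtr_gt0.
have y0 : 0 < be k by rewrite sqrtr_gt0.
set T := scaled_tanh _ _.
have -> : a 0 k + b 0 k - (al k * be k * T) ^+ 2 / a 0 k - (al k * be k * T) ^+ 2 / b 0 k
   = (a 0 k + b 0 k) * (1 - T ^+ 2).
  have ax : a 0 k = al k ^+ 2 by rewrite sqr_sqrtr// ltW.
  have bx : b 0 k = be k ^+ 2 by rewrite sqr_sqrtr// ltW.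
  move: (al k) (be k) x0 y0 ax bx => x y x0 y0 -> ->.
  by field; rewrite !gt_eqF.
by rewrite -abk; ring.
Qed.

(** Bounds of the eigenvalues by g i times a common factor r give a bound
    with the same factor; r is in turn 1, t and the exponential. *)
Lemma entry_norm_conj_diag (v : 'rV[R]_m.+1) (r : R) (g : 'I_m.+1 -> R) : (forall i, `|v 0 i| <= g i * r) ->
  n1 (conj_diag Q v) <= n1 Q ^+ 2 * (\sum_i g i) * r.
Proof.
move=> vg; rewrite /conj_diag (le_trans (entry_normM _ _))// entry_norm_tr.
have -> : n1 Q ^+ 2 * (\sum_i g i) * r = n1 Q * ((\sum_i g i) * r) * n1 Q by ring.
rewrite ler_wpM2r ?entry_norm_ge0//.
rewrite (le_trans (entry_normM _ _))// ler_wpM2l ?entry_norm_ge0//.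
by rewrite entry_norm_diag mulr_suml; apply: ler_sum => i _.
Qed.

Lemma riccati_sol_bounded (t : R) : 0 <= t ->
  n1 (riccati_sol t) <= n1 Q ^+ 2 * \sum_i (al i * be i).
Proof.
move=> t0; rewrite -[leRHS]mulr1; apply: entry_norm_conj_diag => i.
have [h1 [_ [_ h2]]] := scaled_tanh_bounds (k0 i) t0.
by rewrite mxE (ger0_norm (mulr_ge0 (ab0 i) h1)) ler_wpM2l.
Qed.

(** Only the behaviour at time 0 matters: riccati_unique asks for it. *)
Lemma riccati_sol_lip0 (t : R) : 0 <= t ->
  n1 (riccati_sol t) <= n1 Q ^+ 2 * (\sum_i (al i * be i * (2 * kappa_i a b i))) * t.
Proof.
move=> t0; apply: entry_norm_conj_diag => i.
have [h1 [h2 [_ _]]] := scaled_tanh_bounds (k0 i) t0.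
by rewrite mxE (ger0_norm (mulr_ge0 (ab0 i) h1)) -[leRHS]mulrA ler_wpM2l.
Qed.

Lemma riccati_sol_cvg (t : R) : 0 <= t ->
  n1 (riccati_sol t - J_OT (conj_diag Q a) (conj_diag Q b)) <=
    n1 Q ^+ 2 * (\sum_i (al i * be i * 2)) * expR (- 2 * kappa_min a b * t).
Proof.
move=> t0; rewrite J_OT_conj_diag// /riccati_sol conj_diagN conj_diagD.
apply: entry_norm_conj_diag => i.
have [_ [_ [h1 h2]]] := scaled_tanh_bounds (k0 i) t0.
rewrite !mxE -normrN opprD opprK addrC -{1}[al i * be i]mulr1 -mulrBr.
rewrite ger0_norm; last by rewrite mulr_ge0// subr_ge0.
rewrite -[leRHS]mulrA ler_wpM2l// (le_trans h1)// ler_wpM2l// ler_expR.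
have := kappa_min_le a b i; nra.
Qed.
End Explicit.

Theorem theorem4p3 (R : realType) (d : measure_display) (T : measurableType d)
    (P : probability T R) (n : nat) (Smu Snu : 'M[R]_n.+1)
    (X Y : R -> T -> 'cV[R]_n.+1)
    (Smu_pd : posdefmx Smu) (Snu_pd : posdefmx Snu)
    (Smu_Snu_comm : Smu *m Snu - Snu *m Smu = 0)
    (XY_OCD : L2_OCD P X Y)
    (XY0_indep : independent_vectors P (X 0) (Y 0))
    (X_law : forall t, 0 <= t -> centered_gaussian P Smu (X t))
    (Y_law : forall t, 0 <= t -> centered_gaussian P Snu (Y t))
    (XY_law : forall t, 0 <= t -> jointly_gaussian P (X t) (Y t)) :
  (exists C kappa : R, [/\ 0 < C, 0 < kappa &
     forall t, 0 <= t ->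
       spectral_norm (cross_corr P (X t) (Y t) - J_OT Smu Snu)
         <= C * expR (- 2 * kappa * t)]) /\
  (forall (Q : 'M[R]_n.+1) (smu snu : 'rV[R]_n.+1),
     Q^T *m Q = 1%:M ->
     Smu = Q *m diag_mx smu *m Q^T ->
     Snu = Q *m diag_mx snu *m Q^T ->
     2 <= kappa_min smu snu /\
     exists C : R, 0 < C /\
       forall t, 0 <= t ->
         spectral_norm (cross_corr P (X t) (Y t) - J_OT Smu Snu)
           <= C * expR (- 2 * kappa_min smu snu * t)).
Proof.
have main (Q : 'M[R]_n.+1) (smu snu : 'rV[R]_n.+1) :
     Q^T *m Q = 1%:M ->
     Smu = conj_diag Q smu -> Snu = conj_diag Q snu ->
     2 <= kappa_min smu snu /\
     exists C : R, 0 < C /\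
       forall t, 0 <= t ->
         spectral_norm (cross_corr P (X t) (Y t) - J_OT Smu Snu)
           <= C * expR (- 2 * kappa_min smu snu * t).
  move=> QQ Emu Enu.
  have a0 : forall i, 0 < smu 0 i by apply/(conj_diag_posdef QQ); rewrite -Emu.
  have b0 : forall i, 0 < snu 0 i by apply/(conj_diag_posdef QQ); rewrite -Enu.
  split; first exact: kappa_min_ge2.
  have uX : Smu \in unitmx.
    by rewrite Emu; have [|+ _] := @conj_diag_inv _ _ Q QQ smu => // i; rewrite gt_eqF.
  have uY : Snu \in unitmx.
    by rewrite Enu; have [|+ _] := @conj_diag_inv _ _ Q QQ snu => // i; rewrite gt_eqF.
  have z0 := lexx (0 : R).
  have J0 : cross_corr P (X 0) (Y 0) = 0.
    exact: indep_cross_corr0 (X_law 0 z0) (Y_law 0 z0) (XY_law 0 z0) uX XY0_indep.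
  have [B [B0 hB]] := cross_corr_bounded X_law Y_law.
  have [K K0 hK] := cross_corr_lip uX uY XY_OCD X_law Y_law XY_law.
  pose B1 := \sum_(i < n.+1) \sum_(j < n.+1) B.
  pose B2 := entry_norm Q ^+ 2 * \sum_i (Num.sqrt (smu 0 i) * Num.sqrt (snu 0 i)).
  pose L := entry_norm Q ^+ 2 * (\sum_i (Num.sqrt (smu 0 i) * Num.sqrt (snu 0 i) * (2 * kappa_i smu snu i))).
  have L0 : 0 <= L.
    rewrite /L mulr_ge0 ?sqr_ge0// sumr_ge0// => i _.
    by rewrite mulr_ge0 ?mulr_ge0// (le_trans _ (kappa_i_ge2 a0 b0 i)).
  have B10 : 0 <= B1 by apply: sumr_ge0 => i _; exact: sumr_ge0.
  have B20 : 0 <= B2 by rewrite /B2 mulr_ge0 ?sqr_ge0// sumr_ge0// => i _; rewrite mulr_ge0.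
  have JE t : 0 <= t -> cross_corr P (X t) (Y t) = riccati_sol Q smu snu t.
    apply: (@riccati_unique R n.+1 Smu Snu (fun t => cross_corr P (X t) (Y t))
      (riccati_sol Q smu snu) (B1 + B2) (K + L)).
    - exact: addr_ge0.
    - move=> s s0; apply: (@le_trans _ _ B1); last by rewrite lerDl.
      by apply: ler_sum => i _; apply: ler_sum => j _; exact: hB.
    - move=> s s0; apply: (@le_trans _ _ B2); last by rewrite lerDr.
      exact: riccati_sol_bounded.
    - move=> s i j s0.
      exact: (cross_corr_riccati uX uY XY_OCD X_law Y_law XY_law i j s0).
    - move=> s i j s0; rewrite Emu Enu; exact: riccati_sol_ode.
    - move=> s i j s0; have := hK 0 s z0 s0 i j; rewrite J0 [(0 : 'M[R]_n.+1) i j]mxE !subr0 => h.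
      by rewrite (le_trans h)// ler_wpM2r// lerDl.
    - move=> s i j s0; rewrite (le_trans (entry_le_norm _ _ _))//.
      rewrite (le_trans (@riccati_sol_lip0 _ _ Q _ _ a0 b0 s s0))//.
      by rewrite ler_wpM2r// lerDr.
  pose C := entry_norm Q ^+ 2 * (\sum_i (Num.sqrt (smu 0 i) * Num.sqrt (snu 0 i) * 2)) + 1.
  exists C; split.
    by rewrite /C ltr_wpDl// mulr_ge0 ?sqr_ge0// sumr_ge0.
  move=> t t0; rewrite (le_trans (spectral_norm_le _))// JE// Emu Enu.
  rewrite (le_trans (riccati_sol_cvg QQ a0 b0 t0))//.
  by rewrite ler_wpM2r ?expR_ge0// lerDl.
split; last by move=> Q smu snu QQ Emu Enu; exact: (main Q smu snu QQ Emu Enu).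
have AB : Smu *m Snu = Snu *m Smu by apply/eqP; rewrite -subr_eq0; apply/eqP.
have [Q [smu [snu [QQ Emu Enu]]]] := sym_codiag Smu_pd.1 Snu_pd.1 AB.
have [k2 [C [C0 hC]]] := main Q smu snu QQ Emu Enu.
by exists C, (kappa_min smu snu); split => //; exact: lt_le_trans k2.
Qed.
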